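(* There is an absolute constant $C>0$ such that the following holds. Let $s\ge -\frac34$ and let $u\in C([0,\infty);H^s(\mathbb{R}))$ be a solution of the Korteweg--de Vries initial value problem $$u_t+u_{xxx}-6uu_x=0,\qquad u(0,x)=u_0(x),\qquad x\in\mathbb{R}.$$ Then $$\|u(t,\cdot)\|_{H^{-1}}\le C\left(\|u_0\|_{H^{-1}}+\|u_0\|_{H^{-1}}^3\right)\quad\text{for all } t\in[0,\infty).$$
   Context: $H^s=H^s(\mathbb{R})$ is the usual inhomogeneous $L^2$-based Sobolev space. The KdV initial value problem is known to be globally well-posed in $H^s(\mathbb{R})$ for $s\ge-\frac34$; ''solution'' is understood in the sense of this well-posedness theory (the flow is the continuous extension to $H^s$ of the flow on smooth decaying data). *)

(* Defs.v *)
From mathcomp Require Import all_boot all_order all_algebra.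
From mathcomp Require Import all_classical all_reals all_analysis.

Set Implicit Arguments.
Unset Strict Implicit.
Unset Printing Implicit Defensive.

Import Order.TTheory GRing.Theory Num.Theory.
Import numFieldNormedType.Exports.

Local Open Scope classical_set_scope.
Local Open Scope ring_scope.

(* All functions and distributions are real-valued. *)

Definition schwartz_seminorm (R : realType) (m n : nat) (f : R -> R) : \bar R :=
  ereal_sup (range (fun x : R => (`|x ^+ m * derive1n n f x|)%:E)).

Definition schwartz (R : realType) (f : R -> R) : Prop :=
  (forall (n : nat) (x : R), derivable (derive1n n f) x 1) /\
  (forall m n : nat, (schwartz_seminorm m n f < +oo)%E).

(* A distribution is a functional on R -> R of which only the values at Schwartz
   functions are ever constrained or used.  Continuity on the Schwartz space is
   boundedness by finitely many of its defining seminorms. *)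
Definition tempered (R : realType) (u : (R -> R) -> R) : Prop :=
  (forall (c : R) (f g : R -> R), schwartz f -> schwartz g ->
     u (fun x => c * f x + g x) = c * u f + u g) /\
  (exists (N : nat) (K : R), forall f : R -> R, schwartz f ->
     ((`|u f|)%:E <=
        K%:E * \sum_(m < N) \sum_(n < N) schwartz_seminorm m n f)%E).

Definition eq_dist (R : realType) (u v : (R -> R) -> R) : Prop :=
  forall f : R -> R, schwartz f -> u f = v f.

Definition dist_of_fun (R : realType) (g : R -> R) : (R -> R) -> R :=
  fun f => \int[@lebesgue_measure R]_x (g x * f x).

Definition cos_transform (R : realType) (f : R -> R) (x : R) : R :=
  (Num.sqrt (pi *+ 2))^-1 * \int[@lebesgue_measure R]_xi (cos (x * xi) * f xi).

Definition sin_transform (R : realType) (f : R -> R) (x : R) : R :=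
  (Num.sqrt (pi *+ 2))^-1 * \int[@lebesgue_measure R]_xi (sin (x * xi) * f xi).

(* The Fourier transform of u is the function a + i b: the distributional
   identity <u^, f> = <u, f^>, where
   f^ (x) = (2 pi)^(-1/2) \int e^(- i x xi) f xi dxi
          = cos_transform f x - i sin_transform f x,
   is split into real and imaginary parts. *)
Definition is_fourier (R : realType) (u : (R -> R) -> R) (a b : R -> R) : Prop :=
  [/\ measurable_fun setT a, measurable_fun setT b &
   forall f : R -> R, schwartz f ->
     [/\ (@lebesgue_measure R).-integrable setT (fun xi => (a xi * f xi)%:E),
         (@lebesgue_measure R).-integrable setT (fun xi => (b xi * f xi)%:E),
         \int[@lebesgue_measure R]_xi (a xi * f xi) = u (cos_transform f) &
         \int[@lebesgue_measure R]_xi (b xi * f xi) = - u (sin_transform f)]].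

(* || (1 + xi^2)^(s/2) u^ ||_(L^2).  The function u^ is unique almost everywhere,
   so the infimum is over at most one value; it is +oo when the Fourier
   transform of u is not a function. *)
Definition sobolev_norm (R : realType) (s : R) (u : (R -> R) -> R) : \bar R :=
  ereal_inf [set N : \bar R | exists a b : R -> R, is_fourier u a b /\
    N = ('N[@lebesgue_measure R]_(2%:E)
          [EFin \o (fun xi : R => (1 + xi ^+ 2) `^ (s / 2) *
                                  Num.sqrt (a xi ^+ 2 + b xi ^+ 2))%R])%E].

Definition sobolev (R : realType) (s : R) (u : (R -> R) -> R) : Prop :=
  tempered u /\ (sobolev_norm s u < +oo)%E.

Definition continuous_in_sobolev (R : realType) (s : R)
    (u : R -> (R -> R) -> R) : Prop :=
  (forall t : R, 0 <= t -> sobolev s (u t)) /\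
  (forall t : R, 0 <= t ->
     sobolev_norm s (u r \- u t) @[r --> within [set r : R | 0 <= r] (nbhs t)]
       --> 0%E).

(* v is a classical solution in C^oo([0,oo); Schwartz).  Smoothness in time is
   not listed: the equation together with locally uniform bounds on all Schwartz
   seminorms implies it. *)
Definition schwartz_kdv_solution (R : realType) (v : R -> R -> R) : Prop :=
  [/\ forall t : R, 0 <= t -> schwartz (v t),
      forall (T : R) (m n : nat),
        (ereal_sup [set schwartz_seminorm m n (v t) | t in `[0%R, T]] < +oo)%E,
      forall x : R, {within [set t : R | 0 <= t], continuous (v ^~ x)} &
      forall t x : R, 0 < t ->
        derivable (v ^~ x) t 1 /\
        derive1 (v ^~ x) t + derive1n 3 (v t) x - 6 * v t x * derive1 (v t) x = 0].

(* u = Phi(u0), where Phi : H^s -> C([0,oo); H^s) is the continuous extension of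
   the Schwartz flow: u is the limit in C([0,T]; H^s), for every T, of classical
   Schwartz solutions.  (T = 0 gives convergence of the initial data to u0.) *)
Definition kdv_solution (R : realType) (s : R) (u0 : (R -> R) -> R)
    (u : R -> (R -> R) -> R) : Prop :=
  [/\ sobolev s u0, continuous_in_sobolev s u, eq_dist (u 0) u0 &
   exists v : nat -> R -> R -> R,
     (forall n : nat, schwartz_kdv_solution (v n)) /\
     (forall T : R, 0 <= T ->
        ereal_sup [set sobolev_norm s (dist_of_fun (v n t) \- u t) | t in `[0, T]]
          @[n --> \oo] --> 0%E)].

(* Main.v *)
Require Import Defs.
From mathcomp Require Import all_boot all_order all_algebra.
From mathcomp Require Import all_classical all_reals all_analysis.
From mathcomp Require Import measurable_realfun ring lra.
Import Order.TTheory GRing.Theory Num.Theory.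
Import numFieldNormedType.Exports.
Local Open Scope classical_set_scope.
Local Open Scope ring_scope.

(** The bound rests on a conserved quantity of KdV that is comparable with the
    H^-1 norm.  For k > 0 write q = v' + 2 k v + v^2 (a Miura map; v + k is the
    logarithmic derivative of a positive solution of psi'' = (q + k^2) psi).
    The integral of v is the logarithm of the transmission coefficient of q at
    the energy - k^2, which KdV preserves; the integral of q is preserved too,
    and 2 k int v + int v^2 = int q, so int v^2 is preserved.  The linear part
    v' + 2 k v of the map is an isometry from L^2 onto H^-1 with the weight
    1 / (z^2 + 4 k^2), and the quadratic part is a perturbation when k is large
    compared with the square of the H^-1 norm N of the data.  Taking k of order
    1 + N^2, and paying a factor of order k to return to the usual weight
    1 / (1 + z^2), gives a bound by (1 + N^2) N.

    Let p be the solution of p' + 2 k p = q that decays at both ends.  Then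
    int p^2 is the weighted H^-1 norm squared (resolvent_energy, from
    plancherel).  When int p^2 <= k/8, the correction s = p - v solves the Riccati equation
    s' + 2 k s = (p - s)^2 and is constructed by iteration (riccati_exists);
    int v^2 and int p^2 are then comparable (miura_exists).  Conservation of
    int v^2 (miura_mass_conserved) is proved without differentiating v in time:
    its variational derivative in q is 1 - 2 k phi, with phi the diagonal Green
    function (miura_mass_variation), and the product of 1 - 2 k phi with the KdV
    vector field is an exact x-derivative (miura_mass_kdv_orthogonal).  A
    continuity argument in time keeps int p^2 below k/8
    (resolvent_energy_bound).  Existence, decay and stability of p, v and phi
    are all read off from one comparison principle for linear first-order
    equations on the line (ode_comparison).

    For a general solution u, the bound passes to the limit from the
    approximating Schwartz solutions, by the triangle inequality for the
    distributional H^-1 norm (norm_ltD) and its agreement with the explicit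
    norm on Schwartz functions (schwartz_norm_lt, norm_lt_schwartz). *)

(** * Derivatives of functions of one real variable *)

Section derivatives.
Context {R : realType}.
Implicit Types (f g : R -> R) (a b x : R).

(** The rules below state derivatives of pointwise expressions, so that the
    derivative of a compound expression is assembled as a term and its value is
    then put in shape by a ring identity. *)
Lemma der_eq {f x} a {b} : is_derive x 1 f a -> a = b -> is_derive x 1 f b.
Proof. by move=> ? <-. Qed.

Lemma der_ext {f} g {x a} : is_derive x 1 f a -> f =1 g -> is_derive x 1 g a.
Proof. by move=> fa /funext <-. Qed.

Lemma derD {f g x a b} : is_derive x 1 f a -> is_derive x 1 g b ->
  is_derive x 1 (fun y => f y + g y) (a + b).
Proof. by move=> fa gb; exact: is_deriveD. Qed.

Lemma derN {f x a} : is_derive x 1 f a -> is_derive x 1 (fun y => - f y) (- a).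
Proof. by move=> fa; exact: is_deriveN. Qed.

Lemma derB {f g x a b} : is_derive x 1 f a -> is_derive x 1 g b ->
  is_derive x 1 (fun y => f y - g y) (a - b).
Proof. by move=> fa gb; exact: is_deriveB. Qed.

Lemma derM {f g x a b} : is_derive x 1 f a -> is_derive x 1 g b ->
  is_derive x 1 (fun y => f y * g y) (a * g x + f x * b).
Proof.
move=> fa gb; have := is_deriveM fa gb; rewrite fctE => /der_eq; apply.
by rewrite /GRing.scale /= addrC mulrC.
Qed.

Lemma der_cst c x : is_derive x 1 (fun=> c : R) 0.
Proof. exact: is_derive_cst. Qed.

Lemma der_id x : is_derive x 1 (fun y : R => y) 1.
Proof. exact: is_derive_id. Qed.

Lemma derZ c {f x a} : is_derive x 1 f a -> is_derive x 1 (fun y => c * f y) (c * a).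
Proof.
move=> fa; apply: (der_eq _ (derM (der_cst c x) fa)).
by rewrite mul0r add0r.
Qed.

Lemma der_comp {f g x a b} : is_derive (g x) 1 f a -> is_derive x 1 g b ->
  is_derive x 1 (fun y => f (g y)) (a * b).
Proof. by move=> fa gb; exact: is_derive1_comp. Qed.

Lemma der_expR {f x a} : is_derive x 1 f a ->
  is_derive x 1 (fun y => expR (f y)) (a * expR (f x)).
Proof.
move=> fa; apply: (der_eq _ (der_comp (is_derive_expR _) fa)).
by rewrite mulrC.
Qed.

Lemma der_cos {f x a} : is_derive x 1 f a ->
  is_derive x 1 (fun y => cos (f y)) (- (a * sin (f x))).
Proof.
move=> fa; apply: (der_eq _ (der_comp (is_derive_cos _) fa)).
by rewrite mulNr mulrC.
Qed.

Lemma der_sin {f x a} : is_derive x 1 f a ->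
  is_derive x 1 (fun y => sin (f y)) (a * cos (f x)).
Proof.
move=> fa; apply: (der_eq _ (der_comp (is_derive_sin _) fa)).
by rewrite mulrC.
Qed.

Lemma der_continuous {f x a} : is_derive x 1 f a -> {for x, continuous f}.
Proof. by move=> [/derivable1_diffP /differentiable_continuous]. Qed.

Lemma ders_continuous f f' : (forall x, is_derive x 1 f (f' x)) -> continuous f.
Proof. by move=> ff x; exact: der_continuous (ff x). Qed.

Lemma ders_nondecreasing f f' : (forall x, is_derive x 1 f (f' x)) ->
  (forall x, 0 <= f' x) -> {homo f : x y / x <= y}.
Proof.
move=> ff f'0 x y xy.
have cf := ders_continuous _ _ ff.
have [|c _ E] := MVT_segment xy (fun z _ => ff z).
  exact: continuous_subspaceT.
by rewrite -subr_ge0 E mulr_ge0// subr_ge0.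
Qed.

Lemma ctsD f g : continuous f -> continuous g -> continuous (fun x => f x + g x).
Proof. by move=> cf cg x; apply: (@continuousD _ _ _ f g); [exact: cf|exact: cg]. Qed.
Lemma ctsN f : continuous f -> continuous (fun x => - f x).
Proof. by move=> cf x; apply: (@continuousN _ _ _ f); exact: cf. Qed.
Lemma ctsB f g : continuous f -> continuous g -> continuous (fun x => f x - g x).
Proof. by move=> cf cg x; apply: (@continuousB _ _ _ f g); [exact: cf|exact: cg]. Qed.
Lemma ctsM f g : continuous f -> continuous g -> continuous (fun x => f x * g x).
Proof. by move=> cf cg x; apply: (@continuousM _ _ f g); [exact: cf|exact: cg]. Qed.
Lemma cts_cst (c : R) : continuous (fun _ : R => c).
Proof. by move=> x; exact: cvg_cst. Qed.
Lemma ctsZ c f : continuous f -> continuous (fun x => c * f x).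
Proof. by move=> cf; apply: ctsM => //; exact: cts_cst. Qed.
Lemma ctsX n f : continuous f -> continuous (fun x => f x ^+ n).
Proof.
move=> cf x; apply: (@continuous_comp _ _ _ f (fun y : R => y ^+ n)).
  exact: cf.
exact: exprn_continuous.
Qed.
Lemma cts_comp f g : continuous f -> continuous g -> continuous (fun x => f (g x)).
Proof.
by move=> cf cg x; apply: (@continuous_comp _ _ _ g f); [exact: cg|exact: cf].
Qed.
Lemma cts_abs f : continuous f -> continuous (fun x => `|f x|).
Proof.
move=> cf x; apply: (@continuous_comp _ _ _ f (fun y : R => `|y|)).
  exact: cf.
exact: norm_continuous.
Qed.

End derivatives.

(** * Functions dominated by the Lorentzian 1 / (1 + x^2) *)
Section integration_on_the_line.
Context {R : realType}.
Local Notation mu := (@lebesgue_measure R).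
Implicit Types (f g : R -> R) (K x : R).

Definition lorentz (x : R) : R := (1 + x ^+ 2)^-1.

Lemma oneDsqr_gt0 (x : R) : 0 < 1 + x ^+ 2.
Proof. by rewrite ltr_pwDl ?sqr_ge0. Qed.

Lemma lorentz_gt0 x : 0 < lorentz x.
Proof. by rewrite invr_gt0 oneDsqr_gt0. Qed.

Lemma lorentz_ge0 x : 0 <= lorentz x.
Proof. exact/ltW/lorentz_gt0. Qed.

Lemma lorentz_le1 x : lorentz x <= 1.
Proof. by rewrite invf_le1 ?oneDsqr_gt0// lerDl sqr_ge0. Qed.

Lemma der_lorentz x : is_derive x 1 lorentz (- (2 * x * lorentz x ^+ 2)).
Proof.
have n0 : 1 + x ^+ 2 != 0 by rewrite gt_eqF ?oneDsqr_gt0.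
have H : is_derive x 1 (fun y : R => 1 + y * y) (2 * x).
  apply: (der_eq _ (derD (der_cst 1 x) (derM (der_id x) (der_id x)))).
  by ring.
have Hn : (fun y : R => 1 + y * y) x != 0 by rewrite /= -expr2.
have := is_deriveV (f := fun y : R => 1 + y * y) Hn H => /der_eq /(_ _) D.
have -> : lorentz = fun y : R => (1 + y * y)^-1.
  by apply/funext => y; rewrite /lorentz expr2.
apply: D; rewrite /GRing.scale /= -expr2 exprVn.
by ring.
Qed.

Lemma lorentz_continuous : continuous lorentz.
Proof. exact: ders_continuous der_lorentz. Qed.

(** Follows from 2 |x| <= 1 + x^2.  It makes the Lorentzian a supersolution of
    D' + a D = lorentz for a >= 2, whence all decay estimates for linear
    equations below. *)
Lemma der_lorentz_le x : `|2 * x * lorentz x ^+ 2| <= lorentz x.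
Proof.
rewrite normrM (ger0_norm (exprn_ge0 _ (lorentz_ge0 x))) expr2 mulrA.
rewrite -[leRHS]mul1r ler_wpM2r ?lorentz_ge0//.
rewrite ler_pdivrMr ?oneDsqr_gt0// mul1r ler_norml.
by apply/andP; split; have := sqr_ge0 (x - 1); have := sqr_ge0 (x + 1); nra.
Qed.

(** One explicit integrable majorant serves all functions of x: a bound uniform
    in time is then a single constant K. *)
Definition dominated (K : R) f := forall x, `|f x| <= K * lorentz x.

Lemma dominated_ge0 K f : dominated K f -> 0 <= K.
Proof.
by move=> /(_ 0) fK; rewrite -(pmulr_lge0 _ (lorentz_gt0 0)) (le_trans _ fK).
Qed.

Lemma dominated_bounded K f : dominated K f -> forall x, `|f x| <= K.
Proof.
move=> fK x; apply: le_trans (fK x) _.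
by rewrite ler_piMr ?(dominated_ge0 _ _ fK)// lorentz_le1.
Qed.

Lemma dominatedM K L f g : (forall x, `|f x| <= L) -> dominated K g ->
  dominated (L * K) (fun x => f x * g x).
Proof.
by move=> fL gK x; rewrite normrM -mulrA ler_pM.
Qed.

Lemma dominatedD K L f g : dominated K f -> dominated L g ->
  dominated (K + L) (fun x => f x + g x).
Proof.
by move=> fK gL x; rewrite mulrDl (le_trans (ler_normD _ _)) ?lerD.
Qed.

Lemma dominatedN K f : dominated K f -> dominated K (fun x => - f x).
Proof. by move=> fK x; rewrite normrN. Qed.

Lemma integrable_lorentz : mu.-integrable setT (EFin \o lorentz).
Proof.
apply/integrableP; split.
  by apply/measurable_EFinP; apply: continuous_measurable_fun; exact: lorentz_continuous.
under eq_integral => x _ do rewrite /= ger0_norm ?lorentz_ge0//.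
rewrite ge0_symfun_integralT.
- rewrite -set_itvcy.
  have -> : (\int[mu]_(x in `[0%R, +oo[) (lorentz x)%:E = (pi / 2)%:E)%E.
    exact: integral0y_oneDsqr.
  by rewrite -EFinM ltry.
- exact: lorentz_ge0.
- exact: lorentz_continuous.
- by move=> x; rewrite /= /lorentz sqrrN.
Qed.

Lemma measurable_cts f : continuous f -> measurable_fun setT f.
Proof. exact: continuous_measurable_fun. Qed.

Lemma integrable_dominated_mfun K f : measurable_fun setT f -> dominated K f ->
  mu.-integrable setT (EFin \o f).
Proof.
move=> mf fK.
apply: (@le_integrable _ _ _ mu setT measurableT _ (fun x => (K%:E * (EFin \o lorentz) x)%E)).
- exact/measurable_EFinP.
- move=> x _ /=; rewrite lee_fin (le_trans (fK x))// ler_norm//.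
- exact: integrableZl integrable_lorentz.
Qed.

Lemma integrable_dominated K f : continuous f -> dominated K f ->
  mu.-integrable setT (EFin \o f).
Proof. by move=> /measurable_cts; exact: integrable_dominated_mfun. Qed.

Definition mass : R := \int[mu]_x lorentz x.

Lemma mass_ge0 : 0 <= mass.
Proof. by apply: Rintegral_ge0 => x _; exact: lorentz_ge0. Qed.

Lemma le_norm_integral_dominated K f : measurable_fun setT f -> dominated K f ->
  `|\int[mu]_x f x| <= K * mass.
Proof.
move=> mf fK.
apply: le_trans (le_normr_Rintegral _ _) _ => //.
  exact: integrable_dominated_mfun mf fK.
rewrite -RintegralZl//; last exact: integrable_lorentz.
apply: le_Rintegral => //.
- apply: (integrable_dominated_mfun K); first exact: measurableT_comp.
  by move=> x; rewrite normr_id.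
- by rewrite /comp; under eq_fun do rewrite EFinM; apply: integrableZl => //; exact: integrable_lorentz.
Qed.


End integration_on_the_line.

Section limits_of_integrals.
Context {R : realType}.
Local Notation mu := (@lebesgue_measure R).
Implicit Types (f g : R -> R) (K x : R).

Lemma dominated_cvg_integral K (F : nat -> R -> R) f :
  (forall n, measurable_fun setT (F n)) -> measurable_fun setT f ->
  (forall n, dominated K (F n)) ->
  (forall x, F n x @[n --> \oo] --> f x) ->
  \int[mu]_x F n x @[n --> \oo] --> \int[mu]_x f x.
Proof.
move=> mF mf FK Ff.
have mEF n : measurable_fun setT (EFin \o F n) by exact/measurable_EFinP.
have mEf : measurable_fun setT (EFin \o f) by exact/measurable_EFinP.
have [|||||intf _ cvgI] := @dominated_convergence _ _ _ mu setT measurableT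
  (fun n => EFin \o F n) (EFin \o f) (fun x => (K%:E * (EFin \o lorentz) x)%E).
- exact: mEF.
- exact: mEf.
- apply: aeW => x _ /=; apply: cvg_EFin; last exact: Ff.
  by apply/nearW.
- exact: integrableZl integrable_lorentz.
- by apply: aeW => x n _ /=; rewrite lee_fin FK.
apply: fine_cvg; rewrite fineK; first exact: cvgI.
exact: integrable_fin_num.
Qed.

Lemma cvg_lorentz_nat : lorentz (n.+1%:R : R) @[n --> \oo] --> 0.
Proof.
apply: (@squeeze_cvgr _ _ _ _ (fun=> 0) (fun n => n.+1%:R^-1)).
- apply: nearW => n; rewrite lorentz_ge0 /=.
  rewrite lef_pV2 ?posrE ?oneDsqr_gt0//.
  have : (1 : R) <= n.+1%:R by rewrite ler1n.
  by move: (n.+1%:R) => y; nra.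
- exact: cvg_cst.
- exact: cvg_harmonic.
Qed.

Lemma lorentzN x : lorentz (- x) = lorentz x.
Proof. by rewrite /lorentz sqrrN. Qed.

(** Integrate over [- n - 1, n + 1], where the integral is a difference of two
    values of F, and let n tend to infinity. *)
Lemma integral_derivative_eq0 K L F f : (forall x, is_derive x 1 F (f x)) ->
  continuous f -> dominated L f -> dominated K F -> \int[mu]_x f x = 0.
Proof.
move=> Ff cf fL FK.
pose D n : set R := `[- n.+1%:R, n.+1%:R]%classic.
have cI : \int[mu]_(x in D n) f x @[n --> \oo] --> \int[mu]_x f x.
  under eq_fun do rewrite Rintegral_mkcond.
  apply: (dominated_cvg_integral L).
  - move=> n; have mD : measurable (D n) by exact: measurable_itv.
    by apply: (measurable_restrictT f mD).1; apply: measurable_funTS; exact: measurable_cts.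
  - exact: measurable_cts.
  - move=> n x; rewrite patchE; case: ifPn => _; first exact: fL.
    by rewrite normr0 mulr_ge0 ?lorentz_ge0// (dominated_ge0 _ _ fL).
  - move=> x; apply: cvg_near_cst; near=> n.
    rewrite patchE ifT// inE /D /= in_itv /= -ler_norml.
    rewrite (le_trans (ltW (archi_boundP (normr_ge0 x))))// ler_nat ltnW// ltnS.
    by near: n; exact: nbhs_infty_ge.
have cF : F n.+1%:R - F (- n.+1%:R) @[n --> \oo] --> 0.
  apply: norm_cvg0; apply: (@squeeze_cvgr _ _ _ _ (fun=> 0) (fun n => (K + K) * lorentz n.+1%:R)).
  - apply: nearW => n; rewrite normr_ge0 /= (le_trans (ler_normB _ _))//.
    by rewrite mulrDl lerD ?FK// -(lorentzN n.+1%:R) FK.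
  - exact: cvg_cst.
  - by rewrite -(mulr0 (K + K)); apply: cvgMl_tmp; exact: cvg_lorentz_nat.
have E : (fun n => \int[mu]_(x in D n) f x) = (fun n => F n.+1%:R - F (- n.+1%:R)).
  apply/funext => n; rewrite /Rintegral (@continuous_FTC2 _ f F).
  - by [].
  - by rewrite gtrN ?ltr0n.
  - exact: continuous_subspaceT.
  - split.
    + by move=> x _; have [] := Ff x.
    + by apply: cvg_at_right_filter; exact: (der_continuous (Ff _)).
    + by apply: cvg_at_left_filter; exact: (der_continuous (Ff _)).
  - by move=> x _; rewrite derive1E; have [_ ->] := Ff x.
rewrite E in cI.
exact: cvg_unique cI cF.
Unshelve. all: by end_near. Qed.

End limits_of_integrals.

(** * Linear first-order equations on the line *)

Section primitives.
Context {R : realType}.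
Local Notation mu := (@lebesgue_measure R).
Implicit Types (f g : R -> R) (K x : R).

Lemma near_nat_gt x : \forall n \near \oo, `|x| < n.+1%:R.
Proof.
near=> n; apply: lt_le_trans (archi_boundP (normr_ge0 x)) _.
by rewrite ler_nat ltnW// ltnS; near: n; exact: nbhs_infty_ge.
Unshelve. all: by end_near. Qed.

(** A local majorant on each left half-line is enough to integrate from -oo:
    this covers both decaying functions and exponentials. *)
Lemma primitive_Ny g : continuous g ->
  (forall u, exists K, forall y, y <= u -> `|g y| <= K * lorentz y) ->
  exists P : R -> R, [/\ forall x, is_derive x 1 P (g x),
    P (- n.+1%:R) @[n --> \oo] --> 0 &
    forall K, dominated K g -> P n.+1%:R @[n --> \oo] --> \int[mu]_x g x].
Proof.
move=> cg gK.
pose D x : set R := `]-oo, x]%classic.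
have mD x : measurable (D x) by exact: measurable_itv.
have mg := measurable_cts _ cg.
have Dm x : measurable_fun setT (g \_ (D x)).
  by apply: (measurable_restrictT g (mD x)).1; apply: measurable_funTS.
have Dd u x K : x <= u -> (forall y, y <= u -> `|g y| <= K * lorentz y) ->
    dominated K (g \_ (D x)).
  move=> xu K_ y; rewrite patchE; case: ifPn => [/set_mem|_].
    by rewrite /D /= in_itv /= => yx; apply: K_; exact: le_trans xu.
  rewrite normr0 mulr_ge0 ?lorentz_ge0//.
  by rewrite -(pmulr_lge0 _ (lorentz_gt0 u)) (le_trans _ (K_ u (lexx _))).
have gint x : mu.-integrable (D x) (EFin \o g).
  have [K gKx] := gK x.
  apply/integrable_mkcond; first exact: measurable_itv.
  rewrite restrict_EFin.
  exact: (integrable_dominated_mfun _ _ (Dm x) (Dd x x K (lexx _) gKx)).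
exists (fun x => \int[mu]_(y in D x) g y); split.
- move=> x; have [dP P'] := @continuous_FTC1 R g -oo%O x (x + 1)
    ltac:(by rewrite ltrDl) (gint _) (ltNyr _) (cg x).
  by apply: DeriveDef; [exact: dP|rewrite -derive1E; exact: P'].
- under eq_fun do rewrite Rintegral_mkcond.
  have [K gK0] := gK 0.
  have -> : 0 = \int[mu]_(x in setT) 0 :> R by rewrite /Rintegral integral0.
  apply: (dominated_cvg_integral K) => //.
  + by move=> n; apply: (Dd 0) => //; rewrite oppr_le0.
  + move=> x; apply: cvg_near_cst; near=> n.
    rewrite patchE ifF//; apply/negbTE; rewrite notin_setE /D /= in_itv /=.
    apply/negP; rewrite -ltNge ltrNl (le_lt_trans (ler_norm _))// normrN.
    by near: n; exact: near_nat_gt.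
- move=> K gd; under eq_fun do rewrite Rintegral_mkcond.
  apply: (dominated_cvg_integral K) => //.
  + by move=> n; apply: (Dd n.+1%:R).
  + move=> x; apply: cvg_near_cst; near=> n.
    rewrite patchE ifT// inE /D /= in_itv /=.
    by rewrite (le_trans (ler_norm _))// ltW//; near: n; exact: near_nat_gt.
Unshelve. all: by end_near. Qed.

Lemma nondecreasing_ge0 F : {homo F : x y / x <= y} ->
  F (- n.+1%:R) @[n --> \oo] --> (0 : R) -> forall x, 0 <= F x.
Proof.
move=> mF cF x; rewrite -(cvg_lim _ cF)//; apply: limr_le; first by apply/cvg_ex; exists 0.
near=> n; apply: mF; rewrite lerNl.
by rewrite (le_trans (ler_norm _))// normrN ltW//; near: n; exact: near_nat_gt.
Unshelve. all: by end_near. Qed.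

Lemma nondecreasing_le F l : {homo F : x y / x <= y} ->
  F n.+1%:R @[n --> \oo] --> (l : R) -> forall x, F x <= l.
Proof.
move=> mF cF x; rewrite -(cvg_lim _ cF)//; apply: limr_ge; first by apply/cvg_ex; exists l.
near=> n; apply: mF.
by rewrite (le_trans (ler_norm _))// ltW//; near: n; exact: near_nat_gt.
Unshelve. all: by end_near. Qed.

End primitives.

Section linear_equation.
Context {R : realType}.
Local Notation mu := (@lebesgue_measure R).
Implicit Types (f g : R -> R) (K x : R).

Lemma expR_le_lorentz (z : R) : z <= 0 -> expR z <= 2 * lorentz z.
Proof.
move=> z0; rewrite ler_pdivlMr ?oneDsqr_gt0//.
have E : 1 + z ^+ 2 / 2 <= expR (- z).
  by rewrite -(sqrrN z) (expR_ge1Dxn 1) ?oppr_ge0.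
have ee : expR z * expR (- z) = 1 by rewrite -expRD subrr expR0.
have e0 := expR_gt0 z.
have : expR z * (1 + z ^+ 2 / 2) <= 1 by rewrite -[leRHS]ee ler_wpM2l// ltW.
by lra.
Qed.

(** Shifting y by 2 |u| makes the exponent negative on y <= u without making y
    smaller in absolute value. *)
Lemma expR_le_lorentz_left (a : R) (u y : R) : 0 < a -> y <= u ->
  expR (a * y) <= expR (2 * a * `|u|) * 2 * (1 + a ^- 2) * lorentz y.
Proof.
move=> a0 yu; pose w := y - 2 * `|u|.
have uu := ler_norm u; have u0 := normr_ge0 u.
have w0 : w <= 0 by rewrite /w; lra.
have -> : a * y = 2 * a * `|u| + a * w by rewrite /w; ring.
rewrite expRD -!mulrA ler_wpM2l ?expR_ge0//.
have aw0 : a * w <= 0 by rewrite pmulr_rle0.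
apply: (le_trans (expR_le_lorentz _ aw0)); rewrite ler_wpM2l//.
rewrite /lorentz ler_pdivlMr ?oneDsqr_gt0// mulrC ler_pdivrMr ?oneDsqr_gt0//.
have yw : y ^+ 2 <= w ^+ 2.
  rewrite -ler_sqrt ?sqr_ge0// !sqrtr_sqr (ler0_norm w0) ler_norml /w.
  by apply/andP; split; lra.
have -> : (1 + a ^- 2) * (1 + (a * w) ^+ 2) = 1 + w ^+ 2 + a ^- 2 + a ^+ 2 * w ^+ 2.
  by field; rewrite gt_eqF.
have : 0 <= a ^- 2 by rewrite invr_ge0 sqr_ge0.
have : 0 <= a ^+ 2 * w ^+ 2 by rewrite mulr_ge0 ?sqr_ge0.
by lra.
Qed.

Lemma cvg_expR_Nnat (a : R) : 0 < a -> expR (a * - n.+1%:R) @[n --> \oo] --> 0.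
Proof.
move=> a0.
apply: (@squeeze_cvgr _ _ _ _ (fun=> 0) (fun n => a^-1 * n.+1%:R^-1)).
- apply: nearW => n; rewrite expR_ge0 /= mulrN expRN -invfM.
  rewrite lef_pV2 ?posrE ?expR_gt0 ?mulr_gt0//.
  by rewrite (le_trans _ (expR_ge1Dx _))// lerDr.
- exact: cvg_cst.
- by rewrite -(mulr0 a^-1); apply: cvgMl_tmp; exact: cvg_harmonic.
Qed.

Section comparison.
Variables (a M B : R) (U u D D' : R -> R).
Hypotheses (a0 : 0 < a) (Uu : forall x, is_derive x 1 U (u x))
  (UM : forall x, `|U x| <= M) (DB : forall x, `|D x| <= B)
  (DD : forall x, is_derive x 1 D (D' x)).

(** Multiplication by exp (a x + U x) turns the hypothesis into monotonicity of
    a function that tends to 0 at -oo, because D and U are bounded and a > 0.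
    All pointwise estimates on the solutions of differential equations in this
    file are instances of this comparison with an explicit supersolution. *)
Lemma ode_comparison : (forall x, 0 <= D' x + (a + u x) * D x) ->
  forall x, 0 <= D x.
Proof.
move=> D'ge x; set E := fun x => expR (a * x + U x) * D x.
have mE : {homo E : x y / x <= y}.
  apply: (ders_nondecreasing E (fun x => expR (a * x + U x) * (D' x + (a + u x) * D x))).
    move=> y; apply: (der_eq _ (derM (der_expR (derD (derZ a (der_id y)) (Uu y))) (DD y))).
    by rewrite mulr1; ring.
  by move=> y; rewrite mulr_ge0 ?expR_ge0.
rewrite leNgt; apply/negP => Dx0.
have Ex0 : 0 < - E x by rewrite oppr_gt0 /E pmulr_rlt0 ?expR_gt0.
have B0 : 0 <= B by exact: le_trans (DB x).
pose C := B * expR M; have C0 : 0 <= C by rewrite mulr_ge0 ?expR_ge0.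
(* a point far enough to the left that C exp (a y) < - E x *)
pose y : R := - (`|x| + C / (- E x) / a).
have yx : y <= x.
  rewrite /y opprD (le_trans _ (lerNnormlW (lexx `|x|)))// gerDl oppr_le0.
  by rewrite !divr_ge0// ltW.
have Ey : - E y <= C * expR (a * y).
  rewrite (le_trans (ler_norm _))// normrN /E normrM gtr0_norm ?expR_gt0//.
  rewrite mulrC /C -mulrA ler_pM ?expR_ge0// expRD mulrC.
  by rewrite ler_wpM2r ?expR_ge0// ler_expR (le_trans (ler_norm _)).
have := mE _ _ yx; rewrite -lerN2 => /le_trans /(_ Ey).
apply/negP; rewrite -ltNge.
have -> : a * y = - (a * `|x| + C / (- E x)).
  by rewrite /y mulrN mulrDr mulrCA mulfV ?gt_eqF// mulr1.
rewrite expRN ltr_pdivrMr ?expR_gt0//.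
apply: lt_le_trans (_ : - E x * (1 + (a * `|x| + C / (- E x))) <= _).
  rewrite mulrDr mulr1 mulrDr [X in _ + (_ + X)]mulrCA mulfV ?gt_eqF// mulr1.
  rewrite addrA ltrDr ltr_pwDl//.
  by rewrite mulr_ge0 ?(ltW Ex0)// mulr_ge0// ltW.
by rewrite ler_wpM2l ?expR_ge1Dx//; exact: ltW.
Qed.

End comparison.

(** The solution is the one obtained with the integrating factor exp (a x + U x)
    by integration from -oo; it is bounded because |g| <= N e^M e^(a x), whose
    primitive is N e^M e^(a x) / a. *)
Lemma linear_ode (a M N : R) (U u f : R -> R) : 0 < a -> (forall x, is_derive x 1 U (u x)) ->
  (forall x, `|U x| <= M) -> continuous f -> (forall x, `|f x| <= N) ->
  exists D : R -> R, (forall x, is_derive x 1 D (f x - (a + u x) * D x)) /\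
    exists B : R, forall x, `|D x| <= B.
Proof.
move=> a0 Uu UM cf fN.
pose g x := expR (a * x + U x) * f x.
have N0 : 0 <= N by exact: le_trans (fN 0).
have ex_le x : expR (a * x + U x) <= expR M * expR (a * x).
  by rewrite expRD mulrC ler_wpM2r ?expR_ge0// ler_expR (le_trans (ler_norm _)).
have dE x : is_derive x 1 (fun x => expR (a * x + U x)) ((a + u x) * expR (a * x + U x)).
  apply: (der_eq _ (der_expR (derD (derZ a (der_id x)) (Uu x)))).
  by rewrite mulr1.
have cg : continuous g by apply: ctsM => //; exact: ders_continuous dE.
have gle y : `|g y| <= N * expR M * expR (a * y).
  by rewrite /g normrM gtr0_norm ?expR_gt0// mulrC -mulrA ler_pM.
have [t|P [P' P0 _]] := primitive_Ny g cg.
  exists (N * expR M * (expR (2 * a * `|t|) * 2 * (1 + a ^- 2))) => y yt.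
  apply: (le_trans (gle y)); rewrite -[leRHS]mulrA.
  rewrite ler_wpM2l ?(mulr_ge0 N0) ?expR_ge0//.
  exact: expR_le_lorentz_left.
exists (fun x => expR (- (a * x + U x)) * P x); split.
  move=> x; apply: (der_eq _ (derM (der_expR (derN (derD (derZ a (der_id x)) (Uu x)))) (P' x))).
  by rewrite /g mulr1 mulrA -expRD addNr expR0; ring.
exists (N * expR M * expR M / a) => x.
have dX (y : R) : is_derive y 1 (fun y : R => N * expR M / a * expR (a * y)) (N * expR M * expR (a * y)).
  apply: (der_eq _ (derZ (N * expR M / a) (der_expR (derZ a (der_id y))))).
  by rewrite mulr1; field; rewrite gt_eqF.
have cX : N * expR M / a * expR (a * - n.+1%:R) @[n --> \oo] --> 0.
  by rewrite -(mulr0 (N * expR M / a)); apply: cvgMl_tmp; exact: cvg_expR_Nnat.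
have H1 : 0 <= N * expR M / a * expR (a * x) - P x.
  apply: (nondecreasing_ge0 (fun x => N * expR M / a * expR (a * x) - P x)).
    apply: ders_nondecreasing (fun x => derB (dX x) (P' x)) _ => y.
    by rewrite subr_ge0 (le_trans (ler_norm _)).
  by rewrite -(subr0 0); apply: cvgB.
have H2 : 0 <= N * expR M / a * expR (a * x) + P x.
  apply: (nondecreasing_ge0 (fun x => N * expR M / a * expR (a * x) + P x)).
    apply: ders_nondecreasing (fun x => derD (dX x) (P' x)) _ => y.
    by rewrite -(opprK (g y)) subr_ge0 (le_trans (ler_norm _))// normrN.
  by rewrite -(addr0 0); apply: cvgD.
rewrite normrM gtr0_norm ?expR_gt0//.
apply: le_trans (_ : expR M * expR (- (a * x)) * (N * expR M / a * expR (a * x)) <= _).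
  rewrite ler_pM ?expR_ge0//.
    rewrite opprD expRD mulrC ler_wpM2r ?expR_ge0// ler_expR.
    by rewrite (le_trans (ler_norm _))// normrN.
  by rewrite ler_norml; apply/andP; split; lra.
have ee : expR (- (a * x)) * expR (a * x) = 1 by rewrite -expRD addNr expR0.
rewrite le_eqVlt; apply/orP; left; apply/eqP.
rewrite [LHS](_ : _ = expR (- (a * x)) * expR (a * x) * (N * expR M * expR M / a)); last by ring.
by rewrite ee mul1r.
Qed.

End linear_equation.

(** * The Riccati equation *)

Section riccati.
Context {R : realType}.
Local Notation mu := (@lebesgue_measure R).
Implicit Types (f g : R -> R) (K x : R).

Lemma le_geometric_le0 (A B : R) : (forall n, A <= B * (3 / 4) ^+ n) -> A <= 0.
Proof.
move=> AB.
have c0 : B * (3 / 4) ^+ n @[n --> \oo] --> B * 0.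
  by apply: cvgMl_tmp; apply: cvg_expr; rewrite ger0_norm; lra.
rewrite mulr0 in c0; rewrite -(cvg_lim _ c0)//; apply: limr_ge.
  by apply/cvg_ex; exists 0.
by apply: nearW.
Qed.

Lemma geometric_limit (u : nat -> R) (C : R) :
  (forall n, `|u n.+1 - u n| <= C * (3 / 4) ^+ n) ->
  exists l, forall n, `|l - u n| <= 4 * C * (3 / 4) ^+ n.
Proof.
move=> uC.
pose a n := u n + 4 * C * (3 / 4) ^+ n.
pose b n := u n - 4 * C * (3 / 4) ^+ n.
have C0 : 0 <= C by rewrite -[C]mulr1 -(expr0 (3 / 4)) (le_trans _ (uC 0))// normr_ge0.
have t0 n : 0 <= (3 / 4 : R) ^+ n by rewrite exprn_ge0//; lra.
have aS n : a n.+1 <= a n.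
  by have := uC n; rewrite /a exprS ler_norml => /andP[_]; lra.
have bS n : b n <= b n.+1.
  by have := uC n; rewrite /b exprS ler_norml => /andP[+ _]; lra.
have ba n m : b n <= a m.
  have bl i : b n <= b (n + i)%N.
    by elim: i => [|i ih]; rewrite ?addn0// addnS (le_trans ih).
  have al i : a (m + i)%N <= a m.
    by elim: i => [|i ih]; rewrite ?addn0// addnS (le_trans _ ih).
  rewrite (le_trans (bl m))// (le_trans _ (al n))// addnC /a /b.
  by have := mulr_ge0 C0 (t0 (m + n)%N); lra.
have hs : has_sup (range b).
  split; first by exists (b 0), 0.
  by exists (a 0) => _ [n _ <-].
exists (sup (range b)) => n; rewrite ler_norml; apply/andP; split.
  by rewrite lerBrDl; apply: sup_upper_bound => //; exists n.
rewrite lerBlDl; apply: ge_sup; first by exists (b 0), 0.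
by move=> _ [m _ <-]; exact: ba.
Qed.

Lemma lipschitz_continuous (f : R -> R) (L : R) :
  (forall x y, `|f x - f y| <= L * `|x - y|) -> continuous f.
Proof.
move=> fL x; apply/cvgrPdist_le => e e0.
have L1 : 0 < `|L| + 1 by rewrite ltr_wpDl.
near=> y.
rewrite (le_trans (fL _ _))// (le_trans (ler_wpM2r (normr_ge0 _) (_ : L <= `|L| + 1)))//.
  by rewrite ler_wpDr// ler_norm.
rewrite mulrC -ler_pdivlMr//.
by near: y; apply: cvgr_dist_le => //; rewrite divr_gt0.
Unshelve. all: by end_near. Qed.

Lemma ders_lipschitz (f f' : R -> R) (L : R) : (forall x, is_derive x 1 f (f' x)) ->
  (forall x, `|f' x| <= L) -> forall x y, `|f x - f y| <= L * `|x - y|.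
Proof.
move=> ff fL.
suff H x y : x <= y -> `|f x - f y| <= L * `|x - y|.
  move=> x y; have [|/ltW] := leP x y; first exact: H.
  by rewrite distrC (distrC x); exact: H.
move=> xy; have [|c _ E] := MVT_segment xy (fun z _ => ff z).
  by apply: continuous_subspaceT; exact: ders_continuous ff.
by rewrite distrC E normrM (distrC x) ler_wpM2r.
Qed.

(** The equation s' + 2 k s = (p - s)^2 is solved by Picard iteration among
    functions with values in [0, k/2].  That interval is invariant, and the
    iteration contracts a weighted supremum norm, because the integral of p^2 is
    at most k/8: no bound on the size of p itself enters. *)
Section existence.
Variables (k K : R) (p : R -> R).
Hypotheses (k2 : 2 <= k) (cp : continuous p) (pK : dominated K p)
  (pe : \int[mu]_x p x ^+ 2 <= k / 8).

Let k0 : 0 < k. Proof. exact: lt_le_trans k2. Qed.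

(* a Lipschitz constant of all iterates, which passes to the limit *)
Let lip := (K + k / 2) ^+ 2 + 2 * k * (k / 2).

Let admissible (s : R -> R) := (forall x, 0 <= s x <= k / 2) /\
  (forall x y, `|s x - s y| <= lip * `|x - y|).

Let solves (s D : R -> R) :=
  forall x, is_derive x 1 D ((p x - s x) ^+ 2 - 2 * k * D x).

Lemma sqr_dominated f L : dominated L f -> dominated (L ^+ 2) (fun x => f x ^+ 2).
Proof.
move=> fL x; rewrite normrX; apply: (@le_trans _ _ ((L * lorentz x) ^+ 2)).
  by rewrite lerXn2r ?nnegrE ?mulr_ge0 ?lorentz_ge0// (dominated_ge0 _ _ fL).
rewrite exprMn ler_wpM2l ?sqr_ge0// expr2 ler_piMr ?lorentz_ge0//.
exact: lorentz_le1.
Qed.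

Lemma primitive_sqr : exists2 G : R -> R,
  forall x, is_derive x 1 G (p x ^+ 2) & forall x, 0 <= G x <= k / 8.
Proof.
have kge2 := k2; have kgt0 := k0.
have cp2 : continuous (fun x => p x ^+ 2) by exact: ctsX.
have p2 := sqr_dominated _ _ pK.
have [u|G [G' G0 Gy]] := primitive_Ny _ cp2; first by exists (K ^+ 2) => y _.
exists G => // x.
have mG : {homo G : x y / x <= y}.
  by apply: ders_nondecreasing G' _ => y; exact: sqr_ge0.
by rewrite (nondecreasing_ge0 _ mG G0)/= (le_trans _ pe)// (nondecreasing_le _ _ mG (Gy _ p2)).
Qed.

Let der0 x : is_derive x 1 (fun=> 0 : R) 0. Proof. exact: der_cst. Qed.

(** With G a primitive of p^2 vanishing at -oo, 2 G + k/4 is a supersolution, and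
    it is at most k/2. *)
Lemma riccati_step s : admissible s -> exists D, admissible D /\ solves s D.
Proof.
have kge2 := k2; have kgt0 := k0.
move=> [sk sL]; have cs := lipschitz_continuous _ _ sL.
have cf : continuous (fun x => (p x - s x) ^+ 2) by apply: ctsX; exact: ctsB.
have fN x : `|(p x - s x) ^+ 2| <= (K + k / 2) ^+ 2.
  rewrite normrX lerXn2r ?nnegrE//.
    by rewrite addr_ge0 ?(dominated_ge0 _ _ pK)//; lra.
  rewrite (le_trans (ler_normB _ _))// lerD ?(dominated_bounded _ _ pK)//.
  by have /andP[s0 s1] := sk x; rewrite ger0_norm.
have [||D [D' [B DB]]] := linear_ode (2 * k) 0 _ _ _ _ _ der0 _ cf fN; first lra.
  by move=> x; rewrite normr0.
have {}D' : solves s D.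
  by move=> x; apply: (der_eq _ (D' x)); rewrite addr0.
have [G G' Gk] := primitive_sqr.
have D0 : forall x, 0 <= D x.
  apply: (ode_comparison (2 * k) 0 B _ _ _ _ _ der0 _ DB D'); first lra.
    by move=> x; rewrite normr0.
  by move=> x; rewrite addr0 subrK sqr_ge0.
have Dk x : D x <= k / 2.
  have Z x0 : 0 <= 2 * G x0 + k / 4 - D x0.
    apply: (ode_comparison (2 * k) 0 (k + B) _ _ (fun x => 2 * G x + k / 4 - D x) _ _ der0 _ _
      (fun y => derB (derD (derZ 2 (G' y)) (der_cst _ y)) (D' y))); first lra.
    - by move=> y; rewrite normr0.
    - move=> y; rewrite (le_trans (ler_normB _ _))// lerD// ger0_norm.
        by have := Gk y; lra.
      by have := Gk y; lra.
    - move=> y; have := sk y; have := Gk y => /andP[G0 _] /andP[s0 s1].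
      have := mulr_ge0 (ltW k0) G0; have : s y ^+ 2 <= (k / 2) ^+ 2.
        by rewrite lerXn2r// nnegrE; lra.
      have := sqr_ge0 (p y + s y); nra.
  by have := Z x; have := Gk x; lra.
exists D; split=> //; split=> [x|]; first by rewrite D0 Dk.
apply: (ders_lipschitz _ _ _ D') => x.
rewrite (le_trans (ler_normB _ _))// lerD//.
by rewrite ger0_norm ?mulr_ge0//; [rewrite ler_wpM2l//; lra|lra].
Qed.

(** The difference of two images solves a linear equation whose source is
    (t - s) (2 p - s - t), and |2 p - s - t| <= 5 k/4 + 4 p^2/k.  The weight
    b = exp (8 G / k) satisfies (3/4) (b' + 2 k b) = (3 k/2 + 6 p^2/k) b, which
    exceeds that bound. *)
Lemma riccati_contraction G s t S T M :
  (forall x, is_derive x 1 G (p x ^+ 2)) -> (forall x, 0 <= G x <= k / 8) ->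
  admissible s -> admissible t -> admissible S -> admissible T ->
  solves s S -> solves t T ->
  (forall x, `|s x - t x| <= M * expR (8 / k * G x)) ->
  forall x, `|S x - T x| <= 3 / 4 * M * expR (8 / k * G x).
Proof.
have kge2 := k2; have kgt0 := k0.
move=> G' Gk [sk _] [tk _] [Sk _] [Tk _] S' T' stM.
pose b x := expR (8 / k * G x).
have b' x : is_derive x 1 b (8 / k * p x ^+ 2 * b x).
  exact: der_expR (derZ _ (G' x)).
have b0 x : 0 < b x by exact: expR_gt0.
have bB x : `|b x| <= expR 1.
  rewrite gtr0_norm// ler_expR; have /andP[_ Gx] := Gk x.
  by rewrite mulrAC ler_pdivrMr// mul1r; lra.
have M0 : 0 <= M.
  by have := stM 0; rewrite -(pmulr_lge0 _ (b0 0)); exact: le_trans.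
have stp x : `|(s x - t x) * (2 * p x - s x - t x)| <= M * b x * (5 / 4 * k + 4 / k * p x ^+ 2).
  rewrite normrM ler_pM//; have := sk x; have := tk x => /andP[t0 t1] /andP[s0 s1].
  have H : 2 * `|p x| <= k / 4 + 4 / k * p x ^+ 2.
    rewrite -subr_ge0.
    have -> : k / 4 + 4 / k * p x ^+ 2 - 2 * `|p x| = (`|p x| - k / 4) ^+ 2 * (4 / k).
      by rewrite sqrrB real_normK ?num_real//; field; lra.
    by rewrite mulr_ge0 ?sqr_ge0// divr_ge0//; lra.
  have := ler_norm (p x); have := ler_norm (- p x); rewrite normrN => h1 h2.
  by rewrite ler_norml; apply/andP; split; lra.
have main sg : sg = 1 \/ sg = -1 -> forall x, 0 <= 3 / 4 * M * b x - sg * (S x - T x).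
  move=> sg1.
  apply: (ode_comparison (2 * k) 0 (3 / 4 * M * expR 1 + k) _ _
    (fun x => 3 / 4 * M * b x - sg * (S x - T x)) _ _ der0 _ _
    (fun y => derB (derZ _ (b' y)) (derZ sg (derB (S' y) (T' y))))); first lra.
  - by move=> y; rewrite normr0.
  - move=> y; rewrite (le_trans (ler_normB _ _))// lerD//.
      rewrite normrM ler_pM// ger0_norm ?mulr_ge0//; lra.
    have := Sk y; have := Tk y => /andP[t0 t1] /andP[s0 s1].
    by case: sg1 => ->; rewrite ler_norml; apply/andP; split; lra.
  - move=> y; rewrite addr0.
    rewrite [leRHS](_ : _ = 3 / 4 * M * b y * (2 * k + 8 / k * p y ^+ 2) +
       sg * ((s y - t y) * (2 * p y - s y - t y))); last by ring.
    have : M * b y * (5 / 4 * k + 4 / k * p y ^+ 2) <= 3 / 4 * M * b y * (2 * k + 8 / k * p y ^+ 2).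
      rewrite [leRHS](_ : _ = M * b y * (3 / 2 * k + 6 / k * p y ^+ 2)); last by field; lra.
      have i0 : 0 <= k^-1 by rewrite invr_ge0 ltW.
      rewrite ler_wpM2l ?mulr_ge0 ?(ltW (b0 y))//.
      by have := mulr_ge0 i0 (sqr_ge0 (p y)); lra.
    have := stp y; rewrite ler_norml => /andP[].
    by case: sg1 => ->; lra.
move=> x; rewrite ler_norml; apply/andP; split.
  by have := main (-1) (or_intror erefl) x; rewrite /b; lra.
by have := main 1 (or_introl erefl) x; rewrite /b; lra.
Qed.

Lemma riccati_exists : exists s : R -> R, (forall x, 0 <= s x <= k / 2) /\
  forall x, is_derive x 1 s ((p x - s x) ^+ 2 - 2 * k * s x).
Proof.
have kge2 := k2; have kgt0 := k0.
have [G G' Gk] := primitive_sqr.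
have K0 := dominated_ge0 _ _ pK.
have lip0 : 0 <= lip by rewrite addr_ge0 ?sqr_ge0// mulr_ge0; lra.
have a0 : admissible (fun=> 0).
  split=> [x|x y]; first by rewrite lexx divr_ge0//; lra.
  by rewrite subrr normr0 mulr_ge0.
have [T TP] : exists T : (R -> R) -> (R -> R), forall s, admissible s -> admissible (T s) /\ solves s (T s).
  suff [f ?] : {f & forall s, admissible s -> admissible (f s) /\ solves s (f s)} by exists f.
  apply: (@choice _ _ (fun s D => admissible s -> admissible D /\ solves s D)) => s.
  have [/riccati_step[D HD]|ns] := pselect (admissible s); first by exists D.
  by exists s => /ns.
pose s n := iter n T (fun=> 0).
have sA n : admissible (s n) by elim: n => [//|n /TP []].
have sS n : solves (s n) (s n.+1) by have [] := TP _ (sA n).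
have sC n x : `|s n.+1 x - s n x| <= k / 2 * (3 / 4) ^+ n * expR (8 / k * G x).
  elim: n x => [|n ih].
    move=> x; rewrite expr0 mulr1 /= subr0.
    have /andP[s0 s1] := (sA 1%N).1 x; rewrite ger0_norm// (le_trans s1)//.
    rewrite ler_peMr//; first lra.
    have /andP[Gx _] := Gk x.
    by rewrite -expR0 ler_expR mulr_ge0// divr_ge0// ltW.
  move=> x; rewrite exprS mulrCA.
  exact: (riccati_contraction G _ _ _ _ _ G' Gk (sA n.+1) (sA n) (sA n.+2) (sA n.+1) (sS n.+1) (sS n)).
have [l lP] : exists l : R -> R, forall x n, `|l x - s n x| <= 4 * (k / 2 * expR (8 / k * G x)) * (3 / 4) ^+ n.
  suff [f ?] : {f & forall x n, `|f x - s n x| <= 4 * (k / 2 * expR (8 / k * G x)) * (3 / 4) ^+ n} by exists f.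
  apply: (@choice _ _ (fun x l => forall n, `|l - s n x| <= 4 * (k / 2 * expR (8 / k * G x)) * (3 / 4) ^+ n)) => x.
  by apply: geometric_limit => n; rewrite mulrAC.
have lA : admissible l.
  split=> [x|x y].
    apply/andP; split.
      rewrite -oppr_le0; apply: (le_geometric_le0 _ (4 * (k / 2 * expR (8 / k * G x)))) => n.
      have /andP[+ _] := (sA n).1 x.
      by have := lP x n; rewrite ler_norml => /andP[]; lra.
    rewrite -subr_le0; apply: (le_geometric_le0 _ (4 * (k / 2 * expR (8 / k * G x)))) => n.
    have /andP[_] := (sA n).1 x.
    by have := lP x n; rewrite ler_norml => /andP[]; lra.
  rewrite -subr_le0; apply: (le_geometric_le0 _ (4 * (k / 2 * expR (8 / k * G x)) + 4 * (k / 2 * expR (8 / k * G y)))) => n.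
  have tri : `|l x - l y| <= `|l x - s n x| + `|l y - s n y| + `|s n x - s n y|.
    have -> : l x - l y = (l x - s n x) - (l y - s n y) + (s n x - s n y) by ring.
    by rewrite (le_trans (ler_normD _ _))// lerD2r ler_normB.
  rewrite lerBlDr (le_trans tri)// lerD ?(sA n).2//.
  by rewrite [leRHS]mulrDl lerD.
have [TA TS] := TP _ lA.
have E : T l = l.
  apply/funext => x; apply/eqP; rewrite -subr_eq0 -normr_le0.
  apply: (le_geometric_le0 _ (3 / 4 * (4 * (k / 2)) * expR (8 / k * G x) +
    3 * (k / 2 * expR (8 / k * G x)))) => n.
  have h1 := riccati_contraction G _ _ _ _ (4 * (k / 2) * (3 / 4) ^+ n) G' Gk
    lA (sA n) TA (sA n.+1) TS (sS n) _ x.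
  have h2 := lP x n.+1.
  have -> : T l x - l x = (T l x - s n.+1 x) - (l x - s n.+1 x) by ring.
  rewrite (le_trans (ler_normB _ _))// (le_trans (lerD (h1 _) h2))//.
    by move=> y; rewrite (le_trans (lP y n))// le_eqVlt; apply/orP; left; apply/eqP; ring.
  by rewrite exprS le_eqVlt; apply/orP; left; apply/eqP; field.
exists l; split; first by case: lA.
by move=> x; have := TS x; rewrite E.
Qed.

End existence.
End riccati.

(** * The Miura map *)

Section miura.
Context {R : realType}.
Local Notation mu := (@lebesgue_measure R).
Implicit Types (f g : R -> R) (K x y : R).

(** The supersolution is K exp (M - U) / (1 + x^2): the factor exp (- U) absorbs
    the variable part u of the coefficient. *)
Lemma ode_decay (a M B K : R) (U u D D' : R -> R) : 2 <= a -> 0 <= K ->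
  (forall x, is_derive x 1 U (u x)) -> (forall x, `|U x| <= M) ->
  (forall x, `|D x| <= B) -> (forall x, is_derive x 1 D (D' x)) ->
  (forall x, D' x + (a + u x) * D x <= K * lorentz x) ->
  forall x, D x <= K * expR (2 * M) * lorentz x.
Proof.
move=> a2 K0 Uu UM DB DD' DK x.
pose b x := expR (M - U x) * lorentz x.
have b' (y : R) : is_derive y 1 b (- u y * b y - expR (M - U y) * (2 * y * lorentz y ^+ 2)).
  apply: (der_eq _ (derM (der_expR (derB (der_cst M y) (Uu y))) (der_lorentz y))).
  by rewrite /b; ring.
have MU y : M - U y <= 2 * M.
  by have := UM y; rewrite ler_norml => /andP[]; lra.
have b0 y : 0 <= b y by rewrite mulr_ge0 ?expR_ge0 ?lorentz_ge0.
have bM y : b y <= expR (2 * M) * lorentz y.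
  by rewrite ler_wpM2r ?lorentz_ge0// ler_expR.
have bM' y : b y <= expR (2 * M).
  by rewrite (le_trans (bM y))// ler_piMr ?expR_ge0// lorentz_le1.
have : 0 <= K * b x - D x.
  apply: (ode_comparison a M (K * expR (2 * M) + B) U u (fun x => K * b x - D x) _ _ Uu UM _
    (fun y => derB (derZ K (b' y)) (DD' y))); first lra.
  - move=> y; rewrite (le_trans (ler_normB _ _))// lerD//.
    by rewrite (ger0_norm (mulr_ge0 K0 (b0 y))) ler_wpM2l.
  - move=> y.
    have h1 : expR (M - U y) * (2 * y * lorentz y ^+ 2) <= b y.
      rewrite ler_wpM2l ?expR_ge0// (le_trans (ler_norm _))//.
      exact: der_lorentz_le.
    have h2 : lorentz y <= b y.
      rewrite ler_peMl ?lorentz_ge0// -expR0 ler_expR.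
      by have := UM y; rewrite ler_norml => /andP[_]; lra.
    have h3 : K * lorentz y <= K * (- u y * b y - expR (M - U y) * (2 * y * lorentz y ^+ 2) + (a + u y) * b y).
      rewrite ler_wpM2l//.
      have : 2 * b y <= a * b y by rewrite ler_wpM2r.
      by lra.
    by have := DK y; lra.
rewrite subr_ge0 => /le_trans; apply.
by rewrite -mulrA ler_wpM2l.
Qed.

Lemma ode_dominated (a M B K : R) (U u D f : R -> R) : 2 <= a ->
  (forall x, is_derive x 1 U (u x)) -> (forall x, `|U x| <= M) ->
  (forall x, `|D x| <= B) ->
  (forall x, is_derive x 1 D (f x - (a + u x) * D x)) ->
  dominated K f -> dominated (K * expR (2 * M)) D.
Proof.
move=> a2 Uu UM DB DD fK x; have K0 := dominated_ge0 _ _ fK.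
rewrite ler_norml lerNl; apply/andP; split.
  apply: (ode_decay a M B K U u (fun x => - D x) _ a2 K0 Uu UM _ (fun y => derN (DD y))).
    by move=> y; rewrite normrN.
  move=> y; rewrite mulrN opprB addrAC subrr add0r (le_trans _ (fK y))//.
  by rewrite -normrN ler_norm.
apply: (ode_decay a M B K U u D _ a2 K0 Uu UM DB DD) => y.
by rewrite subrK (le_trans _ (fK y))// ler_norm.
Qed.

Lemma constant_coefficient_dominated (a B K : R) (D f : R -> R) : 2 <= a ->
  (forall x, `|D x| <= B) -> (forall x, is_derive x 1 D (f x - a * D x)) ->
  dominated K f -> dominated K D.
Proof.
move=> a2 DB DD fK.
suff : dominated (K * expR (2 * 0)) D by rewrite mulr0 expR0 mulr1.
apply: (ode_dominated a 0 B K (fun=> 0) (fun=> 0) D f a2 _ _ DB) => //.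
- by move=> x; rewrite normr0.
- by move=> x; rewrite addr0.
Qed.

Lemma resolvent_exists (a K : R) (f : R -> R) : 2 <= a -> continuous f -> dominated K f ->
  exists2 D, dominated K D & forall x, is_derive x 1 D (f x - a * D x).
Proof.
move=> a2 cf fK.
have [||||D [DD [B DB]]] := linear_ode a 0 K (fun=> 0) (fun=> 0) f.
- by lra.
- by move=> x; rewrite normr0.
- exact: cf.
- exact: dominated_bounded.
have DD' x : is_derive x 1 D (f x - a * D x) by apply: (der_eq _ (DD x)); rewrite addr0.
by exists D => //; exact: constant_coefficient_dominated DB DD' fK.
Qed.

Lemma primitive_bounded (K : R) v : continuous v -> dominated K v ->
  exists2 V : R -> R, forall x, is_derive x 1 V (v x) & forall x, `|V x| <= K * mass.
Proof.
move=> cv vK; have K0 := dominated_ge0 _ _ vK.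
have [u|V [V' V0 _]] := primitive_Ny _ cv; first by exists K => y _.
have [u|L [L' L0 Ly]] := primitive_Ny _ (@lorentz_continuous R).
  by exists 1 => y _; rewrite mul1r ger0_norm ?lorentz_ge0.
have Lm x : L x <= mass.
  apply: (nondecreasing_le _ _ _ (Ly 1 _)).
    by apply: ders_nondecreasing L' _ => y; exact: lorentz_ge0.
  by move=> y; rewrite mul1r ger0_norm ?lorentz_ge0.
exists V => // x.
have H1 : 0 <= K * L x - V x.
  apply: (nondecreasing_ge0 (fun x => K * L x - V x)).
    apply: ders_nondecreasing (fun y => derB (derZ K (L' y)) (V' y)) _ => y.
    by rewrite subr_ge0 (le_trans (ler_norm _)).
  by rewrite -(subr0 0) -{1}(mulr0 K); apply: cvgB => //; exact: cvgMl_tmp.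
have H2 : 0 <= K * L x + V x.
  apply: (nondecreasing_ge0 (fun x => K * L x + V x)).
    apply: ders_nondecreasing (fun y => derD (derZ K (L' y)) (V' y)) _ => y.
    by rewrite -(opprK (v y)) subr_ge0 (le_trans (ler_norm _))// normrN.
  by rewrite -(addr0 0) -{1}(mulr0 K); apply: cvgD => //; exact: cvgMl_tmp.
have H3 : K * L x <= K * mass by rewrite ler_wpM2l.
by rewrite ler_norml; apply/andP; split; lra.
Qed.

Lemma dominated_integralD K L f g : continuous f -> continuous g -> dominated K f ->
  dominated L g -> \int[mu]_x (f x + g x) = \int[mu]_x f x + \int[mu]_x g x.
Proof.
by move=> cf cg fK gL; apply: RintegralD => //; [exact: integrable_dominated fK|exact: integrable_dominated gL].
Qed.
Lemma dominated_integralB K L f g : continuous f -> continuous g -> dominated K f ->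
  dominated L g -> \int[mu]_x (f x - g x) = \int[mu]_x f x - \int[mu]_x g x.
Proof.
by move=> cf cg fK gL; apply: RintegralB => //; [exact: integrable_dominated fK|exact: integrable_dominated gL].
Qed.
Lemma dominated_integralZ K (c : R) f : continuous f -> dominated K f ->
  \int[mu]_x (c * f x) = c * \int[mu]_x f x.
Proof.
by move=> cf fK; apply: RintegralZl => //; exact: integrable_dominated fK.
Qed.
Lemma le_dominated_integral K L f g : continuous f -> continuous g -> dominated K f ->
  dominated L g -> (forall x, f x <= g x) -> \int[mu]_x f x <= \int[mu]_x g x.
Proof.
move=> cf cg fK gL fg; apply: le_Rintegral => //.
- exact: integrable_dominated fK.
- exact: integrable_dominated gL.
Qed.

Lemma dominatedZ (c K : R) f : dominated K f -> dominated (`|c| * K) (fun x => c * f x).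
Proof. by move=> fK; apply: (dominatedM _ _ (fun=> c)). Qed.

Lemma dominatedB K L f g : dominated K f -> dominated L g ->
  dominated (K + L) (fun x => f x - g x).
Proof. by move=> fK gL; apply: dominatedD => //; exact: dominatedN. Qed.

(** Domination and boundedness without explicit constants, for the identities
    in which only the vanishing of boundary terms at infinity matters. *)
Definition decays f := exists K, dominated K f.
Definition bounded_fun f := exists B, forall x, `|f x| <= B.

Lemma decays_bounded f : decays f -> bounded_fun f.
Proof. by move=> [K fK]; exists K; exact: dominated_bounded. Qed.
Lemma decaysD f g : decays f -> decays g -> decays (fun x => f x + g x).
Proof. by move=> [K fK] [L gL]; exists (K + L); exact: dominatedD. Qed.
Lemma decaysN f : decays f -> decays (fun x => - f x).
Proof. by move=> [K fK]; exists K; exact: dominatedN. Qed.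
Lemma decaysB f g : decays f -> decays g -> decays (fun x => f x - g x).
Proof. by move=> df dg; apply: decaysD => //; exact: decaysN. Qed.
Lemma decaysM f g : bounded_fun f -> decays g -> decays (fun x => f x * g x).
Proof. by move=> [K fK] [L gL]; exists (K * L); exact: dominatedM. Qed.
Lemma decaysMr f g : decays f -> bounded_fun g -> decays (fun x => f x * g x).
Proof. by move=> df dg; have [K gK] := decaysM _ _ dg df; exists K => x; rewrite mulrC. Qed.
Lemma decaysX2 f : decays f -> decays (fun x => f x ^+ 2).
Proof. by move=> [K fK]; exists (K ^+ 2); exact: sqr_dominated. Qed.
Lemma bounded_cst (c : R) : bounded_fun (fun=> c).
Proof. by exists `|c|. Qed.
Lemma decaysZ (c : R) f : decays f -> decays (fun x => c * f x).
Proof. by apply: decaysM; exact: bounded_cst. Qed.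
Lemma boundedD f g : bounded_fun f -> bounded_fun g -> bounded_fun (fun x => f x + g x).
Proof.
move=> [K fK] [L gL]; exists (K + L) => x.
by rewrite (le_trans (ler_normD _ _))// lerD.
Qed.
Lemma boundedN f : bounded_fun f -> bounded_fun (fun x => - f x).
Proof. by move=> [K fK]; exists K => x; rewrite normrN. Qed.
Lemma boundedB f g : bounded_fun f -> bounded_fun g -> bounded_fun (fun x => f x - g x).
Proof. by move=> bf bg; apply: boundedD => //; exact: boundedN. Qed.
Lemma boundedM f g : bounded_fun f -> bounded_fun g -> bounded_fun (fun x => f x * g x).
Proof. by move=> [K fK] [L gL]; exists (K * L) => x; rewrite normrM ler_pM. Qed.
Lemma boundedX2 f : bounded_fun f -> bounded_fun (fun x => f x ^+ 2).
Proof. by move=> bf; exact: boundedM. Qed.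
Lemma boundedZ (c : R) f : bounded_fun f -> bounded_fun (fun x => c * f x).
Proof. by apply: boundedM; exact: bounded_cst. Qed.

Lemma integral_derivative_decays (F f : R -> R) : (forall x, is_derive x 1 F (f x)) ->
  continuous f -> decays f -> decays F -> \int[mu]_x f x = 0.
Proof. by move=> Ff cf [L fL] [K FK]; exact: integral_derivative_eq0 FK. Qed.

(** q = v' + 2 k v + v^2: then v + k is the logarithmic derivative of a positive
    solution of psi'' = (q + k^2) psi that behaves like exp (k x) at both ends. *)
Definition miura_solution (k : R) (q v : R -> R) :=
  forall x, is_derive x 1 v (q x - 2 * k * v x - v x ^+ 2).

(** v = p - s, where p is the solution of the linearised equation and s >= 0
    solves the Riccati equation.  Integrating that equation gives
    int v^2 = 2 k int s, and (p - s)^2 <= 2 p^2 + k s, p^2 <= 2 v^2 + k s because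
    0 <= s <= k/2; these make int v^2 and int p^2 comparable. *)
Lemma miura_exists (k K : R) (q p : R -> R) : 2 <= k -> dominated K p ->
  (forall x, is_derive x 1 p (q x - 2 * k * p x)) -> \int[mu]_x p x ^+ 2 <= k / 8 ->
  exists v, [/\ miura_solution k q v, dominated (K + 2 * K ^+ 2) v,
    \int[mu]_x v x ^+ 2 <= 4 * \int[mu]_x p x ^+ 2 &
    \int[mu]_x p x ^+ 2 <= 5 / 2 * \int[mu]_x v x ^+ 2].
Proof.
move=> k2 pK p' pe; have cp := ders_continuous _ _ p'.
have [s [sk s']] := riccati_exists k K p k2 cp pK pe.
have cs := ders_continuous _ _ s'.
have p2K := sqr_dominated _ _ pK.
have sK : dominated (2 * K ^+ 2) s.
  move=> x; have /andP[s0 _] := sk x; rewrite ger0_norm//.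
  suff : s x <= 2 * K ^+ 2 * expR (2 * 0) * lorentz x by rewrite mulr0 expR0 mulr1.
  apply: (ode_decay k 0 (k / 2) _ (fun=> 0) (fun=> 0) s _ k2 _ _ _ _ s').
  - by rewrite mulr_ge0// sqr_ge0.
  - by move=> y; rewrite normr0.
  - by move=> y; have /andP[? ?] := sk y; rewrite ger0_norm.
  - move=> y; rewrite addr0.
    have := p2K y; rewrite ger0_norm ?sqr_ge0//.
    have := sk y => /andP[a0 a1].
    have : s y * s y <= k / 2 * s y by rewrite ler_wpM2r.
    have := sqr_ge0 (p y + s y); nra.
pose v x := p x - s x.
have vK : dominated (K + 2 * K ^+ 2) v by exact: dominatedB.
have v' : miura_solution k q v.
  by move=> x; apply: (der_eq _ (derB (p' x) (s' x))); rewrite /v; ring.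
have cv := ders_continuous _ _ v'.
have v2K := sqr_dominated _ _ vK.
have E : \int[mu]_x v x ^+ 2 = 2 * k * \int[mu]_x s x.
  have : \int[mu]_x (v x ^+ 2 - 2 * k * s x) = 0.
    have dom := dominatedB _ _ _ _ v2K (dominatedZ (2 * k) _ _ sK).
    apply: (integral_derivative_eq0 _ _ s _ s' _ dom sK).
    by apply: ctsB; [exact: ctsX|exact: ctsZ].
  rewrite (dominated_integralB _ _ _ _ _ _ v2K (dominatedZ (2 * k) _ _ sK)); last 2 first.
  - exact: ctsX.
  - exact: ctsZ.
  by rewrite (dominated_integralZ _ _ _ cs sK) => /eqP; rewrite subr_eq0 => /eqP.
exists v; split=> //.
- have : \int[mu]_x v x ^+ 2 <= \int[mu]_x (2 * p x ^+ 2 + k * s x).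
    apply: (le_dominated_integral _ _ _ _ _ _ v2K (dominatedD _ _ _ _ (dominatedZ 2 _ _ p2K) (dominatedZ k _ _ sK))).
    + exact: ctsX.
    + by apply: ctsD; apply: ctsZ => //; exact: ctsX.
    + move=> x; rewrite /v; have /andP[a0 a1] := sk x.
      have : s x * s x <= k / 2 * s x by rewrite ler_wpM2r.
      have := sqr_ge0 (p x + s x); nra.
  rewrite (dominated_integralD _ _ _ _ _ _ (dominatedZ 2 _ _ p2K) (dominatedZ k _ _ sK)); last 2 first.
  - by apply: ctsZ; exact: ctsX.
  - exact: ctsZ.
  rewrite (dominated_integralZ _ _ _ _ p2K); last exact: ctsX.
  by rewrite (dominated_integralZ _ _ _ cs sK) E; lra.
- have : \int[mu]_x p x ^+ 2 <= \int[mu]_x (2 * v x ^+ 2 + k * s x).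
    apply: (le_dominated_integral _ _ _ _ _ _ p2K (dominatedD _ _ _ _ (dominatedZ 2 _ _ v2K) (dominatedZ k _ _ sK))).
    + exact: ctsX.
    + by apply: ctsD; apply: ctsZ => //; exact: ctsX.
    + move=> x; have /andP[a0 a1] := sk x.
      have : s x * s x <= k / 2 * s x by rewrite ler_wpM2r.
      have -> : p x = v x + s x by rewrite /v subrK.
      have := sqr_ge0 (v x - s x); nra.
  rewrite (dominated_integralD _ _ _ _ _ _ (dominatedZ 2 _ _ v2K) (dominatedZ k _ _ sK)); last 2 first.
  - by apply: ctsZ; exact: ctsX.
  - exact: ctsZ.
  rewrite (dominated_integralZ _ _ _ _ v2K); last exact: ctsX.
  by rewrite (dominated_integralZ _ _ _ cs sK); lra.
Qed.

(** The difference solves a linear equation whose coefficient 2 k + v1 + v2 is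
    2 k plus the derivative of a bounded function. *)
Lemma miura_difference (k K L : R) (q1 q2 v1 v2 : R -> R) : 2 <= k ->
  miura_solution k q1 v1 -> miura_solution k q2 v2 ->
  dominated K v1 -> dominated K v2 -> dominated L (fun x => q2 x - q1 x) ->
  dominated (L * expR (4 * (K * mass))) (fun x => v2 x - v1 x).
Proof.
move=> k2 v1' v2' v1K v2K qL.
have [V1 V1' V1M] := primitive_bounded _ _ (ders_continuous _ _ v1') v1K.
have [V2 V2' V2M] := primitive_bounded _ _ (ders_continuous _ _ v2') v2K.
have -> : 4 * (K * mass) = 2 * (K * mass + K * mass) :> R by ring.
apply: (ode_dominated (2 * k) _ (K + K) L _ _ _ (fun x => q2 x - q1 x) _
  (fun x => derD (V1' x) (V2' x)) _ _ _ qL).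
- by lra.
- by move=> x; rewrite (le_trans (ler_normD _ _))// lerD.
- by move=> x; rewrite (le_trans (ler_normB _ _))// lerD// dominated_bounded.
- by move=> x; apply: (der_eq _ (derB (v2' x) (v1' x))); ring.
Qed.

(** phi is the diagonal of the Green function of - d^2/dx^2 + q + k^2.  The
    equation is to be solved from +oo, so it is reflected. *)
Lemma green_diagonal_exists (k K : R) (v : R -> R) : 0 < k -> continuous v -> dominated K v ->
  exists phi : R -> R, (forall x, is_derive x 1 phi (2 * (k + v x) * phi x - 1)) /\
    exists B : R, forall x, `|phi x| <= B.
Proof.
move=> k0 cv vK; have [V V' VM] := primitive_bounded _ _ cv vK.
have dN x : is_derive x 1 (fun y : R => - y) (- 1) by exact: derN (der_id x).
have [|||||D [D' [B DB]]] := linear_ode (2 * k) (2 * (K * mass)) 1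
  (fun x => - 2 * V (- x)) (fun x => 2 * v (- x)) (fun=> 1).
- by rewrite mulr_gt0.
- by move=> x; apply: (der_eq _ (derZ (- 2) (der_comp (V' (- x)) (dN x)))); ring.
- by move=> x; have := VM (- x); rewrite !ler_norml => /andP[? ?]; apply/andP; split; lra.
- exact: cts_cst.
- by move=> x; rewrite normr1.
exists (fun x => D (- x)); split; last by exists B.
by move=> x; apply: (der_eq _ (der_comp (D' (- x)) (dN x))); rewrite opprK; ring.
Qed.

Section variation.
Variables (k K B : R) (q v phi : R -> R).
Hypotheses (v' : miura_solution k q v) (vK : dominated K v)
  (phi' : forall x, is_derive x 1 phi (2 * (k + v x) * phi x - 1))
  (phiB : forall x, `|phi x| <= B).

Let cv := ders_continuous _ _ v'.
Let cphi := ders_continuous _ _ phi'.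

(** Multiplying the equation of the difference d = v2 - v by phi and using
    phi' = 2 (k + v) phi - 1 gives d = phi (q2 - q) - phi d^2 - (d phi)'.  Hence
    1 - 2 k phi is the variational derivative of int v^2 with respect to q. *)
Lemma miura_mass_variation (L M : R) (q2 v2 : R -> R) : miura_solution k q2 v2 ->
  dominated L (fun x => v2 x - v x) -> continuous q -> continuous q2 ->
  dominated M (fun x => q2 x - q x) ->
  \int[mu]_x v2 x ^+ 2 - \int[mu]_x v x ^+ 2 =
  \int[mu]_x ((1 - 2 * k * phi x) * (q2 x - q x)) +
  2 * k * \int[mu]_x (phi x * (v2 x - v x) ^+ 2).
Proof.
move=> v2' dL cq cq2 qM; have cv2 := ders_continuous _ _ v2'.
pose d x := v2 x - v x; pose f x := q2 x - q x.
have cd : continuous d by exact: ctsB.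
have cf : continuous f by exact: ctsB.
have d' x : is_derive x 1 d (f x - (2 * k + 2 * v x + d x) * d x).
  by apply: (der_eq _ (derB (v2' x) (v' x))); rewrite /f /d; ring.
have c1 : continuous (fun x => 1 - 2 * k * phi x) by apply: ctsB; [exact: cts_cst|exact: ctsZ].
have B1 x : `|1 - 2 * k * phi x| <= 1 + `|2 * k| * B.
  by rewrite (le_trans (ler_normB _ _))// normr1 lerD2l normrM ler_wpM2l.
have d1 := dominatedM _ _ _ _ B1 qM.
have d2 := dominatedM _ _ _ _ phiB (sqr_dominated _ _ dL).
have v2K : dominated (K + L) v2.
  by move=> x; rewrite -(subrK (v x) (v2 x)) addrC; apply: (dominatedD _ _ _ _ vK dL).
have s1 := sqr_dominated _ _ vK.
have s2 := sqr_dominated _ _ v2K.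
pose F x := d x - 2 * k * (phi x * d x).
have F' x : is_derive x 1 F ((1 - 2 * k * phi x) * f x + 2 * k * (phi x * d x ^+ 2) - (v2 x ^+ 2 - v x ^+ 2)).
  apply: (der_eq _ (derB (d' x) (derZ (2 * k) (derM (phi' x) (d' x))))).
  by rewrite /f /d; ring.
have := integral_derivative_eq0 _ _ F _ F' _
  (dominatedB _ _ _ _ (dominatedD _ _ _ _ d1 (dominatedZ (2 * k) _ _ d2)) (dominatedB _ _ _ _ s2 s1))
  (dominatedB _ _ _ _ dL (dominatedZ (2 * k) _ _ (dominatedM _ _ _ _ phiB dL))).
have e1 : continuous (fun x => (1 - 2 * k * phi x) * f x) by exact: ctsM.
have e2 : continuous (fun x => phi x * d x ^+ 2) by apply: ctsM => //; exact: ctsX.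
have e3 : continuous (fun x => v2 x ^+ 2) by exact: ctsX.
have e4 : continuous (fun x => v x ^+ 2) by exact: ctsX.
rewrite (dominated_integralB _ _ _ _ _ _ (dominatedD _ _ _ _ d1 (dominatedZ (2 * k) _ _ d2)) (dominatedB _ _ _ _ s2 s1)); last 2 first.
- by apply: ctsD => //; exact: ctsZ.
- exact: ctsB.
rewrite (dominated_integralD _ _ _ _ e1 _ d1 (dominatedZ (2 * k) _ _ d2)); last exact: ctsZ.
rewrite (dominated_integralZ _ _ _ e2 d2) (dominated_integralB _ _ _ _ e3 e4 s2 s1) => H.
apply/esym/eqP; rewrite -subr_eq0; apply/eqP; apply: H.
by apply: ctsB; [apply: ctsD => //; exact: ctsZ|exact: ctsB].
Qed.

(** The integrand is an exact derivative.  The Green diagonal satisfies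
    phi''' = 4 (q + k^2) phi' + 2 q' phi, and q phi' is the derivative of
    (2 k v + v^2) phi - v; integrating - phi q''' + 6 phi q q' by parts three
    times therefore leaves nothing but the derivative of Om. *)
Lemma miura_mass_kdv_orthogonal (q1 q2 q3 : R -> R) :
  (forall x, is_derive x 1 q (q1 x)) -> (forall x, is_derive x 1 q1 (q2 x)) ->
  (forall x, is_derive x 1 q2 (q3 x)) -> continuous q3 ->
  decays q -> decays q1 -> decays q2 -> decays q3 ->
  \int[mu]_x ((1 - 2 * k * phi x) * (6 * q x * q1 x - q3 x)) = 0.
Proof.
move=> q' q1' q2' cq3 dq dq1 dq2 dq3.
have cq := ders_continuous _ _ q'; have cq1 := ders_continuous _ _ q1'.
have bphi : bounded_fun phi by exists B.
have dv : decays v by exists K.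
have bv := decays_bounded _ dv; have bq := decays_bounded _ dq.
pose ph1 x := 2 * (k + v x) * phi x - 1.
pose ph2 x := 2 * ((q x - 2 * k * v x - v x ^+ 2) * phi x + (k + v x) * ph1 x).
have ph1' x : is_derive x 1 ph1 (ph2 x).
  apply: (der_eq _ (derB (derM (derZ 2 (derD (der_cst k x) (v' x))) (phi' x)) (der_cst 1 x))).
  by rewrite /ph2 /ph1; ring.
have b1 : bounded_fun ph1.
  apply: boundedB; last exact: bounded_cst.
  by apply: boundedM => //; apply/boundedZ/boundedD => //; exact: bounded_cst.
have b2 : bounded_fun ph2.
  apply: boundedZ; apply: boundedD; apply: boundedM => //; last first.
    by apply: boundedD => //; exact: bounded_cst.
  by apply: boundedB; [apply: boundedB => //; exact: boundedZ|exact: boundedX2].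
pose Om x := ph1 x * q1 x - phi x * q2 x - ph2 x * q x + 4 * (phi x * (q x * q x))
  + 4 * k ^+ 2 * (phi x * (2 * k * v x + v x * v x) - v x).
pose F x := 3 * (q x * q x) - q2 x - 2 * k * Om x.
have ph2' x : is_derive x 1 ph2 (2 * ((q1 x - 2 * k * (q x - 2 * k * v x - v x ^+ 2)
    - 2 * v x * (q x - 2 * k * v x - v x ^+ 2)) * phi x
    + (q x - 2 * k * v x - v x ^+ 2) * ph1 x
    + ((q x - 2 * k * v x - v x ^+ 2) * ph1 x + (k + v x) * ph2 x))).
  have vv : is_derive x 1 (fun y => v y ^+ 2) (2 * v x * (q x - 2 * k * v x - v x ^+ 2)).
    by apply: (der_eq _ (derM (v' x) (v' x))); ring.
  have := derZ 2 (derD (derM (derB (derB (q' x) (derZ (2 * k) (v' x))) vv) (phi' x))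
    (derM (derD (der_cst k x) (v' x)) (ph1' x))).
  by move=> /der_eq; apply; rewrite add0r.
have F' x : is_derive x 1 F ((1 - 2 * k * phi x) * (6 * q x * q1 x - q3 x)).
  have dOm := derD (derD (derB (derB (derM (ph1' x) (q1' x)) (derM (phi' x) (q2' x)))
      (derM (ph2' x) (q' x))) (derZ 4 (derM (phi' x) (derM (q' x) (q' x)))))
    (derZ (4 * k ^+ 2) (derB (derM (phi' x) (derD (derZ (2 * k) (v' x)) (derM (v' x) (v' x)))) (v' x))).
  apply: (der_eq _ (derB (derB (derZ 3 (derM (q' x) (q' x))) (q2' x)) (derZ (2 * k) dOm))).
  by rewrite /ph2 /ph1; ring.
apply: (integral_derivative_decays F _ F').
- apply: ctsM; first by apply: ctsB; [exact: cts_cst|exact: ctsZ].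
  by apply: ctsB => //; apply: ctsM => //; exact: ctsZ.
- apply: decaysM; first by apply: boundedB; [exact: bounded_cst|exact: boundedZ].
  by apply: decaysB => //; apply: decaysM => //; exact: boundedZ.
- apply: decaysB; first by apply: decaysB => //; apply/decaysZ/decaysM.
  apply: decaysZ; apply: decaysD.
    apply: decaysD; last by apply/decaysZ/decaysM => //; exact: decaysM.
    apply: decaysB; last exact: decaysM.
    by apply: decaysB; exact: decaysM.
  apply: decaysZ; apply: decaysB => //; apply: decaysM => //.
  by apply: decaysD; [exact: decaysZ|exact: decaysM].
Qed.

End variation.
End miura.

(** * Conservation of the Miura mass along the KdV flow *)

Section time.
Context {R : realType}.
Local Notation mu := (@lebesgue_measure R).
Implicit Types (f g : R -> R) (K x y t : R).

(** The hypothesis improves the bound M to m < M as long as M holds; the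
    Lipschitz bound then extends it by a time step d that does not depend on the
    starting time. *)
Lemma bootstrap (e : R -> R) (T C m M : R) : 0 <= C -> m < M -> e 0 <= M ->
  (forall s t : R, 0 <= s -> s <= t -> t <= T -> `|e t - e s| <= C * (t - s)) ->
  (forall t, 0 <= t -> t <= T -> (forall s : R, 0 <= s -> s <= t -> e s <= M) -> e t <= m) ->
  forall t, 0 <= t -> t <= T -> e t <= M.
Proof.
move=> C0 mM e0 eC step.
pose d := (M - m) / (C + 1).
have C1 : 0 < C + 1 by rewrite ltr_wpDl.
have d0 : 0 < d by rewrite divr_gt0// subr_gt0.
have Cd : C * d <= M - m.
  rewrite /d mulrA ler_pdivrMr// mulrC ler_wpM2l ?subr_ge0 ?ltW//; first by rewrite ltrDl.
suff H n : forall t, 0 <= t -> t <= T -> t <= n%:R * d -> e t <= M.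
  move=> t t0 tT; apply: (H (Num.bound (t / d))) => //.
  rewrite -ler_pdivrMr// ltW//; apply: archi_boundP.
  by rewrite divr_ge0// ltW.
elim: n => [|n ih] t t0 tT.
  by rewrite mul0r => t0'; have /eqP -> : t == 0 by rewrite eq_le t0 t0'.
have [tn _|nt tn] := leP t (n%:R * d); first exact: ih.
have n0 : 0 <= n%:R * d by rewrite mulr_ge0// ltW.
have em : e (n%:R * d) <= m.
  apply: step => //; first exact: le_trans (ltW nt) tT.
  move=> s s0 sn; apply: ih => //.
  by rewrite (le_trans sn)// (le_trans (ltW nt)).
have := eC _ _ n0 (ltW nt) tT.
have : C * (t - n%:R * d) <= C * d.
  by rewrite ler_wpM2l// lerBlDl; move: tn; rewrite -natr1 mulrDl mul1r.
by rewrite ler_norml => h /andP[_]; lra.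
Qed.

Lemma lipschitz_within (F : R -> R) (a b C : R) :
  (forall s t : R, a <= s -> s <= t -> t <= b -> `|F t - F s| <= C * (t - s)) ->
  {within `[a, b], continuous F}.
Proof.
move=> FC; apply/subspace_continuousP => t /=; rewrite in_itv /= => /andP[at_ tb].
apply/cvgrPdist_le => e e0.
have C1 : 0 < `|C| + 1 by rewrite ltr_wpDl.
have key s : a <= s -> s <= b -> `|F t - F s| <= (`|C| + 1) * `|t - s|.
  move=> as_ sb; have [st|/ltW ts] := leP s t.
    rewrite (le_trans (FC _ _ as_ st tb))// (@ger0_norm _ (t - s)) ?subr_ge0//.
    by rewrite ler_wpM2r ?subr_ge0// ler_wpDr// ler_norm.
  rewrite distrC (distrC t) (le_trans (FC _ _ at_ ts sb))// (@ger0_norm _ (s - t)) ?subr_ge0//.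
  by rewrite ler_wpM2r ?subr_ge0// ler_wpDr// ler_norm.
rewrite near_withinE; near=> s => /=; rewrite in_itv /= => /andP[as_ sb].
rewrite (le_trans (key s as_ sb))// mulrC -ler_pdivlMr//.
by near: s; apply: cvgr_dist_le => //; rewrite divr_gt0.
Unshelve. all: by end_near. Qed.

Lemma is_derive_quadratic (F : R -> R) (a b c C : R) : a < c < b ->
  (forall t, a < t < b -> `|F t - F c| <= C * (t - c) ^+ 2) ->
  is_derive c 1 F 0.
Proof.
move=> acb FC.
have C1 : 0 < `|C| + 1 by rewrite ltr_wpDl.
have /andP[ac cb] := acb.
have H : h^-1 *: (F (h *: 1 + c) - F c) @[h --> 0^'] --> 0.
  apply/cvgrPdist_le => e e0; near=> h.
  rewrite sub0r normrN.
  have hne : h != 0 by near: h; exact: nbhs_dnbhs_neq.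
  have hb : `|h| <= Num.min (e / (`|C| + 1)) (Num.min ((c - a) / 2) ((b - c) / 2)).
    near: h; apply: dnbhs0_le.
    by rewrite !lt_min !divr_gt0 ?subr_gt0.
  move: hb; rewrite !le_min => /and3P[he ha hb].
  have hc : a < h + c < b.
    move: ha hb; rewrite !ler_norml => /andP[? ?] /andP[? ?].
    by apply/andP; split; lra.
  rewrite /GRing.scale /= mulr1 normrM normfV ler_pdivrMl ?normr_gt0//.
  rewrite (le_trans (FC _ hc))// addrK -[h ^+ 2]real_normK ?num_real// expr2.
  rewrite (le_trans (ler_wpM2r _ (ler_norm C))) ?mulr_ge0// mulrCA ler_wpM2l//.
  rewrite (le_trans _ (_ : (`|C| + 1) * `|h| <= _))//.
    by rewrite ler_wpM2r// lerDl.
  by rewrite mulrC -ler_pdivlMr.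
apply: DeriveDef; first by apply/cvg_ex; exists 0.
exact/cvg_lim.
Unshelve. all: by end_near. Qed.

Section evolution.
Variables (k T Kq L : R) (q q1 q2 q3 : R -> R -> R).
Hypotheses (k2 : 2 <= k) (qK : forall t, 0 <= t <= T -> dominated Kq (q t))
  (q1' : forall t x, 0 <= t <= T -> is_derive x 1 (q t) (q1 t x))
  (q2' : forall t x, 0 <= t <= T -> is_derive x 1 (q1 t) (q2 t x))
  (q3' : forall t x, 0 <= t <= T -> is_derive x 1 (q2 t) (q3 t x))
  (q3c : forall t, 0 <= t <= T -> continuous (q3 t))
  (q1d : forall t, 0 <= t <= T -> decays (q1 t))
  (q2d : forall t, 0 <= t <= T -> decays (q2 t))
  (q3d : forall t, 0 <= t <= T -> decays (q3 t))
  (qL : forall t, 0 < t < T -> dominated L (fun x => 6 * q t x * q1 t x - q3 t x))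
  (qt : forall t x, 0 < t < T -> is_derive t 1 (q ^~ x) (6 * q t x * q1 t x - q3 t x))
  (qc : forall x, {within `[0, T], continuous (q ^~ x)}).

Lemma flow_lipschitz s t : 0 <= s -> s <= t -> t <= T ->
  dominated (L * (t - s)) (fun x => q t x - q s x).
Proof.
move=> s0; rewrite le_eqVlt => /predU1P[<- _ x|st tT x].
  by rewrite !subrr normr0 mulr0 mul0r.
have [c|c|c cst ->] := @MVT R (q ^~ x) (fun t => 6 * q t x * q1 t x - q3 t x) s t st.
- rewrite in_itv /= => /andP[sc ct]; apply: qt.
  by rewrite (le_lt_trans s0)// (lt_le_trans ct).
- apply: continuous_subspaceW (qc x) c => y /=; rewrite !in_itv /= => /andP[sy yt].
  by rewrite (le_trans s0)// (le_trans yt).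
- move: cst; rewrite in_itv /= => /andP[sc ct].
  rewrite normrM (@ger0_norm _ (t - s)) ?subr_ge0 ?(ltW st)// [leRHS]mulrAC.
  rewrite ler_wpM2r ?subr_ge0 ?(ltW st)//.
  by apply: qL; rewrite (le_lt_trans s0)// (lt_le_trans ct).
Qed.

Lemma flow_dominated s t : 0 <= s <= T -> 0 <= t <= T ->
  dominated (L * `|t - s|) (fun x => q t x - q s x).
Proof.
move=> /andP[s0 sT] /andP[t0 tT]; have [st|/ltW ts] := leP s t.
  by rewrite ger0_norm ?subr_ge0//; exact: flow_lipschitz.
rewrite distrC ger0_norm ?subr_ge0// => x; rewrite distrC.
exact: flow_lipschitz.
Qed.

Let cq t : 0 <= t <= T -> continuous (q t).
Proof. by move=> tT; apply: ders_continuous => x; exact: q1'. Qed.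
(** Differentiation under the integral sign: the time derivative of q is
    dominated uniformly in time. *)
Lemma pairing_derive (w : R -> R) c : continuous w -> bounded_fun w -> 0 < c < T ->
  is_derive c 1 (fun t => \int[mu]_x (w x * q t x))
    (\int[mu]_x (w x * (6 * q c x * q1 c x - q3 c x))).
Proof.
move=> cw [B wB] /andP[c0 cT].
have inI x : (`]0, T[%classic : set R) x -> 0 < x < T by rewrite /= in_itv.
have cI : (`]0, T[%classic : set R) c by rewrite /= in_itv /= c0 cT.
have oc x : 0 < x < T -> 0 <= x <= T by move=> /andP[/ltW -> /ltW ->].
have intf x : (`]0, T[%classic : set R) x -> mu.-integrable setT (EFin \o (fun y => w y * q x y)).
  move=> /inI /oc xT; apply: (integrable_dominated (B * Kq)).
    by apply: ctsM => //; exact: cq.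
  by apply: dominatedM => //; exact: qK.
have derf x y : (`]0, T[%classic : set R) x -> setT y ->
    is_derive x 1 (fun x => w y * q x y) (w y * (6 * q x y * q1 x y - q3 x y)).
  by move=> /inI xT _; exact: derZ (qt _ y xT).
have derf1 x y : (`]0, T[%classic : set R) x -> setT y -> derivable (fun x => w y * q x y) x 1.
  by move=> Ix Dy; have [] := derf _ _ Ix Dy.
have dE x y : (`]0, T[%classic : set R) x -> setT y ->
    partial1of2 (fun x y => w y * q x y) x y = w y * (6 * q x y * q1 x y - q3 x y).
  by move=> Ix Dy; rewrite partial1of2E; have [_ ->] := derf _ _ Ix Dy.
have B0 : 0 <= B by rewrite (le_trans _ (wB 0)).
have L0 : 0 <= L by apply: dominated_ge0 (qL c _); rewrite c0 cT.
have G0 y : 0 <= B * L * lorentz y by rewrite !mulr_ge0 ?lorentz_ge0.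
have intG : mu.-integrable setT (EFin \o (fun y => B * L * lorentz y)).
  apply: (integrable_dominated (B * L)); first by apply: ctsZ; exact: lorentz_continuous.
  by move=> y; rewrite ger0_norm.
have Gub x y : (`]0, T[%classic : set R) x -> setT y ->
    `|partial1of2 (fun x y => w y * q x y) x y| <= B * L * lorentz y.
  move=> Ix Dy; rewrite dE//.
  exact: (dominatedM L B w (fun y => 6 * q x y * q1 x y - q3 x y) wB (qL _ (inI _ Ix)) y).
have D1 := derivable_under_integral measurableT cI intf derf1 G0 intG Gub.
have D2 := differentiation_under_integral measurableT cI intf derf1 G0 intG Gub.
apply: DeriveDef; first exact: D1.
rewrite -derive1E D2; apply: eq_Rintegral => y _.
exact: dE.
Qed.

(** At an interior time c, the mass int v^2 differs from the pairing of q with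
    the fixed weight 1 - 2 k phi (taken at time c) by 2 k int phi (v t - v c)^2,
    which is quadratic in t - c; and that pairing has derivative 0 at c.  So the
    mass has derivative 0, with no differentiability of v in time required. *)
Lemma miura_mass_conserved (t0 Kv : R) (v : R -> R -> R) : 0 < t0 <= T ->
  (forall t, 0 <= t <= t0 -> miura_solution k (q t) (v t)) ->
  (forall t, 0 <= t <= t0 -> dominated Kv (v t)) ->
  \int[mu]_x v t0 x ^+ 2 = \int[mu]_x v 0 x ^+ 2.
Proof.
move=> /andP[t00 t0T] vq vK; have kk := k2.
have inT t : 0 <= t <= t0 -> 0 <= t <= T by move=> /andP[-> tt]; exact: le_trans t0T.
pose L' := L * expR (4 * (Kv * mass)).
have vd s t : 0 <= s <= t0 -> 0 <= t <= t0 ->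
    dominated (L' * `|t - s|) (fun x => v t x - v s x).
  move=> sT tT; rewrite /L' mulrAC.
  apply: (miura_difference k Kv _ (q s) (q t)) => //; [exact: vq|exact: vq|exact: vK|exact: vK|].
  exact: flow_dominated (inT _ sT) (inT _ tT).
have cv t : 0 <= t <= t0 -> continuous (v t) by move=> /vq; exact: ders_continuous.
pose B t := \int[mu]_x v t x ^+ 2.
have BL s t : 0 <= s -> s <= t -> t <= t0 -> `|B t - B s| <= (Kv + Kv) * L' * mass * (t - s).
  move=> s0 st tt; have sT : 0 <= s <= t0 by rewrite s0 (le_trans st).
  have tT : 0 <= t <= t0 by rewrite tt (le_trans s0).
  rewrite /B -(dominated_integralB _ _ _ _ _ _ (sqr_dominated _ _ (vK _ tT)) (sqr_dominated _ _ (vK _ sT))); last 2 first.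
  - by apply: ctsX; exact: cv.
  - by apply: ctsX; exact: cv.
  rewrite mulrAC -[_ * L' * (t - s)]mulrA.
  apply: le_norm_integral_dominated.
    by apply: measurable_cts; apply: ctsB; apply: ctsX; exact: cv.
  have dd := vd s t sT tT; rewrite ger0_norm ?subr_ge0// in dd.
  move=> x; rewrite subr_sqr mulrC.
  apply: (dominatedM _ (Kv + Kv) (fun x => v t x + v s x) _ _ dd) => y.
  by rewrite (le_trans (ler_normD _ _))// lerD// dominated_bounded//; exact: vK.
have B' c : 0 < c < t0 -> is_derive c 1 B 0.
  move=> /andP[c0 ct]; have cT : 0 <= c <= t0 by rewrite !ltW.
  have k0 : 0 < k by lra.
  have [phi [phi' [P phiP]]] := green_diagonal_exists _ _ _ k0 (cv _ cT) (vK _ cT).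
  have cphi := ders_continuous _ _ phi'.
  have cw : continuous (fun x => 1 - 2 * k * phi x).
    by apply: ctsB; [exact: cts_cst|exact: ctsZ].
  have bw : bounded_fun (fun x => 1 - 2 * k * phi x).
    by apply: boundedB; [exact: bounded_cst|apply: boundedZ; exists P].
  pose m t := \int[mu]_x ((1 - 2 * k * phi x) * q t x).
  have m' : is_derive c 1 m 0.
    have cTT : 0 < c < T by rewrite c0 (lt_le_trans ct).
    apply: (der_eq _ (pairing_derive _ _ cw bw cTT)).
    apply: (miura_mass_kdv_orthogonal k Kv P (q c) (v c) phi (vq _ cT) (vK _ cT) phi' phiP
      (q1 c) (q2 c) (q3 c)).
    - by move=> x; apply: q1'; exact: inT.
    - by move=> x; apply: q2'; exact: inT.
    - by move=> x; apply: q3'; exact: inT.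
    - by apply: q3c; exact: inT.
    - by exists Kq; apply: qK; exact: inT.
    - by apply: q1d; exact: inT.
    - by apply: q2d; exact: inT.
    - by apply: q3d; exact: inT.
  have Bm : is_derive c 1 (fun t => B t - m t) 0.
    apply: (is_derive_quadratic _ 0 t0 c (2 * k * (P * L' ^+ 2 * mass))); first by rewrite c0 ct.
    move=> t /andP[tg0 tl]; have tT : 0 <= t <= t0 by rewrite !ltW.
    have qM := flow_dominated _ _ (inT _ cT) (inT _ tT).
    have dL := vd c t cT tT.
    have E := miura_mass_variation k Kv P (q c) (v c) phi (vq _ cT) (vK _ cT) phi' phiP
      _ _ (q t) (v t) (vq _ tT) dL (cq _ (inT _ cT)) (cq _ (inT _ tT)) qM.
    have Em : m t - m c = \int[mu]_x ((1 - 2 * k * phi x) * (q t x - q c x)).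
      have [W wW] := bw.
      rewrite /m -(dominated_integralB (W * Kq) (W * Kq)); last 4 first.
      - by apply: ctsM => //; exact/cq/inT.
      - by apply: ctsM => //; exact/cq/inT.
      - by apply: dominatedM => //; exact/qK/inT.
      - by apply: dominatedM => //; exact/qK/inT.
      by apply: eq_Rintegral => x _; rewrite mulrBr.
    have -> : B t - m t - (B c - m c) = 2 * k * \int[mu]_x (phi x * (v t x - v c x) ^+ 2).
      rewrite [LHS](_ : _ = (B t - B c) - (m t - m c)); last by ring.
      by rewrite E Em addrC addKr.
    rewrite normrM ger0_norm ?mulr_ge0 ?(ltW k0)// -mulrA ler_wpM2l ?mulr_ge0 ?(ltW k0)//.
    have -> : P * L' ^+ 2 * mass * (t - c) ^+ 2 = P * (L' * `|t - c|) ^+ 2 * mass.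
      by rewrite -(real_normK (num_real (t - c))); ring.
    apply: le_norm_integral_dominated.
      apply: measurable_cts; apply: ctsM => //; apply: ctsX; apply: ctsB; exact: cv.
    by apply: dominatedM => //; exact: sqr_dominated.
  have := derD Bm m' => /der_ext /(_ _) H.
  have {}H := H B (fun t => subrK (m t) (B t)).
  by apply: (der_eq _ H); rewrite addr0.
have cB : {within `[0, t0], continuous B} := lipschitz_within _ _ _ _ BL.
have B'' c : c \in `]0, t0[ -> is_derive c 1 B 0 by rewrite in_itv /=; exact: B'.
have [c _] := @MVT R B (fun=> 0) 0 t0 t00 B'' cB.
by rewrite mul0r => /eqP; rewrite subr_eq0 => /eqP.
Qed.

(** While int p^2 <= k/8 the function v exists, and
    int p(t)^2 <= 5/2 int v(t)^2 = 5/2 int v(0)^2 <= 10 int p(0)^2 <= 10 k/128,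
    which is less than k/8: a bootstrap. *)
Lemma resolvent_energy_bound (p : R -> R -> R) :
  0 <= T ->
  (forall t, 0 <= t <= T -> dominated Kq (p t)) ->
  (forall t x, 0 <= t <= T -> is_derive x 1 (p t) (q t x - 2 * k * p t x)) ->
  \int[mu]_x p 0 x ^+ 2 <= k / 128 ->
  \int[mu]_x p T x ^+ 2 <= 10 * \int[mu]_x p 0 x ^+ 2.
Proof.
move=> T0 pK p' e0; have kk := k2.
pose E t := \int[mu]_x p t x ^+ 2.
have E0 : 0 <= E 0 by apply: Rintegral_ge0 => x _; exact: sqr_ge0.
have zT : 0 <= (0 : R) <= T by apply/andP.
have Kq0 : 0 <= Kq := dominated_ge0 _ _ (qK _ zT).
have cp t : 0 <= t <= T -> continuous (p t).
  by move=> tT; apply: ders_continuous => x; exact: p'.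
have L0 : 0 < T -> 0 <= L.
  move=> T1; apply: dominated_ge0 (qL (T / 2) _).
  by apply/andP; split; lra.
have step t : 0 <= t -> t <= T -> (forall s : R, 0 <= s -> s <= t -> E s <= k / 8) ->
    E t <= 10 * E 0.
  move=> t0 tT Es; move: t0; rewrite le_eqVlt => /predU1P[<-|t0]; first lra.
  have inT s : 0 <= s <= t -> 0 <= s <= T by move=> /andP[-> /le_trans]; apply.
  have [v vP] : exists v : R -> R -> R, forall s, 0 <= s <= t ->
      [/\ miura_solution k (q s) (v s), dominated (Kq + 2 * Kq ^+ 2) (v s),
       \int[mu]_x v s x ^+ 2 <= 4 * E s & E s <= 5 / 2 * \int[mu]_x v s x ^+ 2].
    suff [v vP] : {v : R -> R -> R & forall s, 0 <= s <= t ->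
      [/\ miura_solution k (q s) (v s), dominated (Kq + 2 * Kq ^+ 2) (v s),
       \int[mu]_x v s x ^+ 2 <= 4 * E s & E s <= 5 / 2 * \int[mu]_x v s x ^+ 2]} by exists v.
    apply: (@choice _ _ (fun s v => 0 <= s <= t ->
      [/\ miura_solution k (q s) v, dominated (Kq + 2 * Kq ^+ 2) v,
       \int[mu]_x v x ^+ 2 <= 4 * E s & E s <= 5 / 2 * \int[mu]_x v x ^+ 2])) => s.
    have [/[dup] st /andP[s0 s1]|nst] := boolP (0 <= s <= t); last by exists (fun=> 0).
    have [v vs] := miura_exists k Kq (q s) (p s) k2 (pK _ (inT _ st)) (fun x => p' s x (inT _ st)) (Es _ s0 s1).
    by exists v.
  have tt : 0 <= t <= t by apply/andP; split=> //; exact: ltW.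
  have zt : 0 <= (0 : R) <= t by apply/andP; split=> //; exact: ltW.
  have t0T : 0 < t <= T by rewrite t0.
  have cons := miura_mass_conserved t _ v t0T
    (fun s st => let: And4 a _ _ _ := vP s st in a) (fun s st => let: And4 _ a _ _ := vP s st in a).
  have [_ _ _ h1] := vP _ tt; have [_ _ h2 _] := vP _ zt.
  rewrite cons in h1; lra.
move: (T0); rewrite le_eqVlt => /predU1P[T1|T1]; first by rewrite -T1 -/(E 0); lra.
have EL s t : 0 <= s -> s <= t -> t <= T -> `|E t - E s| <= (Kq + Kq) * L * mass * (t - s).
  move=> s0 st tT; have sT : 0 <= s <= T by rewrite s0 (le_trans st).
  have tTT : 0 <= t <= T by rewrite tT (le_trans s0).
  rewrite /E -(dominated_integralB _ _ _ _ _ _ (sqr_dominated _ _ (pK _ tTT)) (sqr_dominated _ _ (pK _ sT))); last 2 first.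
  - by apply: ctsX; exact: cp.
  - by apply: ctsX; exact: cp.
  rewrite mulrAC -[_ * L * (t - s)]mulrA.
  apply: le_norm_integral_dominated.
    by apply: measurable_cts; apply: ctsB; apply: ctsX; exact: cp.
  have dd : dominated (L * (t - s)) (fun x => p t x - p s x).
    apply: (constant_coefficient_dominated (2 * k) (Kq + Kq) _ _ (fun x => q t x - q s x) _ _ _
      (flow_lipschitz _ _ s0 st tT)).
    - by lra.
    - by move=> x; rewrite (le_trans (ler_normB _ _))// lerD// dominated_bounded//; exact: pK.
    - by move=> x; apply: (der_eq _ (derB (p' _ x tTT) (p' _ x sT))); ring.
  move=> x; rewrite subr_sqr mulrC.
  apply: (dominatedM _ (Kq + Kq) (fun x => p t x + p s x) _ _ dd) => y.
  by rewrite (le_trans (ler_normD _ _))// lerD// dominated_bounded//; exact: pK.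
have small t : 0 <= t -> t <= T -> E t <= k / 8.
  apply: (bootstrap E T ((Kq + Kq) * L * mass) (10 * E 0) (k / 8) _ _ _ EL step).
  - by rewrite !mulr_ge0 ?addr_ge0 ?mass_ge0 ?L0.
  - by rewrite /E; lra.
  - by rewrite /E; lra.
by apply: step => // s s0 sT; exact: small.
Qed.

End evolution.
End time.

(** * Fourier transforms and the Plancherel identity *)

Section fourier.
Context {R : realType}.
Local Notation mu := (@lebesgue_measure R).
Implicit Types (f g : R -> R) (K x y t : R).

(** The double integrand is dominated by a product of two Lorentzians. *)
Lemma fubini_kernel (K L : R) (F G : R -> R) (k : R -> R -> R) :
  continuous F -> continuous G -> dominated K F -> dominated L G ->
  measurable_fun setT (fun z : R * R => k z.1 z.2) ->
  (forall x y, `|k x y| <= 1) ->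
  \int[mu]_x (F x * \int[mu]_y (k x y * G y)) =
  \int[mu]_y (G y * \int[mu]_x (k x y * F x)).
Proof.
move=> cF cG FK GL mk k1.
have mF := measurable_cts _ cF; have mG := measurable_cts _ cG.
pose h (z : R * R) := F z.1 * (k z.1 z.2 * G z.2).
have mh : measurable_fun setT h.
  apply: measurable_funM; first exact: (measurableT_comp mF measurable_fst).
  apply: measurable_funM => //; exact: (measurableT_comp mG measurable_snd).
have mhx x : measurable_fun setT (fun y => `|(h (x, y))%:E|%E).
  apply/measurable_EFinP; apply: measurableT_comp => //.
  exact: (measurableT_comp mh (measurable_pair1 x)).
have mk1 x : measurable_fun setT (fun y => k x y * G y).
  apply: measurable_funM => //.
  exact: (measurableT_comp mk (measurable_pair1 x)).
have mk2 y : measurable_fun setT (fun x => k x y * F x).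
  apply: measurable_funM => //.
  exact: (measurableT_comp mk (measurable_pair2 y)).
have d1 x : dominated L (fun y => k x y * G y).
  by move=> y; rewrite normrM -[leRHS]mul1r ler_pM.
have d2 y : dominated K (fun x => k x y * F x).
  by move=> x; rewrite normrM -[leRHS]mul1r ler_pM.
have i1 x := integrable_dominated_mfun _ _ (mk1 x) (d1 x).
have i2 y := integrable_dominated_mfun _ _ (mk2 y) (d2 y).
have K0 := dominated_ge0 _ _ FK; have L0 := dominated_ge0 _ _ GL.
have ih : (mu \x mu)%E.-integrable setT (EFin \o h).
  apply/integrable12ltyP; first exact/measurable_EFinP.
  apply: (@le_lt_trans _ _ (\int[mu]_x (K * L * mass * lorentz x)%:E)%E).
    apply: ge0_le_integral => //.
    - by move=> x _; apply: integral_ge0.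
    - apply: (@measurable_fun_fubini_tonelli_F _ _ _ _ R mu (fun z => `|(h z)%:E|%E)) => //.
      by apply/measurable_EFinP; exact: measurableT_comp.
    - apply/measurable_EFinP; apply: measurable_cts; apply: ctsZ.
      exact: lorentz_continuous.
    - move=> x _.
      apply: (@le_trans _ _ (\int[mu]_y ((K * lorentz x * L) * lorentz y)%:E)%E).
        apply: ge0_le_integral => //.
        + exact: mhx.
        + apply/measurable_EFinP; apply: measurable_cts; apply: ctsZ.
          exact: lorentz_continuous.
        + move=> y _ /=; rewrite lee_fin normrM -mulrA ler_pM//; exact: d1.
      under eq_integral do rewrite EFinM.
      rewrite integralZl//; last exact: integrable_lorentz.
      rewrite -[X in (_ * X)%E]fineK; last exact: integrable_fin_num integrable_lorentz.
      by rewrite -EFinM lee_fin -/mass le_eqVlt; apply/orP; left; apply/eqP; rewrite /mass /Rintegral; ring.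
  under eq_integral do rewrite EFinM.
  rewrite integralZl//; last exact: integrable_lorentz.
  rewrite -[X in (_ * X)%E]fineK; last exact: integrable_fin_num integrable_lorentz.
  by rewrite -EFinM ltry.
rewrite /Rintegral; congr fine.
transitivity (\int[mu]_x \int[mu]_y (EFin \o h) (x, y))%E.
  apply: eq_integral => x _; rewrite EFinM /h /=.
  under [RHS]eq_integral do rewrite EFinM.
  rewrite fineK; last exact: integrable_fin_num (i1 x).
  by rewrite -integralZl//; exact: i1.
rewrite Fubini//; apply: eq_integral => y _; rewrite EFinM /h /=.
under eq_integral => x _.
  rewrite (_ : F x * (k x y * G y) = G y * (k x y * F x)); last by ring.
  rewrite EFinM; over.
rewrite /= fineK; last exact: integrable_fin_num (i2 y).
by rewrite -integralZl//; exact: i2.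
Qed.

Lemma cos_sin_continuous (f : R -> R) K : continuous f -> dominated K f ->
  continuous (cos_transform f) /\ continuous (sin_transform f).
Proof.
move=> cf fK.
have main (w : R -> R) : continuous w -> (forall x, `|w x| <= 1) ->
    continuous (fun x => \int[mu]_y (w (x * y) * f y)).
  move=> cw w1 a.
  have cwx x : continuous (fun y => w (x * y) * f y).
    apply: ctsM => //; apply: (cts_comp w (fun y => x * y)) => //.
    by apply: ctsZ => y; exact: cvg_id.
  have dw x : dominated K (fun y => w (x * y) * f y).
    by move=> y; rewrite normrM -[leRHS]mul1r ler_pM.
  have inI : a \in (`]a - 1, a + 1[%classic : set R).
    by rewrite inE /= in_itv /=; apply/andP; split; [rewrite gtrBl|rewrite ltrDl].
  apply: (@continuity_under_integral R _ _ mu (fun x y => w (x * y) * f y) setT measurableT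
    (a - 1) (a + 1) _ _ (fun y => K * lorentz y) _ _ a inI).
  - by move=> x _; apply: integrable_dominated (cwx x) (dw x).
  - apply: aeW => y _ x _; apply: ctsM; last exact: cts_cst.
    apply: (cts_comp w (fun x => x * y)) => //; apply: ctsM; last exact: cts_cst.
    by move=> z; exact: cvg_id.
  - apply: (integrable_dominated K); first by apply: ctsZ; exact: lorentz_continuous.
    by move=> y; rewrite ger0_norm// mulr_ge0 ?lorentz_ge0// (dominated_ge0 _ _ fK).
  - by move=> x _; apply: aeW => y _; exact: dw.
split; apply: ctsZ; apply: main.
- exact: continuous_cos.
- by move=> x; rewrite ler_norml cos_geN1 cos_le1.
- exact: continuous_sin.
- by move=> x; rewrite ler_norml sin_geN1 sin_le1.
Qed.

End fourier.

Section plancherel.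
Context {R : realType}.
Local Notation mu := (@lebesgue_measure R).
Implicit Types (f g : R -> R) (K x y z t : R).
Local Notation c0 := ((Num.sqrt (pi *+ 2))^-1 : R).

Lemma cos_bound x : `|cos x| <= 1.
Proof. by rewrite ler_norml cos_geN1 cos_le1. Qed.
Lemma sin_bound x : `|sin x| <= 1.
Proof. by rewrite ler_norml sin_geN1 sin_le1. Qed.

Lemma mulx_continuous x : continuous (fun y : R => x * y).
Proof. by apply: ctsZ => y; exact: cvg_id. Qed.
Lemma cosx_continuous x : continuous (fun y : R => cos (x * y)).
Proof. by apply: (cts_comp cos); [exact: continuous_cos|exact: mulx_continuous]. Qed.
Lemma sinx_continuous x : continuous (fun y : R => sin (x * y)).
Proof. by apply: (cts_comp sin); [exact: continuous_sin|exact: mulx_continuous]. Qed.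

Lemma bounded_cosx x : bounded_fun (fun y : R => cos (x * y)).
Proof. by exists 1 => y; exact: cos_bound. Qed.
Lemma bounded_sinx x : bounded_fun (fun y : R => sin (x * y)).
Proof. by exists 1 => y; exact: sin_bound. Qed.

Lemma sqrt2pi_gt0 : 0 < Num.sqrt (pi *+ 2) :> R.
Proof. by rewrite sqrtr_gt0; apply: mulrn_wgt0 => //; exact: pi_gt0. Qed.

Lemma c0_ge0 : 0 <= c0. Proof. by rewrite invr_ge0 sqrtr_ge0. Qed.

Lemma cos_transform_bounded f : continuous f -> decays f -> bounded_fun (cos_transform f).
Proof.
move=> cf [K fK]; exists (c0 * (K * mass)) => x.
rewrite /cos_transform normrM ger0_norm ?c0_ge0// ler_wpM2l ?c0_ge0//.
apply: le_norm_integral_dominated.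
  by apply: measurable_cts; apply: ctsM => //; exact: cosx_continuous.
by move=> y; rewrite normrM -[leRHS]mul1r ler_pM// cos_bound.
Qed.

Lemma sin_transform_bounded f : continuous f -> decays f -> bounded_fun (sin_transform f).
Proof.
move=> cf [K fK]; exists (c0 * (K * mass)) => x.
rewrite /sin_transform normrM ger0_norm ?c0_ge0// ler_wpM2l ?c0_ge0//.
apply: le_norm_integral_dominated.
  by apply: measurable_cts; apply: ctsM => //; exact: sinx_continuous.
by move=> y; rewrite normrM -[leRHS]mul1r ler_pM// sin_bound.
Qed.

Lemma cos_transform_continuous f : continuous f -> decays f -> continuous (cos_transform f).
Proof. by move=> cf [K /(cos_sin_continuous _ _ cf)[]]. Qed.
Lemma sin_transform_continuous f : continuous f -> decays f -> continuous (sin_transform f).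
Proof. by move=> cf [K /(cos_sin_continuous _ _ cf)[]]. Qed.

Lemma decays_integralD f g : continuous f -> continuous g -> decays f -> decays g ->
  \int[mu]_x (f x + g x) = \int[mu]_x f x + \int[mu]_x g x.
Proof. by move=> cf cg [K fK] [L gL]; exact: dominated_integralD fK gL. Qed.
Lemma decays_integralB f g : continuous f -> continuous g -> decays f -> decays g ->
  \int[mu]_x (f x - g x) = \int[mu]_x f x - \int[mu]_x g x.
Proof. by move=> cf cg [K fK] [L gL]; exact: dominated_integralB fK gL. Qed.
Lemma decays_integralZ (c : R) f : continuous f -> decays f ->
  \int[mu]_x (c * f x) = c * \int[mu]_x f x.
Proof. by move=> cf [K fK]; exact: dominated_integralZ fK. Qed.
Lemma decays_le_integral f g : continuous f -> continuous g -> decays f -> decays g ->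
  (forall x, f x <= g x) -> \int[mu]_x f x <= \int[mu]_x g x.
Proof. by move=> cf cg [K fK] [L gL]; exact: le_dominated_integral fK gL. Qed.

Lemma cosf_continuous f x : continuous f -> continuous (fun y : R => cos (x * y) * f y).
Proof. by move=> cf; apply: ctsM => //; exact: cosx_continuous. Qed.
Lemma sinf_continuous f x : continuous f -> continuous (fun y : R => sin (x * y) * f y).
Proof. by move=> cf; apply: ctsM => //; exact: sinx_continuous. Qed.
Lemma cosf_decays f x : decays f -> decays (fun y : R => cos (x * y) * f y).
Proof. by apply: decaysM; exact: bounded_cosx. Qed.
Lemma sinf_decays f x : decays f -> decays (fun y : R => sin (x * y) * f y).
Proof. by apply: decaysM; exact: bounded_sinx. Qed.

Lemma cos_transformD f g x : continuous f -> continuous g -> decays f -> decays g ->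
  cos_transform (fun y => f y + g y) x = cos_transform f x + cos_transform g x.
Proof.
move=> cf cg df dg; rewrite /cos_transform -mulrDr -decays_integralD.
- by congr (_ * _); apply: eq_Rintegral => y _; rewrite mulrDr.
- exact: cosf_continuous.
- exact: cosf_continuous.
- exact: cosf_decays.
- exact: cosf_decays.
Qed.
Lemma sin_transformD f g x : continuous f -> continuous g -> decays f -> decays g ->
  sin_transform (fun y => f y + g y) x = sin_transform f x + sin_transform g x.
Proof.
move=> cf cg df dg; rewrite /sin_transform -mulrDr -decays_integralD.
- by congr (_ * _); apply: eq_Rintegral => y _; rewrite mulrDr.
- exact: sinf_continuous.
- exact: sinf_continuous.
- exact: sinf_decays.
- exact: sinf_decays.
Qed.
Lemma cos_transformZ (c : R) f x : continuous f -> decays f ->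
  cos_transform (fun y => c * f y) x = c * cos_transform f x.
Proof.
move=> cf df; rewrite /cos_transform [RHS]mulrCA; congr (_ * _).
rewrite -decays_integralZ.
- by apply: eq_Rintegral => y _; rewrite mulrCA.
- exact: cosf_continuous.
- exact: cosf_decays.
Qed.
Lemma sin_transformZ (c : R) f x : continuous f -> decays f ->
  sin_transform (fun y => c * f y) x = c * sin_transform f x.
Proof.
move=> cf df; rewrite /sin_transform [RHS]mulrCA; congr (_ * _).
rewrite -decays_integralZ.
- by apply: eq_Rintegral => y _; rewrite mulrCA.
- exact: sinf_continuous.
- exact: sinf_decays.
Qed.

Section derivative.
Variables (f f' : R -> R).
Hypotheses (ff' : forall x, is_derive x 1 f (f' x)) (cf' : continuous f')
  (df : decays f) (df' : decays f').

Lemma cos_transform_derivative x : cos_transform f' x = x * sin_transform f x.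
Proof.
have cf := ders_continuous _ _ ff'.
rewrite /cos_transform /sin_transform mulrCA; congr (_ * _); apply/eqP.
rewrite -subr_eq0 -decays_integralZ; last 2 first.
- exact: sinf_continuous.
- exact: sinf_decays.
rewrite -decays_integralB; last 4 first.
- exact: cosf_continuous.
- by apply: ctsZ; exact: sinf_continuous.
- exact: cosf_decays.
- by apply: decaysZ; exact: sinf_decays.
apply/eqP.
have D y : is_derive y 1 (fun y => cos (x * y) * f y) (cos (x * y) * f' y - x * (sin (x * y) * f y)).
  apply: (der_eq _ (derM (der_cos (derZ x (der_id y))) (ff' y))).
  by rewrite mulr1; ring.
apply: (integral_derivative_decays _ _ D).
- by apply: ctsB; [exact: cosf_continuous|apply: ctsZ; exact: sinf_continuous].
- by apply: decaysB; [exact: cosf_decays|apply: decaysZ; exact: sinf_decays].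
- exact: cosf_decays.
Qed.

Lemma sin_transform_derivative x : sin_transform f' x = - (x * cos_transform f x).
Proof.
have cf := ders_continuous _ _ ff'.
rewrite /cos_transform /sin_transform mulrCA -mulrN; congr (_ * _); apply/eqP.
rewrite -subr_eq0 opprK -decays_integralZ; last 2 first.
- exact: cosf_continuous.
- exact: cosf_decays.
rewrite -decays_integralD; last 4 first.
- exact: sinf_continuous.
- by apply: ctsZ; exact: cosf_continuous.
- exact: sinf_decays.
- by apply: decaysZ; exact: cosf_decays.
apply/eqP.
have D y : is_derive y 1 (fun y => sin (x * y) * f y) (sin (x * y) * f' y + x * (cos (x * y) * f y)).
  apply: (der_eq _ (derM (der_sin (derZ x (der_id y))) (ff' y))).
  by rewrite mulr1; ring.
apply: (integral_derivative_decays _ _ D).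
- by apply: ctsD; [exact: sinf_continuous|apply: ctsZ; exact: cosf_continuous].
- by apply: decaysD; [exact: sinf_decays|apply: decaysZ; exact: cosf_decays].
- exact: sinf_decays.
Qed.

End derivative.

Lemma transform_derive f (w w' : R -> R) x : continuous f -> decays f ->
  decays (fun y => y * f y) ->
  (forall z : R, is_derive z 1 w (w' z)) -> continuous w' ->
  (forall z, `|w z| <= 1) -> (forall z, `|w' z| <= 1) ->
  is_derive x 1 (fun x => c0 * \int[mu]_y (w (x * y) * f y))
    (c0 * \int[mu]_y (w' (x * y) * (y * f y))).
Proof.
move=> cf df [K dK] ww' cw' w1 w1'; have cw := ders_continuous _ _ ww'.
apply: derZ.
have derf (z y : R) : is_derive z 1 (fun z : R => w (z * y) * f y) (w' (z * y) * (y * f y)).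
  have H1 := derM (der_id z) (der_cst y z).
  have H2 := @der_comp R w (fun z => z * y) z _ _ (ww' (z * y)) H1.
  by apply: (der_eq _ (derM H2 (der_cst (f y) z))); ring.
have xI : (`]x - 1, x + 1[%classic : set R) x.
  by rewrite /= in_itv /=; apply/andP; split; [rewrite gtrBl|rewrite ltrDl].
have intf z : (`]x - 1, x + 1[%classic : set R) z -> mu.-integrable setT (EFin \o (fun y => w (z * y) * f y)).
  move=> _; have [L fL] := df; apply: (integrable_dominated L).
    by apply: ctsM => //; apply: (cts_comp w) => //; exact: mulx_continuous.
  by move=> y; rewrite normrM -[leRHS]mul1r ler_pM.
have derf1 z y : (`]x - 1, x + 1[%classic : set R) z -> setT y -> derivable (fun z : R => w (z * y) * f y) z 1.
  by move=> _ _; have [] := derf z y.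
have dE z y : partial1of2 (fun z y => w (z * y) * f y) z y = w' (z * y) * (y * f y).
  by rewrite partial1of2E; have [_ ->] := derf z y.
have G0 y : 0 <= K * lorentz y by rewrite mulr_ge0 ?lorentz_ge0 ?(dominated_ge0 _ _ dK).
have intG : mu.-integrable setT (EFin \o (fun y => K * lorentz y)).
  apply: (integrable_dominated K); first by apply: ctsZ; exact: lorentz_continuous.
  by move=> y; rewrite ger0_norm.
have Gub z y : (`]x - 1, x + 1[%classic : set R) z -> setT y ->
    `|partial1of2 (fun z y => w (z * y) * f y) z y| <= K * lorentz y.
  move=> _ _; rewrite dE normrM -[leRHS]mul1r ler_pM//; exact: dK.
have D1 := derivable_under_integral measurableT xI intf derf1 G0 intG Gub.
have D2 := differentiation_under_integral measurableT xI intf derf1 G0 intG Gub.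
apply: DeriveDef; first exact: D1.
rewrite -derive1E D2; apply: eq_Rintegral => y _.
exact: dE.
Qed.

Lemma cos_transform_derive f x : continuous f -> decays f -> decays (fun y => y * f y) ->
  is_derive x 1 (cos_transform f) (- sin_transform (fun y => y * f y) x).
Proof.
move=> cf df dxf.
have cs (z : R) : is_derive z 1 cos (- sin z) by exact: is_derive_cos.
have csin : continuous (fun z : R => - sin z) by apply: ctsN; exact: continuous_sin.
apply: (der_eq _ (transform_derive f _ _ x cf df dxf cs csin cos_bound _)).
  by move=> z; rewrite normrN sin_bound.
rewrite /sin_transform -mulrN; congr (_ * _).
rewrite -[RHS]mulN1r -decays_integralZ.
- by apply: eq_Rintegral => y _; rewrite mulN1r mulNr.
- by apply: sinf_continuous; apply: ctsM => // y; exact: cvg_id.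
- exact: sinf_decays.
Qed.

Lemma sin_transform_derive f x : continuous f -> decays f -> decays (fun y => y * f y) ->
  is_derive x 1 (sin_transform f) (cos_transform (fun y => y * f y) x).
Proof.
move=> cf df dxf.
have sc (z : R) : is_derive z 1 sin (cos z) by exact: is_derive_sin.
exact: (transform_derive f _ _ x cf df dxf sc (@continuous_cos R) sin_bound cos_bound).
Qed.

Definition gauss (s x : R) : R := expR (- (x ^+ 2 / (2 * s ^+ 2))).

Lemma gauss_ge0 s x : 0 <= gauss s x. Proof. exact: expR_ge0. Qed.
Lemma gauss_le1 s x : gauss s x <= 1.
Proof.
by rewrite -expR0 ler_expR oppr_le0 divr_ge0 ?sqr_ge0// mulr_ge0 ?sqr_ge0.
Qed.

Lemma der_gauss s x : is_derive x 1 (gauss s) (- (x / s ^+ 2 * gauss s x)).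
Proof.
pose c := - (2 * s ^+ 2)^-1.
have H := der_expR (derZ c (derM (der_id x) (der_id x))).
have E : (fun y : R => expR (c * (y * y))) =1 gauss s.
  by move=> y; rewrite /gauss /c -expr2 mulNr mulrC.
apply: (der_eq _ (der_ext _ H E)); rewrite -E.
rewrite /c invfM; set e := expR _; set r := (s ^+ 2)^-1; by field.
Qed.

Lemma gauss_continuous s : continuous (gauss s).
Proof. exact: ders_continuous (der_gauss s). Qed.

(** With z = x^2 / (2 s^2), use exp z >= 1 + z^2 / 2. *)
Lemma gauss_le s x : 0 < s -> (1 + x ^+ 2) ^+ 2 * gauss s x <= 2 * (1 + 8 * s ^+ 4).
Proof.
move=> s0; pose z := x ^+ 2 / (2 * s ^+ 2).
have z0 : 0 <= z by rewrite divr_ge0 ?sqr_ge0// mulr_ge0 ?sqr_ge0.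
have := expR_ge1Dxn 1 z0; rewrite /= => ez.
have g0 : 0 < gauss s x by exact: expR_gt0.
have gz : gauss s x * expR z = 1 by rewrite /gauss -/z expRN mulVf ?gt_eqF ?expR_gt0.
have h1 : gauss s x * (1 + z ^+ 2 / 2) <= 1 by rewrite -[leRHS]gz ler_wpM2l// ltW.
have h2 : (1 + x ^+ 2) ^+ 2 <= 2 * (1 + 8 * s ^+ 4) * (1 + z ^+ 2 / 2).
  have -> : x ^+ 2 = 2 * s ^+ 2 * z by rewrite /z; field; rewrite gt_eqF.
  have := mulr_ge0 (sqr_ge0 s) z0; have := sqr_ge0 (1 - 2 * s ^+ 2 * z); have := sqr_ge0 z.
  have : 0 <= s ^+ 4 by exact: exprn_ge0 (ltW s0).
  have -> : (1 + 2 * s ^+ 2 * z) ^+ 2 = 1 + 4 * (s ^+ 2 * z) + 4 * (s ^+ 4 * z ^+ 2) by ring.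
  have -> : (1 - 2 * s ^+ 2 * z) ^+ 2 = 1 - 4 * (s ^+ 2 * z) + 4 * (s ^+ 4 * z ^+ 2) by ring.
  have -> : 2 * (1 + 8 * s ^+ 4) * (1 + z ^+ 2 / 2) = 2 + 16 * s ^+ 4 + z ^+ 2 + 8 * (s ^+ 4 * z ^+ 2) by field.
  by lra.
apply: le_trans (ler_wpM2r (ltW g0) h2) _.
have c_ge0 : 0 <= 2 * (1 + 8 * s ^+ 4).
  by rewrite mulr_ge0// addr_ge0// mulr_ge0// exprn_ge0// ltW.
by rewrite -[leLHS]mulrA -[leRHS]mulr1 (ler_wpM2l c_ge0)// mulrC.
Qed.

Lemma gauss_decays s : 0 < s -> decays (gauss s) /\ decays (fun x => x * gauss s x).
Proof.
move=> s0.
have key x : (1 + x ^+ 2) * gauss s x <= 2 * (1 + 8 * s ^+ 4) * lorentz x.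
  rewrite ler_pdivlMr ?oneDsqr_gt0// mulrAC -expr2; exact: gauss_le.
split; exists (2 * (1 + 8 * s ^+ 4)) => x.
  rewrite ger0_norm ?gauss_ge0// (le_trans _ (key x))//.
  by rewrite ler_peMl ?gauss_ge0// lerDl sqr_ge0.
rewrite normrM (ger0_norm (gauss_ge0 _ _)) (le_trans _ (key x))//.
rewrite ler_wpM2r ?gauss_ge0// ler_norml; have := sqr_ge0 (x - 1); have := sqr_ge0 (x + 1).
by move=> ? ?; apply/andP; split; nra.
Qed.

Lemma decays_translate f x : decays f -> decays (fun y => f (y - x)).
Proof.
move=> [K fK]; have K0 := dominated_ge0 _ _ fK.
exists (K * (2 * (1 + x ^+ 2))) => y.
rewrite (le_trans (fK _))// -mulrA ler_wpM2l//.
rewrite ler_pdivlMr ?oneDsqr_gt0// mulrC ler_pdivrMr ?oneDsqr_gt0//.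
have := sqr_ge0 (y - 2 * x); have := sqr_ge0 (x * (y - x)); nra.
Qed.

Lemma gauss_decays2 s : 0 < s -> decays (fun x => x ^+ 2 * gauss s x).
Proof.
move=> s0; exists (2 * (1 + 8 * s ^+ 4)) => x.
rewrite normrM (ger0_norm (sqr_ge0 x)) (ger0_norm (gauss_ge0 s x)).
apply: (@le_trans _ _ ((1 + x ^+ 2) * gauss s x)).
  by rewrite ler_wpM2r ?gauss_ge0// lerDr.
rewrite ler_pdivlMr ?oneDsqr_gt0// mulrAC -expr2; exact: gauss_le.
Qed.

Lemma integral_gauss s m : 0 < s -> \int[mu]_x gauss s (x - m) = s * Num.sqrt (pi *+ 2).
Proof.
move=> s0; have sn0 : s != 0 by rewrite gt_eqF.
have := @integral_normal_pdf R m s; rewrite (normal_pdfE _ sn0).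
have E x : normal_peak s * normal_fun m s x = normal_peak s * gauss s (x - m).
  congr (_ * _); rewrite /normal_fun /gauss mulNr; congr (expR (- (_ / _))).
  by rewrite mulr_natl.
under eq_integral do rewrite E.
move=> H.
have cm : continuous (fun x => gauss s (x - m)).
  by apply: (cts_comp (gauss s)); [exact: gauss_continuous|apply: ctsB => x; [exact: cvg_id|exact: cvg_cst]].
have : normal_peak s * \int[mu]_x gauss s (x - m) = 1.
  rewrite -(decays_integralZ _ _ cm (decays_translate _ m (gauss_decays s s0).1)).
  by rewrite /Rintegral H.
have -> : normal_peak s = (s * Num.sqrt (pi *+ 2))^-1.
  rewrite /normal_peak; congr (_^-1).
  by rewrite -mulrnAr sqrtrM ?sqr_ge0// sqrtr_sqr gtr0_norm.
have p0 : s * Num.sqrt (pi *+ 2) != 0 :> R.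
  by rewrite (mulf_neq0 sn0 (lt0r_neq0 sqrt2pi_gt0)).
by move=> /(congr1 (fun z => s * Num.sqrt (pi *+ 2) * z)); rewrite mulr1 mulVKf.
Qed.

(** The derivative of the Gaussian is proportional to x times the Gaussian, so
    its transform A satisfies A' = - s^2 z A. *)
Lemma cos_transform_gauss s z : 0 < s ->
  cos_transform (gauss s) z = s * expR (- (s ^+ 2 * z ^+ 2 / 2)).
Proof.
move=> s0; have [dg dxg] := gauss_decays s s0; have cg := gauss_continuous s.
have cxg : continuous (fun x => x * gauss s x) by apply: ctsM => // y; exact: cvg_id.
pose A z := cos_transform (gauss s) z.
have A' y : is_derive y 1 A (- (s ^+ 2 * (y * A y))).
  apply: (der_eq _ (cos_transform_derive (gauss s) y cg dg dxg)).
  have gg x : is_derive x 1 (gauss s) (- (s ^+ 2)^-1 * (x * gauss s x)).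
    by apply: (der_eq _ (der_gauss s x)); ring.
  have cg' : continuous (fun x => - (s ^+ 2)^-1 * (x * gauss s x)) by exact: ctsZ.
  have := sin_transform_derivative _ _ gg cg' dg (decaysZ _ _ dxg) y.
  rewrite sin_transformZ// => /(congr1 (fun t => s ^+ 2 * t)).
  rewrite mulrA mulrN mulfV ?mulN1r; first by move=> ->; rewrite mulrN.
  by rewrite expf_neq0// gt_eqF.
pose F z := A z * expR (s ^+ 2 / 2 * (z * z)).
have F' y : is_derive y 1 F 0.
  apply: (der_eq _ (derM (A' y) (der_expR (derZ (s ^+ 2 / 2) (derM (der_id y) (der_id y)))))).
  by field.
have := is_derive_0_is_cst z 0 F'; rewrite /F mulr0 mulr0 expR0 mulr1.
have -> : A 0 = s.
  rewrite /A /cos_transform.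
  under eq_Rintegral => x _ do rewrite mul0r cos0 mul1r.
  have := integral_gauss s 0 s0; under eq_Rintegral => x _ do rewrite subr0.
  move=> ->; rewrite mulrCA mulVf ?mulr1//.
  exact: lt0r_neq0 sqrt2pi_gt0.
have -> : s ^+ 2 * z ^+ 2 / 2 = s ^+ 2 / 2 * (z * z) by field.
by rewrite expRN => As; rewrite -[X in X / _]As mulfK// gt_eqF ?expR_gt0.
Qed.

(** Integrate the derivative of - s^2 (y - m) gauss s (y - m). *)
Lemma gauss_translate_moments s m : 0 < s ->
  continuous (fun y => gauss s (y - m)) /\
  \int[mu]_y ((y - m) ^+ 2 * gauss s (y - m)) = s ^+ 2 * \int[mu]_y gauss s (y - m).
Proof.
move=> s0; have cm : continuous (fun x => gauss s (x - m)).
  by apply: (cts_comp (gauss s)); [exact: gauss_continuous|apply: ctsB => x; [exact: cvg_id|exact: cvg_cst]].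
have cx : continuous (fun y : R => y - m).
  by apply: ctsB => x; [exact: cvg_id|exact: cvg_cst].
have d0 := decays_translate _ m (gauss_decays s s0).1.
have d1 := decays_translate _ m (gauss_decays s s0).2.
have d2 := decays_translate _ m (gauss_decays2 s s0).
split=> //.
have dm (y : R) : is_derive y 1 (fun y : R => y - m) 1.
  by apply: (der_eq _ (derB (der_id y) (der_cst m y))); rewrite subr0.
have D (y : R) : is_derive y 1 (fun y => - (s ^+ 2 * ((y - m) * gauss s (y - m))))
    ((y - m) ^+ 2 * gauss s (y - m) - s ^+ 2 * gauss s (y - m)).
  have Hg := @der_comp R (gauss s) (fun y => y - m) y _ _ (der_gauss s (y - m)) (dm y).
  apply: (der_eq _ (derN (derZ (s ^+ 2) (derM (dm y) Hg)))).
  by field; rewrite gt_eqF.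
apply/eqP; rewrite -subr_eq0 -decays_integralZ// -decays_integralB//.
- apply/eqP; apply: (integral_derivative_decays _ _ D).
  + by apply: ctsB; [apply: ctsM => //; exact: ctsX|exact: ctsZ].
  + by apply: decaysB => //; exact: decaysZ.
  + by apply: decaysN; exact: decaysZ.
- by apply: ctsM => //; exact: ctsX.
- exact: ctsZ.
- exact: decaysZ.
Qed.

(** The first absolute moment is bounded through
    |y - x| <= s/2 + (y - x)^2 / (2 s), so only the second moment is computed. *)
Lemma gauss_mollify (p : R -> R) (Lam s x : R) : 0 < s -> continuous p -> decays p ->
  (forall x y, `|p x - p y| <= Lam * `|x - y|) ->
  `|\int[mu]_y (p y * (c0 / s * gauss s (y - x))) - p x| <= Lam * s.
Proof.
move=> s0 cp dp pL; have [cg M2] := gauss_translate_moments _ x s0.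
have I0 := integral_gauss s x s0.
have sq0 := @sqrt2pi_gt0.
have a0 : 0 <= c0 / s by rewrite divr_ge0 ?c0_ge0// ltW.
have cx : continuous (fun y : R => y - x).
  by apply: ctsB => z; [exact: cvg_id|exact: cvg_cst].
have d0 := decays_translate _ x (gauss_decays s s0).1.
have d2 := decays_translate _ x (gauss_decays2 s s0).
have dn : decays (fun y => c0 / s * gauss s (y - x)) by exact: decaysZ.
have cn : continuous (fun y => c0 / s * gauss s (y - x)) by exact: ctsZ.
have n1 : \int[mu]_y (c0 / s * gauss s (y - x)) = 1.
  by rewrite decays_integralZ// I0; field; rewrite !gt_eqF.
have bp := decays_bounded _ dp.
have -> : p x = \int[mu]_y (p x * (c0 / s * gauss s (y - x))).
  by rewrite decays_integralZ// n1 mulr1.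
rewrite -decays_integralB//; last 4 first.
- exact: ctsM.
- exact: ctsZ.
- exact: decaysM.
- exact: decaysZ.
have cd : continuous (fun y => p y * (c0 / s * gauss s (y - x)) - p x * (c0 / s * gauss s (y - x))).
  by apply: ctsB; [exact: ctsM|exact: ctsZ].
have dd : decays (fun y => p y * (c0 / s * gauss s (y - x)) - p x * (c0 / s * gauss s (y - x))).
  by apply: decaysB; [exact: decaysM|exact: decaysZ].
have [K dK] := dd.
apply: le_trans (le_normr_Rintegral _ _) _ => //; first exact: integrable_dominated dK.
have Lam0 : 0 <= Lam.
  by have := pL 1 0; rewrite subr0 normr1 mulr1; exact: le_trans.
pose B y := Lam * (c0 / s) * (s / 2 * gauss s (y - x) + (2 * s)^-1 * ((y - x) ^+ 2 * gauss s (y - x))).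
have -> : Lam * s = \int[mu]_y B y.
  rewrite /B decays_integralZ; last 2 first.
  - apply: ctsD; apply: ctsZ => //; apply: ctsM => //; exact: ctsX.
  - by apply: decaysD; exact: decaysZ.
  rewrite decays_integralD; last 4 first.
  - exact: ctsZ.
  - by apply: ctsZ; apply: ctsM => //; exact: ctsX.
  - exact: decaysZ.
  - exact: decaysZ.
  rewrite decays_integralZ// decays_integralZ//; last by apply: ctsM => //; exact: ctsX.
  by rewrite M2 I0; field; rewrite !gt_eqF.
apply: decays_le_integral.
- exact: cts_abs.
- apply: ctsZ; apply: ctsD; apply: ctsZ => //; apply: ctsM => //; exact: ctsX.
- by exists K => y; rewrite normr_id.
- by apply: decaysZ; apply: decaysD; exact: decaysZ.
move=> y; rewrite -mulrBl normrM (ger0_norm (mulr_ge0 a0 (gauss_ge0 s (y - x)))).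
have h : `|y - x| <= s / 2 + (2 * s)^-1 * (y - x) ^+ 2.
  rewrite -subr_ge0.
  have -> : s / 2 + (2 * s)^-1 * (y - x) ^+ 2 - `|y - x| = (2 * s)^-1 * (s - `|y - x|) ^+ 2.
    by rewrite -(real_normK (num_real (y - x))); field; rewrite gt_eqF.
  by rewrite mulr_ge0 ?sqr_ge0// invr_ge0 mulr_ge0// ltW.
rewrite /B [leRHS](_ : _ = Lam * (s / 2 + (2 * s)^-1 * (y - x) ^+ 2) * (c0 / s * gauss s (y - x))); last by ring.
rewrite (ler_wpM2r (mulr_ge0 a0 (gauss_ge0 s (y - x))))//.
by rewrite (le_trans (pL _ _))// ler_wpM2l.
Qed.

End plancherel.

Section energy.
Context {R : realType}.
Local Notation mu := (@lebesgue_measure R).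
Implicit Types (f g p q : R -> R) (K x y z t : R).
Local Notation c0 := ((Num.sqrt (pi *+ 2))^-1 : R).

Lemma fubini_decays (F G : R -> R) (w : R -> R) (a : R -> R -> R) :
  continuous F -> continuous G -> decays F -> decays G ->
  continuous w -> (forall x, `|w x| <= 1) ->
  measurable_fun setT (fun z : R * R => a z.1 z.2) ->
  \int[mu]_x (F x * \int[mu]_y (w (a x y) * G y)) =
  \int[mu]_y (G y * \int[mu]_x (w (a x y) * F x)).
Proof.
move=> cF cG [K FK] [L GL] cw w1 ma.
apply: (fubini_kernel K L F G (fun x y => w (a x y))) => //.
exact: (measurableT_comp (measurable_cts _ cw) ma).
Qed.

Lemma measurable_mul2 : measurable_fun setT (fun z : R * R => z.1 * z.2).
Proof. by apply: measurable_funM; [exact: measurable_fst|exact: measurable_snd]. Qed.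

Lemma cos_transform_symmetric f g : continuous f -> continuous g -> decays f -> decays g ->
  \int[mu]_x (f x * cos_transform g x) = \int[mu]_x (cos_transform f x * g x).
Proof.
move=> cf cg df dg.
have H := fubini_decays f g cos (fun x y => x * y) cf cg df dg (@continuous_cos R) cos_bound measurable_mul2.
have bg := cos_transform_bounded _ cg dg; have bf := cos_transform_bounded _ cf df.
have cgt := cos_transform_continuous _ cg dg; have cft := cos_transform_continuous _ cf df.
have s0 : c0 != 0 := invr_neq0 (lt0r_neq0 sqrt2pi_gt0).
have E1 x : \int[mu]_y (cos (x * y) * g y) = c0^-1 * cos_transform g x.
  by rewrite /cos_transform mulKf.
have E2 y : \int[mu]_x (cos (x * y) * f x) = c0^-1 * cos_transform f y.
  rewrite /cos_transform mulKf//; by apply: eq_Rintegral => x _; rewrite [y * x]mulrC.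
have : \int[mu]_x (c0^-1 * (f x * cos_transform g x)) = \int[mu]_x (c0^-1 * (cos_transform f x * g x)).
  transitivity (\int[mu]_x (f x * \int[mu]_y (cos (x * y) * g y))).
    by apply: eq_Rintegral => x _; rewrite E1; ring.
  by rewrite H; apply: eq_Rintegral => x _; rewrite E2; ring.
rewrite !decays_integralZ.
- by move/(congr1 (fun t => c0 * t)); rewrite !mulVKf.
- exact: ctsM.
- exact: decaysM.
- exact: ctsM.
- exact: decaysMr.
Qed.

Lemma sin_transform_symmetric f g : continuous f -> continuous g -> decays f -> decays g ->
  \int[mu]_x (f x * sin_transform g x) = \int[mu]_x (sin_transform f x * g x).
Proof.
move=> cf cg df dg.
have H := fubini_decays f g sin (fun x y => x * y) cf cg df dg (@continuous_sin R) sin_bound measurable_mul2.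
have bg := sin_transform_bounded _ cg dg; have bf := sin_transform_bounded _ cf df.
have cgt := sin_transform_continuous _ cg dg; have cft := sin_transform_continuous _ cf df.
have s0 : c0 != 0 := invr_neq0 (lt0r_neq0 sqrt2pi_gt0).
have E1 x : \int[mu]_y (sin (x * y) * g y) = c0^-1 * sin_transform g x.
  by rewrite /sin_transform mulKf.
have E2 y : \int[mu]_x (sin (x * y) * f x) = c0^-1 * sin_transform f y.
  rewrite /sin_transform mulKf//; by apply: eq_Rintegral => x _; rewrite [y * x]mulrC.
have : \int[mu]_x (c0^-1 * (f x * sin_transform g x)) = \int[mu]_x (c0^-1 * (sin_transform f x * g x)).
  transitivity (\int[mu]_x (f x * \int[mu]_y (sin (x * y) * g y))).
    by apply: eq_Rintegral => x _; rewrite E1; ring.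
  by rewrite H; apply: eq_Rintegral => x _; rewrite E2; ring.
rewrite !decays_integralZ.
- by move/(congr1 (fun t => c0 * t)); rewrite !mulVKf.
- exact: ctsM.
- exact: decaysM.
- exact: ctsM.
- exact: decaysMr.
Qed.

(** Damping the transform by a Gaussian and transforming back amounts to
    convolution with a Gaussian of width s. *)
Lemma damped_inversion p s x : 0 < s -> continuous p -> decays p ->
  cos_transform (fun z => gauss s^-1 z * cos_transform p z) x +
  sin_transform (fun z => gauss s^-1 z * sin_transform p z) x =
  \int[mu]_y (p y * (c0 / s * gauss s (y - x))).
Proof.
move=> s0 cp dp; have si0 : 0 < s^-1 by rewrite invr_gt0.
have cC := cos_transform_continuous _ cp dp; have cS := sin_transform_continuous _ cp dp.
have bC := cos_transform_bounded _ cp dp; have bS := sin_transform_bounded _ cp dp.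
have cg := gauss_continuous (s^-1); have dg := (gauss_decays _ si0).1.
rewrite /cos_transform /sin_transform -mulrDr -decays_integralD; last 4 first.
- by apply: cosf_continuous; apply: ctsM.
- by apply: sinf_continuous; apply: ctsM.
- by apply: cosf_decays; apply: decaysMr.
- by apply: sinf_decays; apply: decaysMr.
have ma : measurable_fun setT (fun z : R * R => z.1 * (z.2 - x)).
  apply: measurable_funM; first exact: measurable_fst.
  by apply: measurable_funB; [exact: measurable_snd|exact: measurable_cst].
have H := fubini_decays (gauss s^-1) (fun y => c0 * p y) cos (fun z y => z * (y - x))
  cg (ctsZ _ _ cp) dg (decaysZ _ _ dp) (@continuous_cos R) cos_bound ma.
transitivity (c0 * \int[mu]_z (gauss s^-1 z * \int[mu]_y (cos (z * (y - x)) * (c0 * p y)))).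
  congr (_ * _); apply: eq_Rintegral => z _.
  rewrite (_ : \int[mu]_y (cos (z * (y - x)) * (c0 * p y)) =
    cos (x * z) * c0 * \int[mu]_y (cos (z * y) * p y) +
    sin (x * z) * c0 * \int[mu]_y (sin (z * y) * p y)); first by ring.
  rewrite -decays_integralZ; last 2 first.
  - exact: cosf_continuous.
  - exact: cosf_decays.
  rewrite -decays_integralZ; last 2 first.
  - exact: sinf_continuous.
  - exact: sinf_decays.
  rewrite -decays_integralD; last 4 first.
  - by apply: ctsZ; exact: cosf_continuous.
  - by apply: ctsZ; exact: sinf_continuous.
  - by apply: decaysZ; exact: cosf_decays.
  - by apply: decaysZ; exact: sinf_decays.
  by apply: eq_Rintegral => y _; rewrite mulrBr cosB [x * z]mulrC; ring.
have sq0 : Num.sqrt (pi *+ 2) != 0 :> R := lt0r_neq0 sqrt2pi_gt0.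
have cosg y : \int[mu]_z (cos (z * (y - x)) * gauss s^-1 z) = c0^-1 * (s^-1 * gauss s (y - x)).
  transitivity (c0^-1 * cos_transform (gauss s^-1) (y - x)).
    rewrite /cos_transform mulKf ?invr_neq0//.
    by apply: eq_Rintegral => z _; rewrite [z * _]mulrC.
  rewrite cos_transform_gauss// /gauss; congr (_ * (_ * expR (- _))).
  by field; rewrite gt_eqF.
have cgx : continuous (fun y => gauss s (y - x)) by have [] := gauss_translate_moments s x s0.
have dgx := decays_translate _ x (gauss_decays s s0).1.
have bp := decays_bounded _ dp.
rewrite H -decays_integralZ.
- apply: eq_Rintegral => y _; rewrite cosg invrK; field.
  by rewrite sq0 gt_eqF.
- under eq_fun => y do rewrite cosg.
  by apply: ctsM; apply: ctsZ => //; exact: ctsZ.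
- under eq_fun => y do rewrite cosg.
  by apply: decaysM; [exact: boundedZ|apply: decaysZ; exact: decaysZ].
Qed.

(** Pair the damped inversion formula with p: the left side tends to the integral
    of the squared transform by dominated convergence, the right side to that of
    p^2, with error at most a multiple of s because p is Lipschitz. *)
Theorem plancherel p (p' : R -> R) : (forall x, is_derive x 1 p (p' x)) ->
  decays p -> bounded_fun p' ->
  decays (fun z => cos_transform p z ^+ 2 + sin_transform p z ^+ 2) ->
  \int[mu]_z (cos_transform p z ^+ 2 + sin_transform p z ^+ 2) = \int[mu]_x p x ^+ 2.
Proof.
move=> pp' dp [Lam pLam] dCS; have cp := ders_continuous _ _ pp'.
have pL := ders_lipschitz p p' Lam pp' pLam.
have cC := cos_transform_continuous _ cp dp; have cS := sin_transform_continuous _ cp dp.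
have bC := cos_transform_bounded _ cp dp; have bS := sin_transform_bounded _ cp dp.
have cCS : continuous (fun z => cos_transform p z ^+ 2 + sin_transform p z ^+ 2).
  by apply: ctsD; exact: ctsX.
pose I s := \int[mu]_z (gauss s^-1 z * (cos_transform p z ^+ 2 + sin_transform p z ^+ 2)).
have [K pK] := dp.
have IE s : 0 < s -> `|I s - \int[mu]_x p x ^+ 2| <= K * Lam * mass * s.
  move=> s0; have si0 : 0 < s^-1 by rewrite invr_gt0.
  have cg := gauss_continuous (s^-1); have dg := (gauss_decays _ si0).1.
  pose gC z := gauss s^-1 z * cos_transform p z.
  pose gS z := gauss s^-1 z * sin_transform p z.
  have cgC : continuous gC by exact: ctsM.
  have cgS : continuous gS by exact: ctsM.
  have dgC : decays gC by exact: decaysMr.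
  have dgS : decays gS by exact: decaysMr.
  pose u x := cos_transform gC x + sin_transform gS x.
  have cu : continuous u.
    by apply: ctsD; [exact: cos_transform_continuous|exact: sin_transform_continuous].
  have bu : bounded_fun u.
    by apply: boundedD; [exact: cos_transform_bounded|exact: sin_transform_bounded].
  have -> : I s = \int[mu]_x (p x * u x).
    transitivity (\int[mu]_z (gC z * cos_transform p z + gS z * sin_transform p z)).
      by apply: eq_Rintegral => z _; rewrite /gC /gS; ring.
    rewrite decays_integralD; last 4 first.
    - exact: ctsM.
    - exact: ctsM.
    - exact: decaysMr.
    - exact: decaysMr.
    rewrite (cos_transform_symmetric gC p)// (sin_transform_symmetric gS p)//.
    rewrite -decays_integralD; last 4 first.
    - by apply: ctsM => //; exact: cos_transform_continuous.
    - by apply: ctsM => //; exact: sin_transform_continuous.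
    - by apply: decaysM => //; exact: cos_transform_bounded.
    - by apply: decaysM => //; exact: sin_transform_bounded.
    by apply: eq_Rintegral => x _; rewrite /u; ring.
  have bp := decays_bounded _ dp.
  rewrite -decays_integralB; last 4 first.
  - exact: ctsM.
  - exact: ctsX.
  - exact: decaysMr.
  - exact: decaysX2.
  rewrite mulrAC; apply: le_norm_integral_dominated.
    by apply: measurable_cts; apply: ctsB; [exact: ctsM|exact: ctsX].
  move=> x; rewrite expr2 -mulrBr mulrC normrM.
  rewrite [leRHS](_ : _ = Lam * s * (K * lorentz x)); last by ring.
  rewrite ler_pM// /u damped_inversion//.
  exact: gauss_mollify.
pose sn (n : nat) : R := n.+1%:R^-1.
have sn0 n : 0 < sn n by rewrite invr_gt0.
have c1 : I (sn n) @[n --> \oo] --> \int[mu]_x p x ^+ 2.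
  apply/subr_cvg0; apply: norm_cvg0.
  apply: (@squeeze_cvgr _ _ _ _ (fun=> 0) (fun n => K * Lam * mass * sn n)).
  - by apply: nearW => n; rewrite normr_ge0 /=; exact: IE.
  - exact: cvg_cst.
  - by rewrite -(mulr0 (K * Lam * mass)); apply: cvgMl_tmp; exact: cvg_harmonic.
have [M CSM] := dCS.
have c2 : I (sn n) @[n --> \oo] --> \int[mu]_z (cos_transform p z ^+ 2 + sin_transform p z ^+ 2).
  apply: (dominated_cvg_integral M).
  - move=> n; apply: measurable_cts; apply: ctsM => //; exact: gauss_continuous.
  - exact: measurable_cts.
  - move=> n z; rewrite normrM (ger0_norm (gauss_ge0 _ _)) -[leRHS]mul1r.
    by rewrite ler_pM ?gauss_ge0 ?gauss_le1//; exact: CSM.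
  - move=> z; rewrite -[X in _ --> X]mul1r; apply: cvgMr_tmp.
    apply: (@squeeze_cvgr _ _ _ _ (fun n => 1 - z ^+ 2 / 2 * sn n) (fun=> 1)).
    + apply: nearW => n; rewrite gauss_le1 andbT.
      apply: le_trans (expR_ge1Dx _); rewrite lerD2l lerN2 invfM mulrA ler_wpM2l//.
        by rewrite mulr_ge0 ?sqr_ge0.
      rewrite /sn invrK -exprVn expr2 ler_piMr ?invr_ge0// invf_le1 ?ltr0n//.
      by rewrite ler1n.
    + rewrite -[X in _ --> X]subr0 -(mulr0 (z ^+ 2 / 2)).
      apply: cvgB; first exact: cvg_cst.
      by apply: cvgMl_tmp; exact: cvg_harmonic.
    + exact: cvg_cst.
exact: cvg_unique c2 c1.
Qed.

(** The square of the H^-1 norm. *)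
Definition negative_energy q : R :=
  \int[mu]_z ((cos_transform q z ^+ 2 + sin_transform q z ^+ 2) * lorentz z).

(** The transform of q = p' + 2 k p is (i z + 2 k) times that of p, hence
    |q^|^2 = (z^2 + 4 k^2) |p^|^2, and 1 + z^2 <= z^2 + 4 k^2 <= 4 k^2 (1 + z^2). *)
Lemma resolvent_energy (k : R) q p (q' : R -> R) : 1 <= k ->
  (forall x, is_derive x 1 p (q x - 2 * k * p x)) -> decays p ->
  continuous q -> decays q ->
  \int[mu]_x p x ^+ 2 <= negative_energy q <= 4 * k ^+ 2 * \int[mu]_x p x ^+ 2.
Proof.
move=> k1 p' dp cq dq; have cp := ders_continuous _ _ p'.
pose p1 x := q x - 2 * k * p x.
have cp1 : continuous p1 by apply: ctsB => //; exact: ctsZ.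
have dp1 : decays p1 by apply: decaysB => //; exact: decaysZ.
have qE : q = fun x => p1 x + 2 * k * p x by apply/funext => x; rewrite /p1 subrK.
have ckp : continuous (fun x => 2 * k * p x) by exact: ctsZ.
have dkp : decays (fun x => 2 * k * p x) by exact: decaysZ.
have E z : cos_transform q z ^+ 2 + sin_transform q z ^+ 2 =
    (z ^+ 2 + 4 * k ^+ 2) * (cos_transform p z ^+ 2 + sin_transform p z ^+ 2).
  rewrite {1 2}qE cos_transformD// sin_transformD// cos_transformZ// sin_transformZ//.
  rewrite (cos_transform_derivative p p1 p' cp1 dp dp1).
  rewrite (sin_transform_derivative p p1 p' cp1 dp dp1); ring.
set CS := fun z => cos_transform p z ^+ 2 + sin_transform p z ^+ 2.
have CS0 z : 0 <= CS z by rewrite addr_ge0 ?sqr_ge0.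
have k21 : 1 <= k ^+ 2 by rewrite exprn_ege1.
have [A qA] : bounded_fun (fun z => cos_transform q z ^+ 2 + sin_transform q z ^+ 2).
  by apply: boundedD; apply: boundedX2; [exact: cos_transform_bounded|exact: sin_transform_bounded].
have le1 z : CS z <= (cos_transform q z ^+ 2 + sin_transform q z ^+ 2) * lorentz z.
  rewrite ler_pdivlMr ?oneDsqr_gt0// E mulrC ler_wpM2r//; lra.
have dCS : decays CS.
  exists A => z; rewrite ger0_norm// (le_trans (le1 z))// ler_wpM2r ?lorentz_ge0//.
  by rewrite (le_trans (ler_norm _)).
have cCS : continuous CS.
  by apply: ctsD; apply: ctsX; [exact: cos_transform_continuous|exact: sin_transform_continuous].
have cW : continuous (fun z => (cos_transform q z ^+ 2 + sin_transform q z ^+ 2) * lorentz z).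
  apply: ctsM; last exact: lorentz_continuous.
  by apply: ctsD; apply: ctsX; [exact: cos_transform_continuous|exact: sin_transform_continuous].
have dW : decays (fun z => (cos_transform q z ^+ 2 + sin_transform q z ^+ 2) * lorentz z).
  apply: decaysM; first by exists A.
  by exists 1 => z; rewrite ger0_norm ?lorentz_ge0// mul1r.
have bp1 := decays_bounded _ dp1.
rewrite -(plancherel p p1 p' dp bp1 dCS); apply/andP; split.
  exact: decays_le_integral.
rewrite -decays_integralZ//; apply: decays_le_integral => //.
- exact: ctsZ.
- exact: decaysZ.
- move=> z; rewrite ler_pdivrMr ?oneDsqr_gt0// E -/(CS z) mulrAC ler_wpM2r//.
  have := sqr_ge0 z; nra.
Qed.

End energy.

(** * Schwartz functions *)

Section schwartz_space.
Context {R : realType}.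
Implicit Types (f g : R -> R) (K x y : R).

Definition rapid f := forall m : nat, exists K : R, forall x, `|x ^+ m * f x| <= K.

Lemma seminorm_bounded (m n : nat) f : (schwartz_seminorm m n f < +oo)%E ->
  exists K : R, forall x, `|x ^+ m * derive1n n f x| <= K.
Proof.
move=> fin.
have H x : ((`|x ^+ m * derive1n n f x|)%:E <= schwartz_seminorm m n f)%E.
  by apply: ereal_sup_ubound; exists x.
exists (fine (schwartz_seminorm m n f)) => x; rewrite -lee_fin fineK//.
rewrite fin_numElt fin andbT; apply: lt_le_trans (H 0); exact: ltNyr.
Qed.

Lemma bounded_seminorm (m n : nat) f K : (forall x, `|x ^+ m * derive1n n f x| <= K) ->
  (schwartz_seminorm m n f < +oo)%E.
Proof.
move=> fK; apply: (@le_lt_trans _ _ K%:E); last exact: ltry.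
by apply: ge_ereal_sup => _ [x _ <-]; rewrite lee_fin.
Qed.

Lemma schwartz_der f n x : schwartz f -> is_derive x 1 (derive1n n f) (derive1n n.+1 f x).
Proof. by move=> [df _]; apply: DeriveDef; [exact: df|rewrite derive1nS derive1E]. Qed.

Lemma schwartz_rapid f n : schwartz f -> rapid (derive1n n f).
Proof. by move=> [_ fin] m; exact: seminorm_bounded. Qed.

Lemma schwartz_derive1 f : schwartz f -> schwartz (derive1 f).
Proof.
have E n : derive1n n (derive1 f) = derive1n n.+1 f by rewrite /derive1n iterSr.
move=> [df fin]; split=> [n x|m n]; first by rewrite E; exact: df.
have [K fK] := seminorm_bounded _ _ _ (fin m n.+1).
by apply: (bounded_seminorm _ _ _ K) => x; rewrite E.
Qed.

(** A class of rapidly decreasing functions that contains a derivative of each of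
    its members consists of Schwartz functions; only first derivatives need be
    computed. *)
Lemma schwartz_coinduction (P : (R -> R) -> Prop) :
  (forall f, P f -> rapid f) ->
  (forall f, P f -> exists2 f', P f' & forall x, is_derive x 1 f (f' x)) ->
  forall f, P f -> schwartz f.
Proof.
move=> Pr Pd f Pf.
have Pn n : P (derive1n n f).
  elim: n => [//|n /Pd [g Pg fg]].
  rewrite derive1nS (_ : derive1 _ = g)//; apply/funext => x.
  by rewrite derive1E; have [_ ->] := fg x.
split=> [n x|m n]; first by have [g _ /(_ x) []] := Pd _ (Pn n).
have [K fK] := Pr _ (Pn n) m; exact: bounded_seminorm fK.
Qed.

Lemma rapid_decays f : rapid f -> decays f.
Proof.
move=> fr; have [K fK] := fr 0; have [L fL] := fr 2.
exists (K + L) => x; rewrite ler_pdivlMr ?oneDsqr_gt0// mulrDr mulr1 lerD//.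
  by have := fK x; rewrite expr0 mul1r.
by have := fL x; rewrite normrM (ger0_norm (sqr_ge0 x)) mulrC.
Qed.

(** Stable under differentiation, since lorentz' = - 2 x lorentz^2. *)
Inductive schwartz_closure : (R -> R) -> Prop :=
| closure_base f of schwartz f : schwartz_closure f
| closure_add f g of schwartz_closure f & schwartz_closure g :
    schwartz_closure (fun x => f x + g x)
| closure_scale c f of schwartz_closure f : schwartz_closure (fun x => c * f x)
| closure_mulx f of schwartz_closure f : schwartz_closure (fun x => x * f x)
| closure_lorentz f of schwartz_closure f : schwartz_closure (fun x => lorentz x * f x).

Lemma schwartz_closureE f : schwartz_closure f -> schwartz f.
Proof.
move: f; apply: schwartz_coinduction => f; elim=> {f}.
- by move=> f sf; exact: (schwartz_rapid f 0).
- move=> f g _ fr _ gr m; have [K fK] := fr m; have [L gL] := gr m.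
  by exists (K + L) => x; rewrite mulrDr (le_trans (ler_normD _ _))// lerD.
- move=> c f _ fr m; have [K fK] := fr m; exists (`|c| * K) => x.
  by rewrite mulrCA normrM ler_wpM2l.
- move=> f _ fr m; have [K fK] := fr m.+1; exists K => x.
  by rewrite mulrA -exprSr.
- move=> f _ fr m; have [K fK] := fr m; exists K => x.
  rewrite mulrCA normrM (ger0_norm (lorentz_ge0 x)) (le_trans _ (fK x))//.
  by rewrite ler_piMl// lorentz_le1.
- move=> f sf; exists (derive1 f); first exact/closure_base/schwartz_derive1.
  by move=> x; exact: (schwartz_der f 0).
- move=> f g _ [f' Pf' ff'] _ [g' Pg' gg']; exists (fun x => f' x + g' x).
    exact: closure_add.
  by move=> x; exact: derD.
- move=> c f _ [f' Pf' ff']; exists (fun x => c * f' x); first exact: closure_scale.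
  by move=> x; exact: derZ.
- move=> f Pf [f' Pf' ff']; exists (fun x => f x + x * f' x).
    by apply: closure_add => //; exact: closure_mulx.
  by move=> x; apply: (der_eq _ (derM (der_id x) (ff' x))); rewrite mul1r.
- move=> f Pf [f' Pf' ff'].
  exists (fun x => lorentz x * f' x + - 2 * (x * (lorentz x * (lorentz x * f x)))).
    apply: closure_add; first exact: closure_lorentz.
    by apply/closure_scale/closure_mulx/closure_lorentz/closure_lorentz.
  by move=> x; apply: (der_eq _ (derM (der_lorentz x) (ff' x))); ring.
Qed.

Lemma schwartz_decays f n : schwartz f -> decays (derive1n n f).
Proof. by move=> sf; apply/rapid_decays/schwartz_rapid. Qed.

Lemma schwartz_mulx f : schwartz f -> schwartz (fun x => x * f x).
Proof. by move=> sf; apply/schwartz_closureE/closure_mulx/closure_base. Qed.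

Lemma schwartz_continuous f : schwartz f -> continuous f.
Proof. by move=> sf; apply: ders_continuous => x; exact: (schwartz_der f 0). Qed.

(** Stable under differentiation (up to sign, which the scalar absorbs), since
    differentiating a transform multiplies the function by x. *)
Inductive transform_closure : (R -> R) -> Prop :=
| closure_cos c f of schwartz f : transform_closure (fun x => c * cos_transform f x)
| closure_sin c f of schwartz f : transform_closure (fun x => c * sin_transform f x).

(** Multiplying a transform by x amounts to differentiating the function. *)
Lemma transform_rapid f : transform_closure f -> rapid f.
Proof.
move=> Pf m; elim: m f Pf => [|m ih] f [] {f} c f sf;
  have cf := schwartz_continuous _ sf; have df := schwartz_decays _ 0 sf;
  have sf' := schwartz_derive1 _ sf; have cf' := schwartz_continuous _ sf';
  have df' := schwartz_decays _ 0 sf';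
  have ff' x : is_derive x 1 f (derive1 f x) by exact: (schwartz_der f 0).
- have [K fK] := boundedZ c _ (cos_transform_bounded _ cf df).
  by exists K => x; rewrite expr0 mul1r.
- have [K fK] := boundedZ c _ (sin_transform_bounded _ cf df).
  by exists K => x; rewrite expr0 mul1r.
- have [K fK] := ih _ (closure_sin (- c) _ sf'); exists K => x.
  rewrite exprSr -mulrA (_ : x * (c * _) = - c * sin_transform (derive1 f) x)//.
  by rewrite (sin_transform_derivative f _ ff' cf' df df'); ring.
- have [K fK] := ih _ (closure_cos c _ sf'); exists K => x.
  rewrite exprSr -mulrA (_ : x * (c * _) = c * cos_transform (derive1 f) x)//.
  by rewrite (cos_transform_derivative f _ ff' cf' df df'); ring.
Qed.

Lemma transform_closureE f : transform_closure f -> schwartz f.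
Proof.
move: f; apply: schwartz_coinduction; first exact: transform_rapid.
move=> _ [] c f sf; have cf := schwartz_continuous _ sf; have df := schwartz_decays _ 0 sf;
  have dxf := schwartz_decays _ 0 (schwartz_mulx _ sf).
- exists (fun x => - c * sin_transform (fun y => y * f y) x).
    exact/closure_sin/schwartz_mulx.
  move=> x; apply: (der_eq _ (derZ c (cos_transform_derive f x cf df dxf))).
  by rewrite mulrN mulNr.
- exists (fun x => c * cos_transform (fun y => y * f y) x).
    exact/closure_cos/schwartz_mulx.
  by move=> x; exact: derZ (sin_transform_derive f x cf df dxf).
Qed.

Lemma schwartz_cos_transform f : schwartz f -> schwartz (cos_transform f).
Proof.
move=> sf; have := transform_closureE _ (closure_cos 1 _ sf).
by under eq_fun do rewrite mul1r.
Qed.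

Lemma schwartz_sin_transform f : schwartz f -> schwartz (sin_transform f).
Proof.
move=> sf; have := transform_closureE _ (closure_sin 1 _ sf).
by under eq_fun do rewrite mul1r.
Qed.

End schwartz_space.

(** * The a priori bound for Schwartz solutions *)

Section schwartz_solutions.
Context {R : realType}.
Local Notation mu := (@lebesgue_measure R).
Implicit Types (f g : R -> R) (K x y t : R).

Lemma lt_ereal_sup_bound (S : set (\bar R)) : (ereal_sup S < +oo)%E ->
  exists K : R, forall y : \bar R, S y -> (y <= K%:E)%E.
Proof.
move=> fin; have [E|neq] := eqVneq (ereal_sup S) -oo%E.
  exists 0 => y Sy; have := ereal_sup_ubound Sy; rewrite E leeNy_eq => /eqP ->.
  exact: leNye.
exists (fine (ereal_sup S)) => y Sy; rewrite fineK; first exact: ereal_sup_ubound.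
by rewrite fin_numE neq lt_eqF.
Qed.

Lemma schwartz_derive1n_continuous f n : schwartz f -> continuous (derive1n n f).
Proof. by move=> sf; exact: ders_continuous (fun x => schwartz_der f n x sf). Qed.

Lemma kdv_uniform_rapid (v : R -> R -> R) (T : R) (m n : nat) : schwartz_kdv_solution v ->
  exists K : R, forall t, 0 <= t <= T -> forall x, `|x ^+ m * derive1n n (v t) x| <= K.
Proof.
move=> [_ vT _ _]; have [K vK] := lt_ereal_sup_bound _ (vT T m n).
exists K => t tT x; rewrite -lee_fin; apply: le_trans (vK (schwartz_seminorm m n (v t)) _).
  by apply: ereal_sup_ubound; exists x.
by exists t => //=; rewrite in_itv.
Qed.

Lemma kdv_uniform_dominated (v : R -> R -> R) (T : R) (n : nat) : schwartz_kdv_solution v ->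
  exists K : R, forall t, 0 <= t <= T -> dominated K (derive1n n (v t)).
Proof.
move=> vs; have [K vK] := kdv_uniform_rapid v T 0 n vs.
have [L vL] := kdv_uniform_rapid v T 2 n vs.
exists (K + L) => t tT x; rewrite ler_pdivlMr ?oneDsqr_gt0// mulrDr mulr1 lerD//.
  by have := vK t tT x; rewrite expr0 mul1r.
by have := vL t tT x; rewrite normrM (ger0_norm (sqr_ge0 x)) mulrC.
Qed.

(** 40 = 4 * 10: the comparison of the two energies at time T costs 4 k^2, the
    bound along the flow costs 10. *)
Lemma schwartz_kdv_bound (v : R -> R -> R) (T k : R) : 0 <= T -> 2 <= k ->
  schwartz_kdv_solution v -> negative_energy (v 0) <= k / 128 ->
  negative_energy (v T) <= 40 * k ^+ 2 * negative_energy (v 0).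
Proof.
move=> T0 k2 vs; have [vS _ vc vt] := vs.
have [K0 vK0] := kdv_uniform_dominated v T 0 vs.
have [K1 vK1] := kdv_uniform_dominated v T 1 vs.
have [K2 vK2] := kdv_uniform_dominated v T 2 vs.
have [K3 vK3] := kdv_uniform_dominated v T 3 vs.
have tS t : 0 <= t <= T -> schwartz (v t) by move=> /andP[t0 _]; exact: vS.
have zT : 0 <= (0 : R) <= T by apply/andP.
have TT : 0 <= T <= T by apply/andP.
have k0 : 0 < k by lra.
have [p pP] : exists p : R -> R -> R, forall t, 0 <= t <= T ->
    dominated K0 (p t) /\ forall x, is_derive x 1 (p t) (v t x - 2 * k * p t x).
  suff [p pP] : {p : R -> R -> R & forall t, 0 <= t <= T ->
    dominated K0 (p t) /\ forall x, is_derive x 1 (p t) (v t x - 2 * k * p t x)} by exists p.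
  apply: (@choice _ _ (fun t p => 0 <= t <= T ->
    dominated K0 p /\ forall x, is_derive x 1 p (v t x - 2 * k * p x))) => t.
  have [tT|nT] := boolP (0 <= t <= T); last by exists (fun=> 0).
  have [|p pK p'] := resolvent_exists (2 * k) K0 (v t) _ (schwartz_continuous _ (tS _ tT)) (vK0 _ tT); first lra.
  by exists p.
have en t : 0 <= t <= T ->
    \int[mu]_x p t x ^+ 2 <= negative_energy (v t) <= 4 * k ^+ 2 * \int[mu]_x p t x ^+ 2.
  move=> tT; have [pK p'] := pP _ tT.
  apply: (resolvent_energy k (v t) (p t)) => //.
  - by lra.
  - by exists K0.
  - exact: schwartz_continuous (tS _ tT).
  - by exists K0; exact: vK0.
move=> e0; have /andP[e1 _] := en _ zT; have /andP[_ e2] := en _ TT.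
have oc t : 0 < t < T -> 0 <= t <= T by move=> /andP[/ltW -> /ltW ->].
have v1' t x : 0 <= t <= T -> is_derive x 1 (v t) (derive1n 1 (v t) x).
  by move=> tT; exact: (schwartz_der (v t) 0 x (tS _ tT)).
have v2' t x : 0 <= t <= T -> is_derive x 1 (derive1n 1 (v t)) (derive1n 2 (v t) x).
  by move=> tT; exact: (schwartz_der (v t) 1 x (tS _ tT)).
have v3' t x : 0 <= t <= T -> is_derive x 1 (derive1n 2 (v t)) (derive1n 3 (v t) x).
  by move=> tT; exact: (schwartz_der (v t) 2 x (tS _ tT)).
have v3c t : 0 <= t <= T -> continuous (derive1n 3 (v t)).
  by move=> tT; exact: schwartz_derive1n_continuous (tS _ tT).
have vd n t : 0 <= t <= T -> decays (derive1n n (v t)).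
  by move=> tT; exact: (schwartz_decays (v t) n (tS _ tT)).
have vL t : 0 < t < T ->
    dominated (6 * K0 * K1 + K3) (fun x => 6 * v t x * derive1n 1 (v t) x - derive1n 3 (v t) x).
  move=> /oc tT; apply: dominatedB; last exact: vK3.
  apply: dominatedM; last exact: vK1.
  move=> x; rewrite normrM ger0_norm// ler_wpM2l//.
  exact: (dominated_bounded _ _ (vK0 _ tT)).
have vtt t x : 0 < t < T ->
    is_derive t 1 (v ^~ x) (6 * v t x * derive1n 1 (v t) x - derive1n 3 (v t) x).
  move=> /andP[t0 _]; have [dv E] := vt t x t0.
  apply: DeriveDef; first exact: dv.
  by rewrite -derive1E; move: E; rewrite derive1n1; clear; lra.
have vcc x : {within `[0, T], continuous (v ^~ x)}.
  apply: continuous_subspaceW (vc x) => t /=.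
  by rewrite in_itv /= => /andP[].
have pK t : 0 <= t <= T -> dominated K0 (p t) by move=> tT; have [] := pP _ tT.
have p' t x : 0 <= t <= T -> is_derive x 1 (p t) (v t x - 2 * k * p t x).
  by move=> tT; have [_] := pP _ tT; exact.
have p0 : \int[mu]_x p 0 x ^+ 2 <= k / 128 by exact: le_trans e0.
have bound : \int[mu]_x p T x ^+ 2 <= 10 * \int[mu]_x p 0 x ^+ 2 :=
  resolvent_energy_bound k T K0 (6 * K0 * K1 + K3) v
    (fun t => derive1n 1 (v t)) (fun t => derive1n 2 (v t)) (fun t => derive1n 3 (v t))
    k2 vK0 v1' v2' v3' v3c (vd 1) (vd 2) (vd 3) vL vtt vcc p T0 pK p' p0.
have k20 : 0 <= k ^+ 2 by exact: sqr_ge0.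
rewrite (le_trans e2)//.
rewrite [leRHS](_ : _ = 4 * k ^+ 2 * (10 * negative_energy (v 0))); last by ring.
have k40 : 0 <= 4 * k ^+ 2 by rewrite mulr_ge0.
by rewrite (ler_wpM2l k40)//; apply: le_trans bound _; rewrite ler_wpM2l.
Qed.

(** The frequency k must be at least 128 times the square of the norm X of the
    data, and the bound grows linearly in k: this is the origin of X + X^3. *)
Lemma schwartz_kdv_bound_sqrt : exists2 C : R, 0 < C &
  forall (v : R -> R -> R) (T X : R), 0 <= T -> 0 <= X ->
  schwartz_kdv_solution v -> negative_energy (v 0) <= X ^+ 2 ->
  negative_energy (v T) <= (C * (X + X ^+ 3)) ^+ 2.
Proof.
pose C : R := 7 * 128.
have C0 : 0 < C by rewrite mulr_gt0.
have CE x y : C * (x + y) = 7 * (128 * x + 128 * y) by rewrite /C; ring.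
exists C => //; move: C C0 CE => C C0 CE v T X T0 X0 vs vX.
pose k := 2 + 128 * X ^+ 2.
have X2 := sqr_ge0 X.
have k2 : 2 <= k by rewrite /k; lra.
have vk : negative_energy (v 0) <= k / 128 by rewrite /k; lra.
apply: le_trans (schwartz_kdv_bound v T k T0 k2 vs vk) _.
have k0 : 0 <= k ^+ 2 by exact: sqr_ge0.
apply: (@le_trans _ _ (40 * k ^+ 2 * X ^+ 2)).
  by apply: ler_wpM2l => //; exact: mulr_ge0.
apply: (@le_trans _ _ ((7 * (k * X)) ^+ 2)).
  have := mulr_ge0 k0 X2; rewrite exprMn exprMn; lra.
have kX : 0 <= 7 * (k * X) by rewrite !mulr_ge0// (le_trans _ k2).
have kX2 : 7 * (k * X) <= C * (X + X ^+ 3).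
  by rewrite CE /k; have := exprn_ge0 3 X0; lra.
by apply: lerXn2r; [rewrite nnegrE|rewrite nnegrE (le_trans kX)|].
Qed.

End schwartz_solutions.

(** * Sobolev norms of distributions *)

Section distributions.
Context {R : realType}.
Local Notation mu := (@lebesgue_measure R).
Implicit Types (f g a b : R -> R) (u w : (R -> R) -> R) (K r s x y t : R).

Definition weighted_modulus s a b (x : R) : R :=
  (1 + x ^+ 2) `^ (s / 2) * Num.sqrt (a x ^+ 2 + b x ^+ 2).

Definition weighted_norm s a b : \bar R :=
  ('N[mu]_(2%:E) [EFin \o weighted_modulus s a b])%E.

(** A strict bound is witnessed by one pair of functions a, b, so that norms of
    distributions are estimated without the uniqueness of their Fourier
    transform. *)
Definition norm_lt s u r := exists a b, is_fourier u a b /\ (weighted_norm s a b < r%:E)%E.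

Lemma sobolev_norm_ltP s u r : (sobolev_norm s u < r%:E)%E <-> norm_lt s u r.
Proof.
split=> [/ereal_inf_lt [_ [a [b [fab ->]]] lt]|[a [b [fab lt]]]]; first by exists a, b.
apply: le_lt_trans lt; apply: ereal_inf_lbound; exists a, b; split => //.
Qed.

Lemma weighted_modulus_ge0 s a b x : 0 <= weighted_modulus s a b x.
Proof. by rewrite mulr_ge0 ?powR_ge0 ?sqrtr_ge0. Qed.

Lemma measurable_weighted_modulus s a b : measurable_fun setT a -> measurable_fun setT b ->
  measurable_fun setT (weighted_modulus s a b).
Proof.
move=> ma mb; apply: measurable_funM.
  apply: (@measurableT_comp _ _ _ _ _ _ (fun x : R => x `^ (s / 2))).
    exact: measurable_powR.
  by apply: measurable_cts; apply: ctsD; [exact: cts_cst|apply: ctsX => x; exact: cvg_id].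
have msqrt : measurable_fun setT (@Num.sqrt R).
  by apply: measurable_cts; exact: sqrt_continuous.
apply: (measurableT_comp msqrt).
by apply: measurable_funD; apply: measurable_funX.
Qed.

Lemma Lnorm2E (F : R -> R) :
  ('N[mu]_(2%:E) [EFin \o F] = (\int[mu]_x (F x ^+ 2)%:E) `^ 2^-1)%E.
Proof.
rewrite unlock; congr (_ `^ _)%E; apply: eq_integral => x _.
by rewrite /= powR_mulrn// real_normK ?num_real.
Qed.

Lemma weighted_normE s a b : weighted_norm s a b =
  ((\int[mu]_x (weighted_modulus s a b x ^+ 2)%:E) `^ 2^-1)%E.
Proof. exact: Lnorm2E. Qed.

Lemma measurable_sqr_modulus s a b : measurable_fun setT a -> measurable_fun setT b ->
  measurable_fun setT (fun x => (weighted_modulus s a b x ^+ 2)%:E).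
Proof.
move=> ma mb; apply/measurable_EFinP; apply: measurable_funX.
exact: measurable_weighted_modulus.
Qed.

Lemma le_weighted_norm s1 s2 a b : s1 <= s2 ->
  measurable_fun setT a -> measurable_fun setT b ->
  (weighted_norm s1 a b <= weighted_norm s2 a b)%E.
Proof.
move=> s12 ma mb; rewrite !weighted_normE.
have nn s : (0 <= \int[mu]_x (weighted_modulus s a b x ^+ 2)%:E)%E.
  by apply: integral_ge0 => x _; rewrite lee_fin sqr_ge0.
apply: gt0_ler_poweR; rewrite ?invr_ge0 ?in_itv/= ?nn ?leey//.
apply: ge0_le_integral => //.
- by move=> x _; rewrite lee_fin sqr_ge0.
- exact: measurable_sqr_modulus.
- exact: measurable_sqr_modulus.
move=> x _; rewrite lee_fin; apply: lerXn2r; rewrite ?nnegrE ?weighted_modulus_ge0//.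
rewrite /weighted_modulus ler_wpM2r ?sqrtr_ge0// ler_powR//; last by rewrite ler_wpM2r.
by rewrite lerDl sqr_ge0.
Qed.

Lemma sqrt_sum_triangle (a b c d : R) :
  Num.sqrt ((a + c) ^+ 2 + (b + d) ^+ 2) <= Num.sqrt (a ^+ 2 + b ^+ 2) + Num.sqrt (c ^+ 2 + d ^+ 2).
Proof.
set A := a ^+ 2 + b ^+ 2; set B := c ^+ 2 + d ^+ 2.
have A0 : 0 <= A by rewrite addr_ge0 ?sqr_ge0.
have B0 : 0 <= B by rewrite addr_ge0 ?sqr_ge0.
rewrite -[leRHS]ger0_norm ?addr_ge0 ?sqrtr_ge0// -sqrtr_sqr ler_wsqrtr//.
have : a * c + b * d <= Num.sqrt A * Num.sqrt B.
  rewrite -sqrtrM// (le_trans (ler_norm _))// -sqrtr_sqr ler_wsqrtr//.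
  rewrite /A /B; have := sqr_ge0 (a * d - b * c); nra.
have := sqr_sqrtr A0; have := sqr_sqrtr B0.
move: (Num.sqrt A) (Num.sqrt B) => al be; rewrite /A /B; lra.
Qed.

Lemma weighted_norm_triangle s a1 b1 a2 b2 :
  measurable_fun setT a1 -> measurable_fun setT b1 ->
  measurable_fun setT a2 -> measurable_fun setT b2 ->
  (weighted_norm s (fun x => a1 x + a2 x)%R (fun x => b1 x + b2 x)%R
   <= weighted_norm s a1 b1 + weighted_norm s a2 b2)%E.
Proof.
move=> ma1 mb1 ma2 mb2.
have m1 := measurable_weighted_modulus s _ _ ma1 mb1.
have m2 := measurable_weighted_modulus s _ _ ma2 mb2.
have m3 := measurable_weighted_modulus s _ _ (measurable_funD ma1 ma2) (measurable_funD mb1 mb2).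
have le12 : (1 <= 2 :> R) by rewrite ler1n.
apply: le_trans (minkowski_EFin mu m1 m2 le12).
rewrite /weighted_norm !Lnorm2E.
have nn (F : R -> R) : (0 <= \int[mu]_x (F x ^+ 2)%:E)%E.
  by apply: integral_ge0 => x _; rewrite lee_fin sqr_ge0.
apply: gt0_ler_poweR; rewrite ?invr_ge0 ?in_itv/= ?nn ?leey//.
apply: ge0_le_integral => //.
- by move=> x _; rewrite lee_fin sqr_ge0.
- by apply/measurable_EFinP; apply: measurable_funX.
- by apply/measurable_EFinP; apply: measurable_funX; exact: measurable_funD.
move=> x _; rewrite lee_fin.
have h3 := weighted_modulus_ge0 s (fun x => a1 x + a2 x) (fun x => b1 x + b2 x) x.
have h12 := addr_ge0 (weighted_modulus_ge0 s a1 b1 x) (weighted_modulus_ge0 s a2 b2 x).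
apply: lerXn2r => //.
by rewrite /= /weighted_modulus -mulrDr ler_wpM2l ?powR_ge0//; exact: sqrt_sum_triangle.
Qed.

Lemma is_fourierD u w a1 b1 a2 b2 : is_fourier u a1 b1 -> is_fourier w a2 b2 ->
  is_fourier (u \+ w) (fun x => a1 x + a2 x) (fun x => b1 x + b2 x).
Proof.
move=> [ma1 mb1 F1] [ma2 mb2 F2]; split.
- exact: measurable_funD.
- exact: measurable_funD.
move=> f sf; have [ia1 ib1 Ea1 Eb1] := F1 _ sf; have [ia2 ib2 Ea2 Eb2] := F2 _ sf.
have Da : (fun x => (a1 x + a2 x) * f x) = (fun x => a1 x * f x + a2 x * f x).
  by apply/funext => x; rewrite mulrDl.
have Db : (fun x => (b1 x + b2 x) * f x) = (fun x => b1 x * f x + b2 x * f x).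
  by apply/funext => x; rewrite mulrDl.
split.
- have := integrableD measurableT ia1 ia2; congr (integrable _ _ _).
  by apply/funext => x /=; rewrite -EFinD mulrDl.
- have := integrableD measurableT ib1 ib2; congr (integrable _ _ _).
  by apply/funext => x /=; rewrite -EFinD mulrDl.
- by rewrite Da RintegralD// Ea1 Ea2.
- by rewrite Db RintegralD// Eb1 Eb2 /= opprD.
Qed.

Lemma is_fourierN u a b : is_fourier u a b ->
  is_fourier (fun f => - u f) (fun x => - a x) (fun x => - b x).
Proof.
move=> [ma mb F]; split.
- exact: measurableT_comp.
- exact: measurableT_comp.
move=> f sf; have [ia ib Ea Eb] := F _ sf.
have Da : (fun x => - a x * f x) = (fun x => -1 * (a x * f x)).
  by apply/funext => x; rewrite mulN1r mulNr.
have Db : (fun x => - b x * f x) = (fun x => -1 * (b x * f x)).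
  by apply/funext => x; rewrite mulN1r mulNr.
split.
- have := integrableN ia; congr (integrable _ _ _).
  by apply/funext => x; rewrite /comp mulNr.
- have := integrableN ib; congr (integrable _ _ _).
  by apply/funext => x; rewrite /comp mulNr.
- by rewrite Da RintegralZl// Ea mulN1r.
- by rewrite Db RintegralZl// Eb mulN1r.
Qed.

(** The Fourier transform is defined through the values of the distribution at
    transforms of Schwartz functions, which are Schwartz functions. *)
Lemma is_fourier_eq_dist u w a b : eq_dist u w -> is_fourier u a b -> is_fourier w a b.
Proof.
move=> uw [ma mb F]; split=> // f sf; have [ia ib Ea Eb] := F _ sf; split=> //.
- by rewrite Ea uw//; exact: schwartz_cos_transform.
- by rewrite Eb uw//; exact: schwartz_sin_transform.
Qed.

Lemma norm_lt_eq_dist s u w r : eq_dist u w -> norm_lt s u r -> norm_lt s w r.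
Proof. by move=> uw [a [b [F lt]]]; exists a, b; split => //; exact: is_fourier_eq_dist F. Qed.

Lemma norm_ltD s u w r1 r2 : norm_lt s u r1 -> norm_lt s w r2 -> norm_lt s (u \+ w) (r1 + r2).
Proof.
move=> [a1 [b1 [F1 lt1]]] [a2 [b2 [F2 lt2]]].
exists (fun x => a1 x + a2 x), (fun x => b1 x + b2 x); split; first exact: is_fourierD.
have [ma1 mb1 _] := F1; have [ma2 mb2 _] := F2.
apply: (le_lt_trans (weighted_norm_triangle s _ _ _ _ ma1 mb1 ma2 mb2)).
by rewrite EFinD; exact: lteD.
Qed.

Lemma norm_ltN s u r : norm_lt s u r -> norm_lt s (fun f => - u f) r.
Proof.
move=> [a [b [F lt]]]; exists (fun x => - a x), (fun x => - b x); split; first exact: is_fourierN.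
rewrite /weighted_norm (_ : weighted_modulus s _ _ = weighted_modulus s a b)//.
by apply/funext => x; rewrite /weighted_modulus !sqrrN.
Qed.

Lemma norm_lt_exponent s1 s2 u r : s1 <= s2 -> norm_lt s2 u r -> norm_lt s1 u r.
Proof.
move=> s12 [a [b [F lt]]]; exists a, b; split=> //; have [ma mb _] := F.
by apply: le_lt_trans lt; exact: le_weighted_norm.
Qed.

Lemma weighted_modulus_sqr a b x :
  weighted_modulus (- 1) a b x ^+ 2 = (a x ^+ 2 + b x ^+ 2) * lorentz x.
Proof.
rewrite /weighted_modulus exprMn sqr_sqrtr ?addr_ge0 ?sqr_ge0// mulrC; congr (_ * _).
rewrite -(powR_mulrn 2 (powR_ge0 _ _)) -powRrM (_ : - 1 / 2 * 2 = - 1); last by field.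
by rewrite powR_inv1 ?(ltW (oneDsqr_gt0 x)).
Qed.

Lemma dist_of_fun_fourier v : schwartz v ->
  is_fourier (dist_of_fun v) (cos_transform v) (fun x => - sin_transform v x).
Proof.
move=> sv; have cv := schwartz_continuous _ sv; have dv := schwartz_decays _ 0 sv.
have cC := cos_transform_continuous _ cv dv; have cS := sin_transform_continuous _ cv dv.
have bC := cos_transform_bounded _ cv dv; have bS := sin_transform_bounded _ cv dv.
split.
- exact: measurable_cts.
- by apply: measurable_cts; exact: ctsN.
move=> f sf; have cf := schwartz_continuous _ sf; have df := schwartz_decays _ 0 sf.
split.
- have [K H] := decaysM _ _ bC df.
  by apply: (integrable_dominated K) H; exact: ctsM.
- have [K H] := decaysM _ _ (boundedN _ bS) df.
  by apply: (integrable_dominated K) H; apply: ctsM => //; exact: ctsN.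
- by rewrite -cos_transform_symmetric.
- rewrite /dist_of_fun sin_transform_symmetric//.
  rewrite -[RHS]mulN1r -decays_integralZ.
  + by apply: eq_Rintegral => x _; rewrite mulN1r mulNr.
  + exact: ctsM.
  + exact: decaysM.
Qed.

Lemma weighted_norm_ltP a b r : 0 < r ->
  (weighted_norm (- 1) a b < r%:E)%E =
  (\int[mu]_x ((a x ^+ 2 + b x ^+ 2) * lorentz x)%:E < (r ^+ 2)%:E)%E.
Proof.
move=> r0; rewrite weighted_normE.
under eq_integral => x _ do rewrite weighted_modulus_sqr.
have : (0 <= \int[mu]_x ((a x ^+ 2 + b x ^+ 2) * lorentz x)%:E)%E.
  by apply: integral_ge0 => x _; rewrite lee_fin mulr_ge0 ?lorentz_ge0// addr_ge0 ?sqr_ge0.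
move: (\int[mu]_x _)%E => [y| |] //.
- rewrite lee_fin => y0; rewrite poweR_EFin !lte_fin powR12_sqrt//.
  by rewrite -[r in LHS](ger0_norm (ltW r0)) -sqrtr_sqr ltr_sqrt// exprn_gt0.
- by move=> _; rewrite poweRyr ?invr_neq0// !ltNge !leey.
Qed.

Lemma negative_energy_integrable v : schwartz v ->
  mu.-integrable setT (EFin \o (fun x => (cos_transform v x ^+ 2 + sin_transform v x ^+ 2) * lorentz x)).
Proof.
move=> sv; have cv := schwartz_continuous _ sv; have dv := schwartz_decays _ 0 sv.
have cC := cos_transform_continuous _ cv dv; have cS := sin_transform_continuous _ cv dv.
have bC := cos_transform_bounded _ cv dv; have bS := sin_transform_bounded _ cv dv.
have dl : decays (@lorentz R) by exists 1 => x; rewrite ger0_norm ?lorentz_ge0// mul1r.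
have [K H] := decaysM _ _ (boundedD _ _ (boundedX2 _ bC) (boundedX2 _ bS)) dl.
apply: integrable_dominated H; apply: ctsM; last exact: lorentz_continuous.
by apply: ctsD; exact: ctsX.
Qed.

Lemma schwartz_norm_lt v r : schwartz v -> 0 < r -> negative_energy v < r ^+ 2 ->
  norm_lt (- 1) (dist_of_fun v) r.
Proof.
move=> sv r0 vr; exists (cos_transform v), (fun x => - sin_transform v x).
split; first exact: dist_of_fun_fourier.
rewrite weighted_norm_ltP//; under eq_integral => x _ do rewrite sqrrN.
rewrite -lte_fin in vr; apply: le_lt_trans vr; rewrite /negative_energy /Rintegral fineK//.
exact: integrable_fin_num (negative_energy_integrable _ sv).
Qed.

(** Any a, b representing the transform of v have the same pairing with the
    Schwartz functions lorentz * v^ as v^ itself, namely the negative energy of v;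
    by a x + b y <= (a^2 + b^2 + x^2 + y^2) / 2 that pairing is at most half the
    squared norm of a, b plus half the negative energy. *)
Lemma norm_lt_schwartz v r : schwartz v -> norm_lt (- 1) (dist_of_fun v) r ->
  0 < r /\ negative_energy v <= r ^+ 2.
Proof.
move=> sv [a [b [[ma mb F] lt]]].
have r0 : 0 < r.
  by rewrite -lte_fin; apply: le_lt_trans lt; exact: Lnorm_ge0.
split=> //; rewrite weighted_norm_ltP// in lt.
have cv := schwartz_continuous _ sv; have dv := schwartz_decays _ 0 sv.
have cC := cos_transform_continuous _ cv dv; have cS := sin_transform_continuous _ cv dv.
have bC := cos_transform_bounded _ cv dv; have bS := sin_transform_bounded _ cv dv.
pose A x := (a x ^+ 2 + b x ^+ 2) * lorentz x.
pose W x := (cos_transform v x ^+ 2 + sin_transform v x ^+ 2) * lorentz x.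
have A0 x : 0 <= A x by rewrite mulr_ge0 ?lorentz_ge0// addr_ge0 ?sqr_ge0.
have mA : measurable_fun setT A.
  apply: measurable_funM; last by apply: measurable_cts; exact: lorentz_continuous.
  by apply: measurable_funD; exact: measurable_funX.
have iA : mu.-integrable setT (EFin \o A).
  apply/integrableP; split; first exact/measurable_EFinP.
  under eq_integral => x _ do rewrite /= ger0_norm//.
  exact: lt_trans lt (ltry _).
have iW : mu.-integrable setT (EFin \o W) := negative_energy_integrable _ sv.
have sf1 : schwartz (fun x => lorentz x * cos_transform v x).
  by apply/schwartz_closureE/closure_lorentz/closure_base/schwartz_cos_transform.
have sf2 : schwartz (fun x => lorentz x * (-1 * sin_transform v x)).
  by apply/schwartz_closureE/closure_lorentz/closure_scale/closure_base/schwartz_sin_transform.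
have [i1 _ E1 _] := F _ sf1; have [_ i2 _ E2] := F _ sf2.
have cf1 := schwartz_continuous _ sf1; have df1 := schwartz_decays _ 0 sf1.
have cf2 := schwartz_continuous _ sf2; have df2 := schwartz_decays _ 0 sf2.
have E : negative_energy v = \int[mu]_x (a x * (lorentz x * cos_transform v x)) +
    \int[mu]_x (b x * (lorentz x * (-1 * sin_transform v x))).
  rewrite E1 E2 /dist_of_fun cos_transform_symmetric// sin_transform_symmetric//.
  rewrite -decays_integralB; last 4 first.
  - exact: ctsM.
  - exact: ctsM.
  - exact: decaysM.
  - exact: decaysM.
  by apply: eq_Rintegral => x _; ring.
have : negative_energy v <= \int[mu]_x (2^-1 * (A x + W x)).
  rewrite E -RintegralD//; apply: le_Rintegral => //.
  - have := integrableD measurableT i1 i2; congr (integrable _ _ _).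
  - have := integrableZl measurableT 2^-1 (integrableD measurableT iA iW).
    by congr (integrable _ _ _); apply/funext => x.
  move=> x _; rewrite /A /W.
  have := mulr_ge0 (addr_ge0 (sqr_ge0 (a x - cos_transform v x)) (sqr_ge0 (b x + sin_transform v x)))
    (lorentz_ge0 x).
  by clear; lra.
have -> : \int[mu]_x (2^-1 * (A x + W x)) = 2^-1 * (\int[mu]_x A x + negative_energy v).
  rewrite RintegralZl//; last by have := integrableD measurableT iA iW; congr (integrable _ _ _).
  by rewrite RintegralD.
have : \int[mu]_x A x <= r ^+ 2.
  by rewrite -lee_fin /Rintegral fineK ?(ltW lt)//; exact: integrable_fin_num iA.
by clear; lra.
Qed.

End distributions.

(** * Passage to the limit *)

Section limit.
Context {R : realType}.
Implicit Types (u : (R -> R) -> R) (s r t : R).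

Lemma ereal_sup_cvg0_lt (F : nat -> \bar R) (e : R) : 0 < e ->
  F n @[n --> \oo] --> 0%E -> exists n, (F n < e%:E)%E.
Proof.
move=> e0 F0.
have e0' : (0 < e%:E)%E by rewrite lte_fin.
have [n _ Fn] : \forall n \near \oo, (F n < e%:E)%E := F0 _ (open_ereal_lt' e0').
by exists n; apply: Fn => /=.
Qed.

(** Compare u with a Schwartz solution that is e-close to it at the times 0 and
    t. *)
Lemma kdv_solution_norm_lt (C : R) :
  (forall (v : R -> R -> R) (T X : R), 0 <= T -> 0 <= X ->
    schwartz_kdv_solution v -> negative_energy (v 0) <= X ^+ 2 ->
    negative_energy (v T) <= (C * (X + X ^+ 3)) ^+ 2) -> 0 < C ->
  forall (s : R) (u0 : (R -> R) -> R) (u : R -> (R -> R) -> R) (t r e : R),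
  - 1 <= s -> kdv_solution s u0 u -> 0 <= t -> 0 < e -> norm_lt (- 1) u0 r ->
  norm_lt (- 1) (u t) (C * ((r + e) + (r + e) ^+ 3) + 2 * e).
Proof.
move=> bound C0 s u0 u t r e s1 [_ _ uu0 [v [vs vu]]] t0 e0 ur.
have [n vn] := ereal_sup_cvg0_lt _ _ e0 (vu t t0).
have near c : 0 <= c -> c <= t -> norm_lt (- 1) (dist_of_fun (v n c) \- u c) e.
  move=> c0 ct; apply: (norm_lt_exponent (- 1) s _ _ s1); apply/sobolev_norm_ltP.
  apply: le_lt_trans vn; apply: ereal_sup_ubound; exists c => //=.
  by rewrite in_itv /= c0.
have [vS _ _ _] := vs n.
have u0r : norm_lt (- 1) (u 0) r.
  by apply: norm_lt_eq_dist ur => f sf; rewrite uu0.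
have v0r : norm_lt (- 1) (dist_of_fun (v n 0)) (r + e).
  have := norm_ltD _ _ _ _ _ u0r (near 0 (lexx _) t0).
  by congr (norm_lt _ _ _); apply/funext => f /=; rewrite addrC subrK.
have [re0 E0] := norm_lt_schwartz _ _ (vS 0 (lexx _)) v0r.
have Et := bound (v n) t (r + e) t0 (ltW re0) (vs n) E0.
have vtr : norm_lt (- 1) (dist_of_fun (v n t)) (C * ((r + e) + (r + e) ^+ 3) + e).
  have p0 : 0 <= C * ((r + e) + (r + e) ^+ 3).
    by rewrite mulr_ge0 ?(ltW C0)// addr_ge0 ?(ltW re0)// exprn_ge0// ltW.
  apply: schwartz_norm_lt; [exact: vS|by rewrite ltr_wpDl|].
  by apply: le_lt_trans Et _; rewrite ltr_pXn2r ?nnegrE ?ltrDl// ltW// ltr_wpDl.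
have := norm_ltD _ _ _ _ _ vtr (norm_ltN _ _ _ (near t t0 (lexx _))).
have -> : C * (r + e + (r + e) ^+ 3) + 2 * e = C * (r + e + (r + e) ^+ 3) + e + e by ring.
by congr (norm_lt _ _ _); apply/funext => f /=; rewrite opprB addrC subrK.
Qed.

Lemma sobolev_norm_ge0 s u : (0 <= sobolev_norm s u)%E.
Proof.
by apply: le_ereal_inf_tmp => _ [a [b [_ ->]]]; exact: Lnorm_ge0.
Qed.

End limit.

Theorem theorem1 (R : realType) :
  exists2 C : R, 0 < C &
    forall (s : R) (u0 : (R -> R) -> R) (u : R -> (R -> R) -> R),
      - (3 / 4) <= s -> kdv_solution s u0 u ->
      forall t : R, 0 <= t ->
        (sobolev_norm (- 1) (u t) <=
           C%:E * (sobolev_norm (- 1) u0 + sobolev_norm (- 1) u0 ^+ 3))%E.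
Proof.
have [C C0 bound] := @schwartz_kdv_bound_sqrt R.
exists C => // s u0 u s34 ku t t0.
have s1 : - 1 <= s by apply: le_trans s34; lra.
have [[_ fin] _ _ _] := ku.
have N0 := sobolev_norm_ge0 (- 1) u0.
have Nfin : sobolev_norm (- 1) u0 \is a fin_num.
  rewrite ge0_fin_numE//; rewrite -ge0_fin_numE ?sobolev_norm_ge0// in fin.
  have /sobolev_norm_ltP : (sobolev_norm s u0 < (fine (sobolev_norm s u0) + 1)%:E)%E.
    by rewrite EFinD fineK// lteDl// lte_fin.
  by move=> /(norm_lt_exponent _ _ _ _ s1) /sobolev_norm_ltP /lt_trans; apply; exact: ltry.
set N := fine (sobolev_norm (- 1) u0).
have NE : sobolev_norm (- 1) u0 = N%:E by rewrite fineK.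
have N0' : 0 <= N by rewrite fine_ge0.
rewrite NE -EFin_expe -EFinD -EFinM.
apply/lee_addgt0Pr => eta eta0.
(* for e <= 1, the bound at N + 2 e exceeds the bound at N by at most M e *)
pose M := C * (2 + 2 * (3 * N ^+ 2 + 6 * N + 4)) + 2.
have M0 : 0 < M.
  by rewrite ltr_wpDl// mulr_ge0 ?(ltW C0)// !addr_ge0// !mulr_ge0// !addr_ge0 ?mulr_ge0// sqr_ge0.
pose e := Num.min 1 (eta / M).
have e0 : 0 < e by rewrite lt_min ltr01 divr_gt0.
have e1 : e <= 1 by rewrite ge_min lexx.
have eM : M * e <= eta.
  by rewrite mulrC -ler_pdivlMr// ge_min lexx orbT.
have u0r : norm_lt (- 1) u0 (N + e).
  by apply/sobolev_norm_ltP; rewrite NE lte_fin ltrDl.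
have /sobolev_norm_ltP /ltW := kdv_solution_norm_lt C bound C0 s u0 u t _ e s1 ku t0 e0 u0r.
move=> /le_trans; apply; rewrite -EFinD lee_fin.
apply: (@le_trans _ _ (C * (N + N ^+ 3) + M * e)); last by rewrite lerD2l.
have h : (N + e + e) + (N + e + e) ^+ 3 <= N + N ^+ 3 + (2 + 2 * (3 * N ^+ 2 + 6 * N + 4)) * e.
  have e2 : e ^+ 2 <= e by rewrite expr2 ler_piMl// ltW.
  have e3 : e ^+ 3 <= e by rewrite exprS ler_piMr ?(ltW e0)// (le_trans e2).
  have := mulr_ge0 N0' (ltW e0).
  have : N * e ^+ 2 <= N * e by rewrite ler_wpM2l.
  have -> : (N + e + e) ^+ 3 = N ^+ 3 + 6 * (N ^+ 2 * e) + 12 * (N * e ^+ 2) + 8 * e ^+ 3 by ring.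
  by lra.
have := ler_wpM2l (ltW C0) h; rewrite /M; lra.
Qed.
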